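(* Let $(M,\mathcal{T})$ be a closed pseudo $3$-manifold such that $v(e)\ge 9$ for every edge $e\in E$. Then there exists a zero-curvature hyper-ideal metric $l\in\mathcal{L}(M,\mathcal{T})$, which is unique in $\mathbb{R}^E_{>0}$ (no other $l'\in\mathbb{R}^E_{>0}$ has $\widetilde K_e(l')=0$ for all $e\in E$). Moreover, for each $e\in E$, $$l_e\in\left[\operatorname{arccosh}(1+\mu_{v(e)}),\ \operatorname{arccosh}(b_{v(e)})\right]\subset(0,\operatorname{arccosh}2].$$ In this case, for every initial data $l^0\in\mathbb{R}^E_{>0}$, the solution $l(t)$ of the extended Ricci flow converges to $l$ exponentially fast as $t\to\infty$.
   Context: A closed pseudo $3$-manifold $(M,\mathcal{T})$: take a finite disjoint union $\widehat{\mathcal{T}}=\bigsqcup_{i=1}^n\sigma_i$ of tetrahedra, partition the $4n$ faces into $2n$ pairs and glue each pair by an affine homeomorphism; $\mathcal{T}$ is the quotient complex and $M$ its underlying space. Let $E$ be the edge set of $\mathcal{T}$, $P_E$ the quotient map from edges of $\widehat{\mathcal{T}}$ to $E$, and $v(e)=|P_E^{-1}(e)|$ the valence. A generalized hyper-ideal metric is a vector $l\in\mathbb{R}^E_{>0}$; each edge $\hat e$ of $\widehat{\mathcal{T}}$ then receives length $l_{P_E(\hat e)}$. For a tetrahedron of $\widehat{\mathcal{T}}$ with vertices $i,j,k,h$ let $x_{ab}=\cosh$ (length of edge $ab$), and set $$\phi_{ij}=\frac{x_{ik}x_{ih}+x_{jk}x_{jh}+x_{ij}x_{ik}x_{jh}+x_{ij}x_{ih}x_{jk}-x_{ij}^2x_{kh}+x_{kh}}{\sqrt{2x_{ij}x_{ik}x_{jk}+x_{ij}^2+x_{ik}^2+x_{jk}^2-1}\sqrt{2x_{ij}x_{ih}x_{jh}+x_{ij}^2+x_{ih}^2+x_{jh}^2-1}}.$$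 The (extended) dihedral angle at edge $ij$ is $\alpha_{ij}=\arccos(\max\{-1,\min\{\phi_{ij},1\}\})$. The generalized Ricci curvature is $\widetilde K_e(l)=2\pi-\sum_{\hat e\in P_E^{-1}(e)}\alpha(\hat e)$. The set $\mathcal{L}(M,\mathcal{T})$ of hyper-ideal metrics consists of those $l$ for which every $\phi_{ij}$ of every tetrahedron lies in $(-1,1)$ (then each tetrahedron is an actual hyper-ideal hyperbolic tetrahedron with these edge lengths and dihedral angles); a zero-curvature hyper-ideal metric is $l\in\mathcal{L}(M,\mathcal{T})$ with $\widetilde K_e(l)=0$ for all $e$. The extended Ricci flow is $\frac{d}{dt}l_e(t)=\widetilde K_e(l(t))\,l_e(t)$ for all $e\in E$, $l(0)=l^0\in\mathbb{R}^E_{>0}$; it has a unique solution for all $t\ge0$. Constants: $b_9=2$ and $b_n=\frac{16}{1+\cos(2\pi/n)}-7$ for $n\ge10$. For $\xi\ge0$ and $y\in(0,1)$ let $\eta_\xi(y)$ be the unique positive root $\delta$ of $(2+y)\delta^2+2(2+5y-(1+\xi)^2)\delta-4(1-y)(1+\xi)^2=0$, i.e. $\eta_\xi(y)=\frac{-2-5y+(1+\xi)^2+\sqrt{(2+5y-(1+\xi)^2)^2+4(2+y)(1-y)(1+\xi)^2}}{2+y}$. Let $\xi_1=0$, $\xi_{k+1}=\eta_{\xi_k}(\cos(2\pi/9))$, and $\xi_\infty=\lim_k\xi_k$ (this sequence is nondecreasing and bounded). Set $\mu_n=\eta_{\xi_\infty}(\cos(2\pi/n))$ for $n\ge9$. 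*)

(* Defs.v *)
From HB Require Import structures.
From mathcomp Require Import all_boot all_order all_algebra all_fingroup.
From mathcomp Require Import all_classical all_reals all_analysis.
Set Implicit Arguments. Unset Strict Implicit. Unset Printing Implicit Defensive.
Import Order.TTheory GRing.Theory Num.Theory.
Import numFieldNormedType.Exports.
Local Open Scope ring_scope.

(* Tetrahedra are indexed by 'I_n, their vertices by 'I_4.  The face of
   tetrahedron i opposite to vertex v is (i, v).  A gluing is a fixed-point
   free involution [pr] on faces together with, for each face f, a vertex
   bijection [sg f] : 'I_4 -> 'I_4 sending the vertices of f onto those of
   [pr f] (equivalently sg f maps the opposite vertex to the opposite vertex);
   the gluing of pr f back to f is the inverse map.  The affine homeomorphism
   between the two faces is the affine extension of this vertex bijection. *)

Definition face (n : nat) := ('I_n * 'I_4)%type.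

Definition is_gluing (n : nat) (pr : face n -> face n)
  (sg : face n -> {perm 'I_4}) : Prop :=
  forall f : face n,
    [/\ pr f != f, pr (pr f) = f, sg f f.2 = (pr f).2 & sg (pr f) = (sg f)^-1%g].

(* Edges of the disjoint union: (i, s) with s a 2-element set of vertices. *)
Definition hatEdge (n : nat) := ('I_n * {set 'I_4})%type.
Definition hatE (n : nat) : {set hatEdge n} := [set x : hatEdge n | #|x.2| == 2%N].

(* x is identified with y through the face (x.1, v) (which contains x when
   v \notin x.2). *)
Definition adj n (pr : face n -> face n) (sg : face n -> {perm 'I_4})
  (x y : hatEdge n) : bool :=
  [exists v : 'I_4, (v \notin x.2) &&
     (y == ((pr (x.1, v)).1, (sg (x.1, v)) @: x.2))].

Definition glue (n : nat) (pr : face n -> face n) (sg : face n -> {perm 'I_4})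
  (x y : hatEdge n) : bool :=
  adj pr sg x y || adj pr sg y x.

Definition cls (n : nat) (pr : face n -> face n) (sg : face n -> {perm 'I_4})
  (x : hatEdge n) : {set hatEdge n} :=
  [set y | connect (glue pr sg) x y].

Definition edgeSet (n : nat) (pr : face n -> face n) (sg : face n -> {perm 'I_4})
  : {set {set hatEdge n}} :=
  [set cls pr sg x | x in hatE n].

Definition Edge n (pr : face n -> face n) (sg : face n -> {perm 'I_4}) :=
  {X : {set hatEdge n} | X \in edgeSet pr sg}.

Definition preE (n : nat) (pr : face n -> face n) (sg : face n -> {perm 'I_4})
  (e : Edge pr sg) : {set hatEdge n} :=
  [set x in hatE n | cls pr sg x == val e].

Definition valence (n : nat) (pr : face n -> face n) (sg : face n -> {perm 'I_4})
  (e : Edge pr sg) : nat := #|preE e|.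

Section Reals.
Variable R : realType.

Definition cosh (x : R) : R := (expR x + expR (- x)) / 2.
Definition arccosh (y : R) : R := ln (y + Num.sqrt (y ^+ 2 - 1)).

(* length assigned to the edge x of \hat T (l_{P_E(x)}); x is always an
   actual edge when this is used, so the default 0 is never reached *)
Definition lenOf (n : nat) (pr : face n -> face n) (sg : face n -> {perm 'I_4})
  (l : Edge pr sg -> R) (x : hatEdge n) : R :=
  match insub (cls pr sg x) : option (Edge pr sg) with
  | Some e => l e
  | None => 0
  end.

(* phi_{ij} for a tetrahedron with vertices i j k h, x_{ab} = cosh l_{ab} *)
Definition phi_formula (xij xik xih xjk xjh xkh : R) : R :=
  (xik * xih + xjk * xjh + xij * xik * xjh + xij * xih * xjk
     - xij ^+ 2 * xkh + xkh) /
  (Num.sqrt (2 * xij * xik * xjk + xij ^+ 2 + xik ^+ 2 + xjk ^+ 2 - 1) *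
   Num.sqrt (2 * xij * xih * xjh + xij ^+ 2 + xih ^+ 2 + xjh ^+ 2 - 1)).

(* phi at the edge x = (t, {i, j}) of tetrahedron t; k, h are the two
   remaining vertices (the formula is symmetric in i<->j and in k<->h) *)
Definition phi (n : nat) (pr : face n -> face n) (sg : face n -> {perm 'I_4})
  (l : Edge pr sg -> R) (x : hatEdge n) : R :=
  let t := x.1 in
  let i := nth ord0 (enum x.2) 0 in
  let j := nth ord0 (enum x.2) 1 in
  let k := nth ord0 (enum (~: x.2)) 0 in
  let h := nth ord0 (enum (~: x.2)) 1 in
  let X (a b : 'I_4) := cosh (lenOf l (t, [set a; b])) in
  phi_formula (X i j) (X i k) (X i h) (X j k) (X j h) (X k h).

Definition alpha (n : nat) (pr : face n -> face n) (sg : face n -> {perm 'I_4})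
  (l : Edge pr sg -> R) (x : hatEdge n) : R :=
  acos (Num.max (-1) (Num.min (phi l x) 1)).

Definition curv (n : nat) (pr : face n -> face n) (sg : face n -> {perm 'I_4})
  (l : Edge pr sg -> R) (e : Edge pr sg) : R :=
  2 * pi - \sum_(x in preE e) alpha l x.

Definition hyperideal (n : nat) (pr : face n -> face n) (sg : face n -> {perm 'I_4})
  (l : Edge pr sg -> R) : Prop :=
  (forall e, 0 < l e) /\ forall x : hatEdge n, x \in hatE n -> -1 < phi l x < 1.

Definition bconst (m : nat) : R :=
  if m == 9%N then 2 else 16 / (1 + cos (2 * pi / m%:R)) - 7.

Definition eta (xi y : R) : R :=
  (- 2 - 5 * y + (1 + xi) ^+ 2 +
   Num.sqrt ((2 + 5 * y - (1 + xi) ^+ 2) ^+ 2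
             + 4 * (2 + y) * (1 - y) * (1 + xi) ^+ 2)) / (2 + y).

(* xi_seq k = xi_{k+1} *)
Fixpoint xi_seq (k : nat) : R :=
  match k with
  | 0%N => 0
  | k'.+1 => eta (xi_seq k') (cos (2 * pi / 9%:R))
  end.

Definition xi_inf : R := limn xi_seq.

Definition mu (m : nat) : R := eta xi_inf (cos (2 * pi / m%:R)).

End Reals.

(* Main.v *)
Require Import Defs.
From HB Require Import structures.
From mathcomp Require Import all_boot all_order all_algebra all_fingroup.
From mathcomp Require Import all_classical all_reals all_analysis.
From mathcomp Require Import ring lra.
Import Order.TTheory GRing.Theory Num.Theory.
Import numFieldNormedType.Exports.
Local Open Scope ring_scope.
Local Open Scope classical_set_scope.

(* Where the determinant of the Gram matrix of a tetrahedron is negative, the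
   Jacobian of its dihedral angles with respect to its edge lengths is symmetric
   and positive definite; elsewhere all angles are 0 or pi.  Along any segment of
   lengths the pairing of the angles with the direction is therefore
   nondecreasing, and it grows at a definite rate as long as the segment stays
   near a compact set of hyper-ideal lengths.  Summed over the tetrahedra, this
   makes the curvature K strongly monotone.

   For small tau the map l |-> clamp (l + tau K(l)) onto the box
   [arccosh (1 + mu_v), arccosh b_v] is thus a contraction.  The formula for phi is
   monotone in each variable on [1, 2]^6, which gives K the inward sign at the
   lower faces of the box and at the upper faces of valence at least 10, so the
   fixed point has K >= 0, with K > 0 at most at edges of valence 9 and
   cosh l = 2.  Around such an edge two adjacent tetrahedra would have total angle
   less than 4 pi / 9 there, and comparison with the extremal tetrahedron shows
   that an edge of their common face has negative curvature, a contradiction.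

   Coercivity of K around the solution z gives uniqueness, and along the flow
   sum (l - z - z ln (l / z)) has derivative sum (l - z) K, hence decays
   exponentially. *)

(** Segments of lengths may leave the hyper-ideal region, so monotonicity has to survive a region
    where the angles are not differentiable; what helps there is that they take only two values.
    Positive definiteness comes from the link of a vertex, a hyperbolic triangle whose angle cosines
    are normalized cofactors of the Gram matrix. Two opposite obtuse edges escape the direct
    argument and are reached by deformation.

    The box is dictated by bounds valid for one tetrahedron: if all cosh are in [1, 2] and x is the
    cosh at an edge, the cosine of the angle there lies between 2 (2 - x) / (1 + x) and (9 - x) / (7
    + x). Equating the second with cos (2 pi / n) gives b_n for n >= 10; the first is at least cos
    (2 pi / n) when x <= 1 + mu_n. For n = 9 the upper solution would exceed 2, beyond the range of
    the bounds, and at x = 2 a tetrahedron can have the angle arccos (7 / 9) < 2 pi / 9. This is why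
    valence 9 needs two neighbouring tetrahedra. *)

Set Implicit Arguments.
Unset Strict Implicit.
Unset Printing Implicit Defensive.

(* Labels of the edges of a tetrahedron 1234; opposite edges are consecutive. *)
Record six (T : Type) := Six {e12 : T; e34 : T; e13 : T; e24 : T; e14 : T; e23 : T}.

(* [swapij] is the action of the transposition of the vertices i and j. *)
Definition swap12 T (x : six T) := Six (e12 x) (e34 x) (e23 x) (e14 x) (e24 x) (e13 x).
Definition swap23 T (x : six T) := Six (e13 x) (e24 x) (e12 x) (e34 x) (e14 x) (e23 x).
Definition swap34 T (x : six T) := Six (e12 x) (e34 x) (e14 x) (e23 x) (e13 x) (e24 x).

(** * The Jacobian of the dihedral angles and its inverse *)

Section Tetrahedron.
Variable R : realFieldType.
Implicit Types x y z : six R.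

Definition face_det (p q r : R) := 2 * p * q * r + p ^+ 2 + q ^+ 2 + r ^+ 2 - 1.

(** Up to sign, the minor of the Gram matrix (unit diagonal, entries -x_ab) with row k and column h
    deleted. *)
Definition phi_num (ij ik ih jk jh kh : R) :=
  ik * ih + jk * jh + ij * ik * jh + ij * ih * jk - ij ^+ 2 * kh + kh.

Definition n12 x := phi_num (e12 x) (e13 x) (e14 x) (e23 x) (e24 x) (e34 x).
Definition n34 x := phi_num (e34 x) (e13 x) (e23 x) (e14 x) (e24 x) (e12 x).
Definition n13 x := phi_num (e13 x) (e12 x) (e14 x) (e23 x) (e34 x) (e24 x).
Definition n24 x := phi_num (e24 x) (e12 x) (e23 x) (e14 x) (e34 x) (e13 x).
Definition n14 x := phi_num (e14 x) (e12 x) (e13 x) (e24 x) (e34 x) (e23 x).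
Definition n23 x := phi_num (e23 x) (e12 x) (e24 x) (e13 x) (e34 x) (e14 x).

(* [fdk] is minus the Gram determinant of the face opposite to vertex k. *)
Definition fd1 x := face_det (e23 x) (e24 x) (e34 x).
Definition fd2 x := face_det (e13 x) (e14 x) (e34 x).
Definition fd3 x := face_det (e12 x) (e14 x) (e24 x).
Definition fd4 x := face_det (e12 x) (e13 x) (e23 x).

(* Minus the determinant of the Gram matrix of the four vertices; among the
   labels [> 1], its positivity singles out the hyper-ideal tetrahedra. *)
Definition ngram x := fd1 x + e12 x * n34 x + e13 x * n24 x + e14 x * n23 x.

Definition sh2 (t : R) := t ^+ 2 - 1.

Definition E12 x :=
  n23 x * (e23 x + e12 x * e13 x) / fd4 x + n24 x * (e24 x + e12 x * e14 x) / fd3 x.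
Definition E34 x :=
  n14 x * (e14 x + e13 x * e34 x) / fd2 x + n24 x * (e24 x + e23 x * e34 x) / fd1 x.
Definition E13 x :=
  n23 x * (e23 x + e12 x * e13 x) / fd4 x + n34 x * (e34 x + e13 x * e14 x) / fd2 x.
Definition E24 x :=
  n14 x * (e14 x + e12 x * e24 x) / fd3 x + n34 x * (e34 x + e23 x * e24 x) / fd1 x.
Definition E14 x :=
  n24 x * (e24 x + e12 x * e14 x) / fd3 x + n34 x * (e34 x + e13 x * e14 x) / fd2 x.
Definition E23 x :=
  n13 x * (e13 x + e12 x * e23 x) / fd4 x + n34 x * (e34 x + e23 x * e24 x) / fd1 x.

(* When the hyperbolic cosines [x] of the lengths move with velocity [y], the
   angle at edge ij has derivative [eij (zeta x y) / sqrt (ngram x * sh2 (eij x))]. *)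
Definition zeta x y : six R := Six
  (E12 x * e12 y + sh2 (e12 x) * (e34 y
    - n23 x / fd4 x * e13 y - n24 x / fd3 x * e14 y
    - n13 x / fd4 x * e23 y - n14 x / fd3 x * e24 y))
  (E34 x * e34 y + sh2 (e34 x) * (e12 y
    - n14 x / fd2 x * e13 y - n13 x / fd2 x * e14 y
    - n24 x / fd1 x * e23 y - n23 x / fd1 x * e24 y))
  (E13 x * e13 y + sh2 (e13 x) * (e24 y
    - n23 x / fd4 x * e12 y - n12 x / fd4 x * e23 y
    - n34 x / fd2 x * e14 y - n14 x / fd2 x * e34 y))
  (E24 x * e24 y + sh2 (e24 x) * (e13 y
    - n14 x / fd3 x * e12 y - n12 x / fd3 x * e14 y
    - n34 x / fd1 x * e23 y - n23 x / fd1 x * e34 y))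
  (E14 x * e14 y + sh2 (e14 x) * (e23 y
    - n24 x / fd3 x * e12 y - n12 x / fd3 x * e24 y
    - n34 x / fd2 x * e13 y - n13 x / fd2 x * e34 y))
  (E23 x * e23 y + sh2 (e23 x) * (e14 y
    - n13 x / fd4 x * e12 y - n12 x / fd4 x * e13 y
    - n34 x / fd1 x * e24 y - n24 x / fd1 x * e34 y)).

Arguments zeta : simpl never.

Definition P12 x := e13 x * e24 x + e14 x * e23 x
  + e12 x * (e13 x * e14 x + e23 x * e24 x).

(** One row of the inverse of [zeta x]: up to the factor [ngram x] its entries are polynomials, so
    the face determinants disappear from the denominators and the quadratic form can be read off
    from the angle velocities. *)
Lemma zeta_inv x y :
  fd1 x != 0 -> fd2 x != 0 -> fd3 x != 0 -> fd4 x != 0 ->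
  let z := zeta x y in
  ngram x * e12 y = P12 x * e12 z + sh2 (e12 x) *
    (- e34 z + e14 x * e13 z + e23 x * e24 z + e13 x * e14 z + e24 x * e23 z).
Proof.
move=> h1 h2 h3 h4 z.
(* The six identities express row 12 of the inverse times each column of [zeta x]: [ngram x] on the
   diagonal and zero elsewhere, common factors removed. *)
have c12 : P12 x * E12 x + sh2 (e12 x) * (- sh2 (e34 x)
   - e14 x * sh2 (e13 x) * (n23 x / fd4 x) - e23 x * sh2 (e24 x) * (n14 x / fd3 x)
   - e13 x * sh2 (e14 x) * (n24 x / fd3 x) - e24 x * sh2 (e23 x) * (n13 x / fd4 x))
   = ngram x.
  rewrite /E12; move: h3 h4; case: x {z h1 h2} => a A b B c C.
  rewrite /ngram /P12 /sh2 /n12 /n34 /n13 /n24 /n14 /n23 /fd1 /fd2 /fd3 /fd4 /phi_num /face_det /= => h3 h4.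
  field. rewrite h3 h4 //.
have c34 : P12 x + (- E34 x
   - e14 x * sh2 (e13 x) * (n14 x / fd2 x) - e23 x * sh2 (e24 x) * (n23 x / fd1 x)
   - e13 x * sh2 (e14 x) * (n13 x / fd2 x) - e24 x * sh2 (e23 x) * (n24 x / fd1 x))
   = 0.
  rewrite /E34; move: h1 h2; case: x {z h3 h4 c12} => a A b B c C.
  rewrite /ngram /P12 /sh2 /n12 /n34 /n13 /n24 /n14 /n23 /fd1 /fd2 /fd3 /fd4 /phi_num /face_det /= => h3 h4.
  field. rewrite h3 h4 //.
have c13 : - (n23 x / fd4 x) * P12 x + (sh2 (e34 x) * (n14 x / fd2 x)
   + e14 x * E13 x + e23 x * sh2 (e24 x)
   - e13 x * sh2 (e14 x) * (n34 x / fd2 x) - e24 x * sh2 (e23 x) * (n12 x / fd4 x))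
   = 0.
  rewrite /E13; move: h2 h4; case: x {z h1 h3 c12 c34} => a A b B c C.
  rewrite /ngram /P12 /sh2 /n12 /n34 /n13 /n24 /n14 /n23 /fd1 /fd2 /fd3 /fd4 /phi_num /face_det /= => h3 h4.
  field. rewrite h3 h4 //.
have c24 : - (n14 x / fd3 x) * P12 x + (sh2 (e34 x) * (n23 x / fd1 x)
   + e14 x * sh2 (e13 x) + e23 x * E24 x
   - e13 x * sh2 (e14 x) * (n12 x / fd3 x) - e24 x * sh2 (e23 x) * (n34 x / fd1 x))
   = 0.
  rewrite /E24; move: h1 h3; case: x {z h2 h4 c12 c34 c13} => a A b B c C.
  rewrite /ngram /P12 /sh2 /n12 /n34 /n13 /n24 /n14 /n23 /fd1 /fd2 /fd3 /fd4 /phi_num /face_det /= => h3 h4.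
  field. rewrite h3 h4 //.
have c14 : - (n24 x / fd3 x) * P12 x + (sh2 (e34 x) * (n13 x / fd2 x)
   - e14 x * sh2 (e13 x) * (n34 x / fd2 x) - e23 x * sh2 (e24 x) * (n12 x / fd3 x)
   + e13 x * E14 x + e24 x * sh2 (e23 x))
   = 0.
  rewrite /E14; move: h2 h3; case: x {z h1 h4 c12 c34 c13 c24} => a A b B c C.
  rewrite /ngram /P12 /sh2 /n12 /n34 /n13 /n24 /n14 /n23 /fd1 /fd2 /fd3 /fd4 /phi_num /face_det /= => h3 h4.
  field. rewrite h3 h4 //.
have c23 : - (n13 x / fd4 x) * P12 x + (sh2 (e34 x) * (n24 x / fd1 x)
   - e14 x * sh2 (e13 x) * (n12 x / fd4 x) - e23 x * sh2 (e24 x) * (n34 x / fd1 x)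
   + e13 x * sh2 (e14 x) + e24 x * E23 x)
   = 0.
  rewrite /E23; move: h1 h4; case: x {z h2 h3 c12 c34 c13 c24 c14} => a A b B c C.
  rewrite /ngram /P12 /sh2 /n12 /n34 /n13 /n24 /n14 /n23 /fd1 /fd2 /fd3 /fd4 /phi_num /face_det /= => h3 h4.
  field. rewrite h3 h4 //.
rewrite -c12 /z /zeta /=.
rewrite -[LHS]addr0 -(mulr0 (sh2 (e12 x) * e34 y)) -c34.
rewrite -[LHS]addr0 -(mulr0 (sh2 (e12 x) * e13 y)) -c13.
rewrite -[LHS]addr0 -(mulr0 (sh2 (e12 x) * e24 y)) -c24.
rewrite -[LHS]addr0 -(mulr0 (sh2 (e12 x) * e14 y)) -c14.
rewrite -[LHS]addr0 -(mulr0 (sh2 (e12 x) * e23 y)) -c23.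
ring.
Qed.

End Tetrahedron.

Ltac unfold_tet := rewrite /ngram /P12 /sh2 /n12 /n34 /n13 /n24 /n14 /n23
  /fd1 /fd2 /fd3 /fd4 /phi_num /face_det /=.

(** * Symmetries, vertex links and a block decomposition of the quadratic form *)

Section TetrahedronIdentities.
Variable R : realFieldType.
Implicit Types x y z : six R.

(** The Desnanot-Jacobi identity for the Gram matrix, with rows and columns 3 and 4 deleted. *)
Lemma n12_sqr x : n12 x ^+ 2 = fd3 x * fd4 x - ngram x * sh2 (e12 x).
Proof.
case: x => a A b B c C.
rewrite /ngram /sh2 /n12 /n34 /n24 /n23 /fd1 /fd3 /fd4 /phi_num /face_det /=; ring.
Qed.



(** The three transpositions generate the symmetric group on the vertices, so a fact about edge 12
    or vertex 1 can be transported to any other edge or vertex. *)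
Lemma swap12E x : [/\ [/\ n12 (swap12 x) = n12 x, n34 (swap12 x) = n34 x
    & n13 (swap12 x) = n23 x], [/\ n24 (swap12 x) = n14 x,
    n14 (swap12 x) = n24 x & n23 (swap12 x) = n13 x],
    [/\ fd1 (swap12 x) = fd2 x, fd2 (swap12 x) = fd1 x, fd3 (swap12 x) = fd3 x
    & fd4 (swap12 x) = fd4 x] & ngram (swap12 x) = ngram x].
Proof. by case: x => *; do 2?split; unfold_tet; ring. Qed.

Lemma swap23E x : [/\ [/\ n12 (swap23 x) = n13 x, n34 (swap23 x) = n24 x
    & n13 (swap23 x) = n12 x], [/\ n24 (swap23 x) = n34 x,
    n14 (swap23 x) = n14 x & n23 (swap23 x) = n23 x],
    [/\ fd1 (swap23 x) = fd1 x, fd2 (swap23 x) = fd3 x, fd3 (swap23 x) = fd2 x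
    & fd4 (swap23 x) = fd4 x] & ngram (swap23 x) = ngram x].
Proof. by case: x => *; do 2?split; unfold_tet; ring. Qed.

Lemma swap34E x : [/\ [/\ n12 (swap34 x) = n12 x, n34 (swap34 x) = n34 x
    & n13 (swap34 x) = n14 x], [/\ n24 (swap34 x) = n23 x,
    n14 (swap34 x) = n13 x & n23 (swap34 x) = n24 x],
    [/\ fd1 (swap34 x) = fd1 x, fd2 (swap34 x) = fd2 x, fd3 (swap34 x) = fd4 x
    & fd4 (swap34 x) = fd3 x] & ngram (swap34 x) = ngram x].
Proof. by case: x => *; do 2?split; unfold_tet; ring. Qed.

Definition posdet x := [&& fd1 x != 0, fd2 x != 0, fd3 x != 0 & fd4 x != 0].

(** The definition of [E12] reads the two faces at edge 12 from vertex 1. Reading them from vertex 2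
    gives the same value, which is what makes [zeta] commute with [swap12]; the next two identities
    serve the other transpositions. *)
Lemma E12_alt x : fd3 x != 0 -> fd4 x != 0 ->
  E12 x = n13 x * (e13 x + e12 x * e23 x) / fd4 x + n14 x * (e14 x + e12 x * e24 x) / fd3 x.
Proof.
case: x => a A b B c C; rewrite /E12; unfold_tet => h3 h4.
by field; rewrite h3 h4.
Qed.

Lemma E34_alt x : fd1 x != 0 -> fd2 x != 0 ->
  E34 x = n13 x * (e13 x + e14 x * e34 x) / fd2 x + n23 x * (e23 x + e24 x * e34 x) / fd1 x.
Proof.
case: x => a A b B c C; rewrite /E34; unfold_tet => h3 h4.
by field; rewrite h3 h4.
Qed.

Lemma E23_alt x : fd1 x != 0 -> fd4 x != 0 ->
  E23 x = n12 x * (e12 x + e13 x * e23 x) / fd4 x + n24 x * (e24 x + e23 x * e34 x) / fd1 x.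
Proof.
case: x => a A b B c C; rewrite /E23; unfold_tet => h3 h4.
by field; rewrite h3 h4.
Qed.

Lemma zeta_swap12 x y : posdet x -> zeta (swap12 x) (swap12 y) = swap12 (zeta x y).
Proof.
case/and4P=> h1 h2 h3 h4.
have [[p12 p34 p13] [p24 p14 p23] [q1 q2 q3 q4] _] := swap12E x.
rewrite /zeta /= (E12_alt h3 h4) /E12 /E34 /E13 /E24 /E14 /E23
  ?p12 ?p34 ?p13 ?p24 ?p14 ?p23 ?q1 ?q2 ?q3 ?q4 /swap12 /=.
by congr Six; ring.
Qed.

Lemma zeta_swap23 x y : posdet x -> zeta (swap23 x) (swap23 y) = swap23 (zeta x y).
Proof.
case/and4P=> h1 h2 h3 h4.
have [[p12 p34 p13] [p24 p14 p23] [q1 q2 q3 q4] _] := swap23E x.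
rewrite /zeta /= (E23_alt h1 h4) /E12 /E34 /E13 /E24 /E14 /E23
  ?p12 ?p34 ?p13 ?p24 ?p14 ?p23 ?q1 ?q2 ?q3 ?q4 /swap23 /=.
by congr Six; ring.
Qed.

Lemma zeta_swap34 x y : posdet x -> zeta (swap34 x) (swap34 y) = swap34 (zeta x y).
Proof.
case/and4P=> h1 h2 h3 h4.
have [[p12 p34 p13] [p24 p14 p23] [q1 q2 q3 q4] _] := swap34E x.
rewrite /zeta /= (E34_alt h1 h2) /E12 /E34 /E13 /E24 /E14 /E23
  ?p12 ?p34 ?p13 ?p24 ?p14 ?p23 ?q1 ?q2 ?q3 ?q4 /swap34 /=.
by congr Six; ring.
Qed.


Definition gt1 x := [&& 1 < e12 x, 1 < e34 x, 1 < e13 x, 1 < e24 x, 1 < e14 x & 1 < e23 x].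

Lemma gt1P x : gt1 x -> [/\ [/\ 1 < e12 x, 1 < e34 x & 1 < e13 x],
  1 < e24 x, 1 < e14 x & 1 < e23 x].
Proof. by case/andP=> ? /and5P[]. Qed.

(** Dividing by [sh2] makes the matrix of [zeta x] symmetric. For y the velocity of the cosh along a
    segment of lengths, this is [Num.sqrt (ngram x)] times the derivative of the pairing of the
    angles with the direction. *)
Definition qform x y := let z := zeta x y in
  e12 y * e12 z / sh2 (e12 x) + e34 y * e34 z / sh2 (e34 x)
  + e13 y * e13 z / sh2 (e13 x) + e24 y * e24 z / sh2 (e24 x)
  + e14 y * e14 z / sh2 (e14 x) + e23 y * e23 z / sh2 (e23 x).

Lemma sh2_gt0 (t : R) : 1 < t -> 0 < sh2 t.
Proof. by rewrite /sh2 => t1; nra. Qed.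

Lemma face_det_ge4 (p q r : R) : 1 <= p -> 1 <= q -> 1 <= r -> 4 <= face_det p q r.
Proof.
rewrite /face_det => p1 q1 r1.
have pq : 1 <= p * q by nra.
have pqr : 1 <= p * q * r by nra.
by nra.
Qed.

Lemma face_det_gt0 (p q r : R) : 1 < p -> 1 < q -> 1 < r -> 0 < face_det p q r.
Proof.
by move=> p1 q1 r1; apply: lt_le_trans (face_det_ge4 (ltW p1) (ltW q1) (ltW r1)); lra.
Qed.

Lemma gt1_fd x : gt1 x -> [/\ 0 < fd1 x, 0 < fd2 x, 0 < fd3 x & 0 < fd4 x].
Proof. by case/gt1P => -[*] *; split; apply: face_det_gt0. Qed.

Lemma gt1_sh2 x : gt1 x -> [/\ [/\ 0 < sh2 (e12 x), 0 < sh2 (e34 x) & 0 < sh2 (e13 x)],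
  0 < sh2 (e24 x), 0 < sh2 (e14 x) & 0 < sh2 (e23 x)].
Proof. by case/gt1P => -[*] *; do 2?split; apply: sh2_gt0. Qed.

Lemma gt1_posdet x : gt1 x -> posdet x.
Proof. by case/gt1_fd => *; apply/and4P; split; apply: lt0r_neq0. Qed.

Lemma gt1_swap12 x : gt1 (swap12 x) = gt1 x.
Proof. by rewrite /gt1 /=; do 6?[case: (_ < _)]. Qed.
Lemma gt1_swap23 x : gt1 (swap23 x) = gt1 x.
Proof. by rewrite /gt1 /=; do 6?[case: (_ < _)]. Qed.
Lemma gt1_swap34 x : gt1 (swap34 x) = gt1 x.
Proof. by rewrite /gt1 /=; do 6?[case: (_ < _)]. Qed.

Lemma qform_swap12 x y : gt1 x -> qform (swap12 x) (swap12 y) = qform x y.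
Proof. by move=> /gt1_posdet h; rewrite /qform zeta_swap12 //=; ring. Qed.
Lemma qform_swap23 x y : gt1 x -> qform (swap23 x) (swap23 y) = qform x y.
Proof. by move=> /gt1_posdet h; rewrite /qform zeta_swap23 //=; ring. Qed.
Lemma qform_swap34 x y : gt1 x -> qform (swap34 x) (swap34 y) = qform x y.
Proof. by move=> /gt1_posdet h; rewrite /qform zeta_swap34 //=; ring. Qed.

(* If two of three cosines were nonpositive, the third relation would force
   [a3 ^+ 2 >= f1 * f2]. *)
Lemma acute_of_obtuse (a1 a2 a3 f1 f2 : R) : 0 < f1 -> 0 < f2 -> a3 ^+ 2 < f1 * f2 ->
  0 < a1 * f1 + a2 * a3 -> 0 < a2 * f2 + a1 * a3 -> a1 <= 0 -> 0 < a2.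
Proof.
move=> f10 f20 a32 r1 r2 a10; rewrite ltNge; apply/negP => a20.
have p1 : 0 <= - a1 by rewrite oppr_ge0.
have p2 : 0 <= - a2 by rewrite oppr_ge0.
have h : 0 < a2 * a3 by nra.
have p30 : 0 < - a3 by nra.
have p2' : 0 < - a2 by nra.
have s1 : (- a1) * f1 < (- a2) * (- a3) by nra.
have s2 : (- a2) * f2 < (- a1) * (- a3) by nra.
have p1' : 0 < - a1 by nra.
have : ((- a1) * f1) * ((- a2) * f2) < ((- a2) * (- a3)) * ((- a1) * (- a3)).
  by apply: ltr_pM => //; nra.
have : 0 < a1 * a2 by nra.
nra.
Qed.

(** Jacobi's identity for 2 by 2 minors of the adjugate. Normalized, it is the law of cosines cos A
    + cos B cos C = sin B sin C cosh a in the triangle truncating vertex 1, whose right side is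
    positive. *)
Lemma link_relations x : [/\
  n12 x * fd2 x + n13 x * n14 x = ngram x * (e34 x + e13 x * e14 x),
  n13 x * fd3 x + n12 x * n14 x = ngram x * (e24 x + e12 x * e14 x) &
  n14 x * fd4 x + n12 x * n13 x = ngram x * (e23 x + e12 x * e13 x)].
Proof. by case: x => *; split; unfold_tet; ring. Qed.

(** The angles at 12, 13, 14 are those of a hyperbolic triangle, so at most one of them is not
    acute; vertex 2 gives the other two edges. Hence edges with nonpositive cosine never share a
    vertex. *)
Lemma n12_le0 x : gt1 x -> 0 < ngram x -> n12 x <= 0 ->
  [/\ 0 < n13 x, 0 < n14 x, 0 < n23 x & 0 < n24 x].
Proof.
have aux z : gt1 z -> 0 < ngram z -> n12 z <= 0 -> 0 < n13 z.
  move=> z1 D0 n0; have [r1 r2 r3] := link_relations z.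
  have [f1 f2 f3 f4] := gt1_fd z1; have [[a1 A1 b1] B1 c1 C1] := gt1P z1.
  apply: (@acute_of_obtuse (n12 z) (n13 z) (n14 z) (fd2 z) (fd3 z)) => //.
  - have -> : n14 z ^+ 2 = fd2 z * fd3 z - ngram z * sh2 (e14 z).
      by case: z {z1 D0 n0 r1 r2 r3 f1 f2 f3 f4 a1 A1 b1 B1 c1 C1} => *; unfold_tet; ring.
    have : 0 < ngram z * sh2 (e14 z) by apply: mulr_gt0 => //; apply: sh2_gt0.
    by rewrite /=; lra.
  - by rewrite r1; apply: mulr_gt0 => //; nra.
  - by rewrite r2; apply: mulr_gt0 => //; nra.
move=> x1 D0 n0.
have [[p12 p34 p13] [p24 p14 p23] _ gg] := swap34E x.
have [[p12' p34' p13'] [p24' p14' p23'] _ gg'] := swap12E x.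
have [[p12'' p34'' p13''] [p24'' p14'' p23''] _ gg''] := swap12E (swap34 x).
split; first exact: aux.
- by rewrite -p13; apply: aux; rewrite ?gt1_swap34 ?gg ?p12.
- by rewrite -p13'; apply: aux; rewrite ?gt1_swap12 ?gg' ?p12'.
- by rewrite -p23 -p13''; apply: aux; rewrite ?gt1_swap12 ?gt1_swap34 ?gg'' ?gg ?p12'' ?p12.
Qed.

(** Sylvester's criterion: multiplied by the first two leading minors, the form becomes a positive
    combination of squares. *)
Lemma sym3_gt0 (m11 m22 m33 m12 m13 m23 u1 u2 u3 : R) :
  0 < m11 -> 0 < m11 * m22 - m12 ^+ 2 ->
  0 < m11 * (m22 * m33 - m23 ^+ 2) - m12 * (m12 * m33 - m13 * m23)
      + m13 * (m12 * m23 - m13 * m22) ->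
  (u1 != 0) || (u2 != 0) || (u3 != 0) ->
  0 < m11 * u1 ^+ 2 + m22 * u2 ^+ 2 + m33 * u3 ^+ 2
      + 2 * (m12 * u1 * u2 + m13 * u1 * u3 + m23 * u2 * u3).
Proof.
set M2 := m11 * m22 - _; set M3 := (X in _ -> _ -> 0 < X -> _) => h1 h2 h3 u0.
have key : m11 * M2 * (m11 * u1 ^+ 2 + m22 * u2 ^+ 2 + m33 * u3 ^+ 2
      + 2 * (m12 * u1 * u2 + m13 * u1 * u3 + m23 * u2 * u3)) =
  M2 * (m11 * u1 + m12 * u2 + m13 * u3) ^+ 2
  + (M2 * u2 + (m11 * m23 - m12 * m13) * u3) ^+ 2 + m11 * M3 * u3 ^+ 2.
  by rewrite /M2 /M3; ring.
have p : 0 < m11 * M2 by apply: mulr_gt0.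
rewrite -(pmulr_rgt0 _ p) key.
have s1 := mulr_ge0 (ltW h2) (sqr_ge0 (m11 * u1 + m12 * u2 + m13 * u3)).
have s2 := sqr_ge0 (M2 * u2 + (m11 * m23 - m12 * m13) * u3).
have p3 : 0 < m11 * M3 by apply: mulr_gt0.
have [z3|z3] := eqVneq u3 0; last first.
  have : 0 < m11 * M3 * u3 ^+ 2 by apply: mulr_gt0 => //; rewrite exprn_even_gt0.
  lra.
rewrite z3 !mulr0 !addr0 expr0n /= mulr0 addr0 in s1 s2 *.
have [z2|z2] := eqVneq u2 0; last first.
  have : 0 < (M2 * u2) ^+ 2 by rewrite exprn_even_gt0 //= mulf_neq0 // lt0r_neq0.
  lra.
move: u0; rewrite z2 z3 eqxx !orbF => u10.
rewrite !mulr0 !addr0 expr0n /= addr0.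
by apply: mulr_gt0 => //; rewrite exprn_even_gt0 //= mulf_neq0 // lt0r_neq0.
Qed.

Lemma sym3_solve (m11 m22 m33 m12 m13 m23 r1 r2 r3 : R) :
  0 < m11 * (m22 * m33 - m23 ^+ 2) - m12 * (m12 * m33 - m13 * m23)
      + m13 * (m12 * m23 - m13 * m22) ->
  exists u : R * R * R, [/\
    m11 * u.1.1 + m12 * u.1.2 + m13 * u.2 = r1,
    m12 * u.1.1 + m22 * u.1.2 + m23 * u.2 = r2 &
    m13 * u.1.1 + m23 * u.1.2 + m33 * u.2 = r3].
Proof.
set d := (X in 0 < X) => d0; have dn0 := lt0r_neq0 d0.
exists (((r1 * (m22 * m33 - m23 ^+ 2) - m12 * (r2 * m33 - r3 * m23) + m13 * (r2 * m23 - r3 * m22)) / d,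
  (m11 * (r2 * m33 - r3 * m23) - r1 * (m12 * m33 - m13 * m23) + m13 * (m12 * r3 - m13 * r2)) / d),
  (m11 * (m22 * r3 - m23 * r2) - m12 * (m12 * r3 - m13 * r2) + r1 * (m12 * m23 - m13 * m22)) / d) => /=.
by rewrite /d in dn0 *; split; field.
Qed.

(** The left side is the determinant of the link form at vertex 1 with denominators cleared; the
    right side is visibly positive for positive labels. *)
Lemma link_det (a A b B c C : R) : let x := Six a A b B c C in
  let ea := A + B * C in let eb := B + A * C in let ec := C + A * B in
  n34 x ^+ 2 * (n24 x * (B + a * c) * fd4 x + n23 x * (C + a * b) * fd3 x)
  + n24 x ^+ 2 * (n34 x * (A + b * c) * fd4 x + n23 x * (C + a * b) * fd2 x)
  + n23 x ^+ 2 * (n34 x * (A + b * c) * fd3 x + n24 x * (B + a * c) * fd2 x)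
  + 2 * n34 x * n24 x * n23 x * ((A + b * c) * (B + a * c) * (C + a * b) - sh2 a * sh2 b * sh2 c)
  = ngram x ^+ 2 * (a ^+ 2 * (b * eb + c * ec) + b ^+ 2 * (a * ea + c * ec) + c ^+ 2 * (a * ea + b * eb)
   + 2 * a * b * c * (1 + A * B * C)).
Proof.
rewrite /ngram /sh2 /n12 /n13 /n14 /n34 /n24 /n23 /fd1 /fd2 /fd3 /fd4 /phi_num /face_det /=.
ring.
Qed.

Definition P13 x := P12 (swap23 x).
Definition P14 x := P12 (swap23 (swap34 x)).
Definition P23 x := P12 (swap23 (swap12 x)).
Definition P24 x := P12 (swap23 (swap12 (swap34 x))).
Definition P34 x := P12 (swap23 (swap12 (swap34 (swap23 x)))).

Lemma zeta_invs x y : gt1 x -> let z := zeta x y in let D := ngram x in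
  [/\ [/\ D * e12 y = P12 x * e12 z + sh2 (e12 x) *
      (- e34 z + e14 x * e13 z + e23 x * e24 z + e13 x * e14 z + e24 x * e23 z),
     D * e34 y = P34 x * e34 z + sh2 (e34 x) *
      (- e12 z + e23 x * e13 z + e14 x * e24 z + e24 x * e14 z + e13 x * e23 z) &
     D * e13 y = P13 x * e13 z + sh2 (e13 x) *
      (- e24 z + e14 x * e12 z + e23 x * e34 z + e12 x * e14 z + e34 x * e23 z)],
     D * e24 y = P24 x * e24 z + sh2 (e24 x) *
      (- e13 z + e14 x * e34 z + e23 x * e12 z + e34 x * e14 z + e12 x * e23 z),
     D * e14 y = P14 x * e14 z + sh2 (e14 x) *
      (- e23 z + e12 x * e13 z + e34 x * e24 z + e13 x * e12 z + e24 x * e34 z) &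
     D * e23 y = P23 x * e23 z + sh2 (e23 x) *
      (- e14 z + e34 x * e13 z + e12 x * e24 z + e24 x * e12 z + e13 x * e34 z)].
Proof.
move=> x1 z D.
have inv u v : gt1 u -> let z := zeta u v in
  ngram u * e12 v = P12 u * e12 z + sh2 (e12 u) *
    (- e34 z + e14 u * e13 z + e23 u * e24 z + e13 u * e14 z + e24 u * e23 z).
  by move=> /gt1_fd[? ? ? ?]; apply: zeta_inv; apply: lt0r_neq0.
have g12 (u : six R) : ngram (swap12 u) = ngram u by case: (swap12E u).
have g23 (u : six R) : ngram (swap23 u) = ngram u by case: (swap23E u).
have g34 (u : six R) : ngram (swap34 u) = ngram u by case: (swap34E u).
split; first split.
- exact: inv.
- move: (inv (swap23 (swap12 (swap34 (swap23 x)))) (swap23 (swap12 (swap34 (swap23 y))))).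
  rewrite !(gt1_swap12, gt1_swap23, gt1_swap34) => /(_ x1).
  rewrite !(zeta_swap12, zeta_swap23, zeta_swap34) ?gt1_posdet ?(gt1_swap12, gt1_swap23, gt1_swap34) //.
  by rewrite !(g12, g23, g34) /= -/z -/D -/(P34 x) => ->; ring.
- move: (inv (swap23 x) (swap23 y)).
  rewrite !(gt1_swap12, gt1_swap23, gt1_swap34) => /(_ x1).
  rewrite !(zeta_swap12, zeta_swap23, zeta_swap34) ?gt1_posdet ?(gt1_swap12, gt1_swap23, gt1_swap34) //.
  by rewrite !(g12, g23, g34) /= -/z -/D -/(P13 x) => ->; ring.
- move: (inv (swap23 (swap12 (swap34 x))) (swap23 (swap12 (swap34 y)))).
  rewrite !(gt1_swap12, gt1_swap23, gt1_swap34) => /(_ x1).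
  rewrite !(zeta_swap12, zeta_swap23, zeta_swap34) ?gt1_posdet ?(gt1_swap12, gt1_swap23, gt1_swap34) //.
  by rewrite !(g12, g23, g34) /= -/z -/D -/(P24 x) => ->; ring.
- move: (inv (swap23 (swap34 x)) (swap23 (swap34 y))).
  rewrite !(gt1_swap12, gt1_swap23, gt1_swap34) => /(_ x1).
  rewrite !(zeta_swap12, zeta_swap23, zeta_swap34) ?gt1_posdet ?(gt1_swap12, gt1_swap23, gt1_swap34) //.
  by rewrite !(g12, g23, g34) /= -/z -/D -/(P14 x) => ->; ring.
- move: (inv (swap23 (swap12 x)) (swap23 (swap12 y))).
  rewrite !(gt1_swap12, gt1_swap23, gt1_swap34) => /(_ x1).
  rewrite !(zeta_swap12, zeta_swap23, zeta_swap34) ?gt1_posdet ?(gt1_swap12, gt1_swap23, gt1_swap34) //.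
  by rewrite !(g12, g23, g34) /= -/z -/D -/(P23 x) => ->; ring.
Qed.

(** In the variables t / sqrt w and t' / sqrt w' the smallest eigenvalue is e - sqrt (w w'), that is
    (e^2 - w w') / (e + sqrt (w w')), whose denominator is at most 2 e. *)
Lemma pair_form_ge (e w w' t t' : R) : 0 < w -> 0 < w' -> 0 < e -> w * w' < e ^+ 2 ->
  (e ^+ 2 - w * w') / (2 * e) * (t ^+ 2 / w + t' ^+ 2 / w')
    <= e * (t ^+ 2 / w + t' ^+ 2 / w') + 2 * t * t'.
Proof.
move=> w0 w0' e0 F0.
have [wn wn' en] : [/\ w != 0, w' != 0 & e != 0] by split; apply: lt0r_neq0.
rewrite -subr_ge0.
set s := e ^+ 2 + w * w'.
have s0 : 0 < s by rewrite /s; nra.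
have -> : e * (t ^+ 2 / w + t' ^+ 2 / w') + 2 * t * t'
    - (e ^+ 2 - w * w') / (2 * e) * (t ^+ 2 / w + t' ^+ 2 / w')
  = (s * t ^+ 2 * w' + s * t' ^+ 2 * w + 4 * e * (w * w') * t * t') / (2 * e * (w * w')).
  by rewrite /s; field; rewrite wn wn' en.
apply: divr_ge0; last by have := mulr_gt0 e0 (mulr_gt0 w0 w0'); lra.
rewrite -(pmulr_rge0 _ s0).
have -> : s * (s * t ^+ 2 * w' + s * t' ^+ 2 * w + 4 * e * (w * w') * t * t') =
  w' * (s * t + 2 * e * w * t') ^+ 2 + w * (e ^+ 2 - w * w') ^+ 2 * t' ^+ 2 by rewrite /s; ring.
apply: addr_ge0; first by apply: mulr_ge0; [exact: ltW | exact: sqr_ge0].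
by apply: mulr_ge0 (sqr_ge0 _); apply: mulr_ge0 (sqr_ge0 _); exact: ltW.
Qed.

(* The link of vertex 1: moving that vertex with the opposite face fixed. *)
Definition sform x (u : R * R * R) :=
  E12 x / sh2 (e12 x) * u.1.1 ^+ 2 + E13 x / sh2 (e13 x) * u.1.2 ^+ 2
  + E14 x / sh2 (e14 x) * u.2 ^+ 2
  + 2 * (- (n23 x / fd4 x) * u.1.1 * u.1.2 + - (n24 x / fd3 x) * u.1.1 * u.2
         + - (n34 x / fd2 x) * u.1.2 * u.2).

Definition sminor2 x := E12 x / sh2 (e12 x) * (E13 x / sh2 (e13 x)) - (n23 x / fd4 x) ^+ 2.

Lemma sdet_gt0 x : gt1 x -> 0 < ngram x ->
  let m11 := E12 x / sh2 (e12 x) in let m22 := E13 x / sh2 (e13 x) in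
  let m33 := E14 x / sh2 (e14 x) in
  let m12 := - (n23 x / fd4 x) in let m13 := - (n24 x / fd3 x) in
  let m23 := - (n34 x / fd2 x) in
  0 < m11 * (m22 * m33 - m23 ^+ 2) - m12 * (m12 * m33 - m13 * m23)
      + m13 * (m12 * m23 - m13 * m22).
Proof.
move=> x1 D0 /=; set d := (X in 0 < X).
have [f1 f2 f3 f4] := gt1_fd x1; have [[w1 _ w3] _ w5 _] := gt1_sh2 x1.
have := gt1P x1.
have [nf2 nf3 nf4] : [/\ fd2 x != 0, fd3 x != 0 & fd4 x != 0] by split; apply: lt0r_neq0.
have [nw1 nw3 nw5] : [/\ sh2 (e12 x) != 0, sh2 (e13 x) != 0 & sh2 (e14 x) != 0]
  by split; apply: lt0r_neq0.
have p : 0 < sh2 (e12 x) * sh2 (e13 x) * sh2 (e14 x) * (fd2 x * fd3 x * fd4 x)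
  by rewrite !mulr_gt0.
have key := link_det (e12 x) (e34 x) (e13 x) (e24 x) (e14 x) (e23 x).
have ex : Six (e12 x) (e34 x) (e13 x) (e24 x) (e14 x) (e23 x) = x by case: (x).
rewrite ex in key.
have -> : d = ngram x ^+ 2 * (e12 x ^+ 2 * (e13 x * (e24 x + e34 x * e23 x) + e14 x * (e23 x + e34 x * e24 x))
  + e13 x ^+ 2 * (e12 x * (e34 x + e24 x * e23 x) + e14 x * (e23 x + e34 x * e24 x))
  + e14 x ^+ 2 * (e12 x * (e34 x + e24 x * e23 x) + e13 x * (e24 x + e34 x * e23 x))
   + 2 * e12 x * e13 x * e14 x * (1 + e34 x * e24 x * e23 x))
   / (sh2 (e12 x) * sh2 (e13 x) * sh2 (e14 x) * (fd2 x * fd3 x * fd4 x)).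
  rewrite -key /d /E12 /E13 /E14.
  have l12 : (e23 x + e12 x * e13 x) ^+ 2 = fd4 x + sh2 (e12 x) * sh2 (e13 x)
    by rewrite /fd4 /face_det /sh2; ring.
  have l13 : (e24 x + e12 x * e14 x) ^+ 2 = fd3 x + sh2 (e12 x) * sh2 (e14 x)
    by rewrite /fd3 /face_det /sh2; ring.
  have l23 : (e34 x + e13 x * e14 x) ^+ 2 = fd2 x + sh2 (e13 x) * sh2 (e14 x)
    by rewrite /fd2 /face_det /sh2; ring.
  apply: (mulIf (lt0r_neq0 p)); rewrite divfK ?lt0r_neq0 //.
  move: l12 l13 l23 nf2 nf3 nf4 nw1 nw3 nw5.
  move: (e23 x + _) (e24 x + _) (e34 x + _) (fd2 x) (fd3 x) (fd4 x) => p12 p13 p23 F2 F3 F4.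
  move: (sh2 (e12 x)) (sh2 (e13 x)) (sh2 (e14 x)) (n23 x) (n24 x) (n34 x) => v1 v2 v3 N3 N2 N1.
  move=> l12 l13 l23 nf2 nf3 nf4 nw1 nw3 nw5.
  (* Once the face determinants are eliminated, the identity holds in free variables. *)
  have eF2 : F2 = p23 ^+ 2 - v2 * v3 by rewrite l23 addrK.
  have eF3 : F3 = p13 ^+ 2 - v1 * v3 by rewrite l13 addrK.
  have eF4 : F4 = p12 ^+ 2 - v1 * v2 by rewrite l12 addrK.
  rewrite {}eF2 {}eF3 {}eF4 in nf2 nf3 nf4 *.
  by field; rewrite nf2 nf3 nf4 nw1 nw3 nw5.
move=> [[a A b] B c C].
apply: divr_gt0 => //; apply: mulr_gt0; first by rewrite exprn_gt0.
have pos (t : R) : 1 < t -> 0 < t by lra.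
move: a A b B c C => /pos a /pos A /pos b /pos B /pos c /pos C.
by do ?[apply: addr_gt0 | apply: mulr_gt0 | apply: exprn_gt0] => //; do ?apply: mulr_gt0.
Qed.

(** Splitting [P34] as e14 (e23 + e34 e24) + e13 (e24 + e34 e23), and likewise [P24] and [P23],
    decomposes the form into three pair forms with weights e14, e13, e12. All three have the same
    discriminant [fd1 x]. *)
Lemma facet_form_ge x (z34 z24 z23 : R) : gt1 x ->
  fd1 x / 2 * (e14 x / (e23 x + e34 x * e24 x) * (z34 ^+ 2 / sh2 (e34 x) + z24 ^+ 2 / sh2 (e24 x))
   + e13 x / (e24 x + e34 x * e23 x) * (z34 ^+ 2 / sh2 (e34 x) + z23 ^+ 2 / sh2 (e23 x))
   + e12 x / (e34 x + e24 x * e23 x) * (z24 ^+ 2 / sh2 (e24 x) + z23 ^+ 2 / sh2 (e23 x)))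
  <= P34 x * z34 ^+ 2 / sh2 (e34 x) + P24 x * z24 ^+ 2 / sh2 (e24 x)
     + P23 x * z23 ^+ 2 / sh2 (e23 x)
     + 2 * (e14 x * z34 * z24 + e13 x * z34 * z23 + e12 x * z24 * z23).
Proof.
move=> x1; have [[_ w2 _] w4 _ w6] := gt1_sh2 x1.
have [[a A b] B c C] := gt1P x1; have [f1 _ _ _] := gt1_fd x1.
have h1 : 0 < e23 x + e34 x * e24 x by nra.
have h2 : 0 < e24 x + e34 x * e23 x by nra.
have h3 : 0 < e34 x + e24 x * e23 x by nra.
have d1 : (e23 x + e34 x * e24 x) ^+ 2 - sh2 (e34 x) * sh2 (e24 x) = fd1 x
  by rewrite /sh2 /fd1 /face_det; ring.
have d2 : (e24 x + e34 x * e23 x) ^+ 2 - sh2 (e34 x) * sh2 (e23 x) = fd1 x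
  by rewrite /sh2 /fd1 /face_det; ring.
have d3 : (e34 x + e24 x * e23 x) ^+ 2 - sh2 (e24 x) * sh2 (e23 x) = fd1 x
  by rewrite /sh2 /fd1 /face_det; ring.
have := pair_form_ge z34 z24 w2 w4 h1; rewrite -subr_gt0 d1 => /(_ f1) p1.
have := pair_form_ge z34 z23 w2 w6 h2; rewrite -subr_gt0 d2 => /(_ f1) p2.
have := pair_form_ge z24 z23 w4 w6 h3; rewrite -subr_gt0 d3 => /(_ f1) p3.
have a0 : 0 <= e12 x by lra.
have b0 : 0 <= e13 x by lra.
have c0 : 0 <= e14 x by lra.
have := lerD (lerD (ler_wpM2l c0 p1) (ler_wpM2l b0 p2)) (ler_wpM2l a0 p3).
have [n1 n2 n3] : [/\ e23 x + e34 x * e24 x != 0, e24 x + e34 x * e23 x != 0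
  & e34 x + e24 x * e23 x != 0] by split; apply: lt0r_neq0.
have [m1 m2 m3] : [/\ sh2 (e34 x) != 0, sh2 (e24 x) != 0 & sh2 (e23 x) != 0]
  by split; apply: lt0r_neq0.
rewrite -subr_ge0 => h; rewrite -subr_ge0; apply: le_trans h _.
rewrite le_eqVlt; apply/orP; left; apply/eqP.
rewrite /P34 /P24 /P23 /P12 /=.
by field; rewrite n1 n2 n3 m1 m2 m3.
Qed.

Definition link_part y (u : R * R * R) : six R :=
  Six (e12 y - u.1.1) (e34 y) (e13 y - u.1.2) (e24 y) (e14 y - u.2) (e23 y).

Lemma qform_split x y : gt1 x -> 0 < ngram x -> exists u : R * R * R,
  let z := zeta x (link_part y u) in
  [/\ e12 z = 0, e13 z = 0, e14 z = 0 & qform x y = sform x u + qform x (link_part y u)].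
Proof.
move=> x1 D0; have [[w1 w2 w3] w4 w5 w6] := gt1_sh2 x1.
have [f1 f2 f3 f4] := gt1_fd x1.
have [[m1 m2 m3] m4 m5 m6] : [/\ [/\ sh2 (e12 x) != 0, sh2 (e34 x) != 0 & sh2 (e13 x) != 0],
  sh2 (e24 x) != 0, sh2 (e14 x) != 0 & sh2 (e23 x) != 0] by do 2?split; apply: lt0r_neq0.
have [u [r1 r2 r3]] := sym3_solve (e12 (zeta x y) / sh2 (e12 x)) (e13 (zeta x y) / sh2 (e13 x))
  (e14 (zeta x y) / sh2 (e14 x)) (sdet_gt0 x1 D0).
exists u => z.
have z1 : e12 z = 0.
  have -> : e12 z = e12 (zeta x y) - sh2 (e12 x) * (e12 (zeta x y) / sh2 (e12 x)).
    rewrite -r1 /z /zeta /=.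
    move: (n23 x / _) (n24 x / _) (n13 x / _) (n14 x / _) (E12 x) (sh2 _) m1 => ? ? ? ? ? ? ?.
    by field.
  by rewrite mulrCA mulfV // mulr1 subrr.
have z2 : e13 z = 0.
  have -> : e13 z = e13 (zeta x y) - sh2 (e13 x) * (e13 (zeta x y) / sh2 (e13 x)).
    rewrite -r2 /z /zeta /=.
    move: (n23 x / _) (n12 x / _) (n34 x / _) (n14 x / _) (E13 x) (sh2 _) m3 => ? ? ? ? ? ? ?.
    by field.
  by rewrite mulrCA mulfV // mulr1 subrr.
have z3 : e14 z = 0.
  have -> : e14 z = e14 (zeta x y) - sh2 (e14 x) * (e14 (zeta x y) / sh2 (e14 x)).
    rewrite -r3 /z /zeta /=.
    move: (n24 x / _) (n12 x / _) (n34 x / _) (n13 x / _) (E14 x) (sh2 _) m5 => ? ? ? ? ? ? ?.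
    by field.
  by rewrite mulrCA mulfV // mulr1 subrr.
split=> //.
have -> : qform x (link_part y u) = e34 y * e34 z / sh2 (e34 x) + e24 y * e24 z / sh2 (e24 x)
   + e23 y * e23 z / sh2 (e23 x).
  by rewrite /qform -/z z1 z2 z3 /=; ring.
rewrite /qform.
apply/eqP; rewrite -subr_eq0; apply/eqP.
rewrite /sform.
have s1 : e12 z = 0 by [].
(* With v = y - u, the defect is twice the polar form of u and v plus the part of the form of v at
   vertex 1, so each coordinate has weight 2 u + v = y + u. *)
have : (e12 y + u.1.1) * e12 z / sh2 (e12 x) + (e13 y + u.1.2) * e13 z / sh2 (e13 x) + (e14 y + u.2) * e14 z / sh2 (e14 x) = 0.
  by rewrite z1 z2 z3 !mulr0 !mul0r !addr0.
move: (m1) (m2) (m3) (m4) (m5) (m6); rewrite {s1 z1 z2 z3} /z /zeta /=.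
move: (sh2 (e12 x)) (sh2 (e34 x)) (sh2 (e13 x)) (sh2 (e24 x)) (sh2 (e14 x)) (sh2 (e23 x)).
move=> v1 v2 v3 v4 v5 v6 k1 k2 k3 k4 k5 k6 hu.
set rhs := (X in X = 0).
suff -> : rhs = ((e12 y + u.1.1) * (E12 x * (e12 y - u.1.1) +
     v1 * (e34 y - n23 x / fd4 x * (e13 y - u.1.2) - n24 x / fd3 x * (e14 y - u.2) - n13 x / fd4 x * e23 y - n14 x / fd3 x * e24 y)) / v1 +
    (e13 y + u.1.2) * (E13 x * (e13 y - u.1.2) +
     v3 * (e24 y - n23 x / fd4 x * (e12 y - u.1.1) - n12 x / fd4 x * e23 y - n34 x / fd2 x * (e14 y - u.2) - n14 x / fd2 x * e34 y)) / v3 +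
    (e14 y + u.2) * (E14 x * (e14 y - u.2) +
     v5 * (e23 y - n24 x / fd3 x * (e12 y - u.1.1) - n12 x / fd3 x * e24 y - n34 x / fd2 x * (e13 y - u.1.2) - n13 x / fd2 x * e34 y)) / v5).
  exact: hu.
rewrite /rhs {rhs hu}.
move: (n23 x / fd4 x) (n24 x / fd3 x) (n13 x / fd4 x) (n14 x / fd3 x) (n12 x / fd4 x) (n34 x / fd2 x)
  (n14 x / fd2 x) (n12 x / fd3 x) (n13 x / fd2 x) (E12 x) (E34 x) (E13 x) (E24 x) (E14 x) (E23 x) => *.
by field; rewrite ?k1 ?k2 ?k3 ?k4 ?k5 ?k6 ?lt0r_neq0.
Qed.
End TetrahedronIdentities.

(** * Positivity when some face carries no obtuse dihedral angle *)

Section TetrahedronPositivity.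
Variable R : realFieldType.
Implicit Types x y z : six R.

Lemma qform_link_part x y : gt1 x -> 0 < ngram x ->
  let z := zeta x y in e12 z = 0 -> e13 z = 0 -> e14 z = 0 ->
  ngram x * qform x y = P34 x * e34 z ^+ 2 / sh2 (e34 x) + P24 x * e24 z ^+ 2 / sh2 (e24 x)
     + P23 x * e23 z ^+ 2 / sh2 (e23 x)
     + 2 * (e14 x * e34 z * e24 z + e13 x * e34 z * e23 z + e12 x * e24 z * e23 z).
Proof.
move=> x1 D0 z z1 z2 z3; have [[w1 w2 w3] w4 w5 w6] := gt1_sh2 x1.
have [[_ i34 _] i24 _ i23] := zeta_invs y x1; rewrite -/z z1 z2 z3 in i34 i24 i23.
have -> : qform x y = e34 y * e34 z / sh2 (e34 x) + e24 y * e24 z / sh2 (e24 x)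
   + e23 y * e23 z / sh2 (e23 x).
  by rewrite /qform -/z z1 z2 z3; ring.
transitivity ((ngram x * e34 y) * e34 z / sh2 (e34 x) + (ngram x * e24 y) * e24 z / sh2 (e24 x)
   + (ngram x * e23 y) * e23 z / sh2 (e23 x)); first by ring.
rewrite i34 i24 i23.
by field; rewrite !lt0r_neq0.
Qed.

Lemma qform_link_part_ge0 x y : gt1 x -> 0 < ngram x ->
  let z := zeta x y in e12 z = 0 -> e13 z = 0 -> e14 z = 0 ->
  0 <= qform x y /\ (qform x y = 0 -> y = Six 0 0 0 0 0 0).
Proof.
move=> x1 D0 z z1 z2 z3; have [[w1 w2 w3] w4 w5 w6] := gt1_sh2 x1.
have [[a A b] B c C] := gt1P x1; have [f1 _ _ _] := gt1_fd x1.
have := facet_form_ge (e34 z) (e24 z) (e23 z) x1.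
rewrite -qform_link_part // -/z.
have r1 : 0 < e14 x / (e23 x + e34 x * e24 x) by apply: divr_gt0; nra.
have r2 : 0 < e13 x / (e24 x + e34 x * e23 x) by apply: divr_gt0; nra.
have r3 : 0 < e12 x / (e34 x + e24 x * e23 x) by apply: divr_gt0; nra.
have sq (t w : R) : 0 < w -> 0 <= t ^+ 2 / w by move=> w0; rewrite divr_ge0 ?sqr_ge0 // ltW.
have := sq (e34 z) _ w2; have := sq (e24 z) _ w4; have := sq (e23 z) _ w6.
set s1 := e23 z ^+ 2 / _; set s2 := e24 z ^+ 2 / _; set s3 := e34 z ^+ 2 / _ => p1 p2 p3 q.
have ge0 : 0 <= qform x y.
  rewrite -(pmulr_rge0 _ D0); apply: le_trans q.
  apply: mulr_ge0; first by lra.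
  by do ?apply: addr_ge0; apply: mulr_ge0 (ltW _) (addr_ge0 _ _).
split=> // q0; rewrite q0 mulr0 pmulr_rle0 ?divr_gt0 ?ltr0n // in q.
have t0 : [/\ s1 = 0, s2 = 0 & s3 = 0].
  have u1 : 0 <= s3 + s2 by rewrite addr_ge0.
  have u2 : 0 <= s3 + s1 by rewrite addr_ge0.
  have u3 : 0 <= s2 + s1 by rewrite addr_ge0.
  have v1 := mulr_ge0 (ltW r1) u1.
  have v2 := mulr_ge0 (ltW r2) u2.
  have v3 := mulr_ge0 (ltW r3) u3.
  have e2 : s3 + s1 <= 0 by rewrite -(pmulr_rle0 _ r2); lra.
  have e1 : s3 + s2 <= 0 by rewrite -(pmulr_rle0 _ r1); lra.
  by split; lra.
have zz (t w : R) : 0 < w -> t ^+ 2 / w = 0 -> t = 0.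
  by move=> w0 /eqP; rewrite mulf_eq0 invr_eq0 (gt_eqF w0) orbF sqrf_eq0 => /eqP.
case: t0 => /(zz _ _ w6) k6 /(zz _ _ w4) k4 /(zz _ _ w2) k2.
have [[i12 i34 i13] i24 i14 i23] := zeta_invs y x1.
rewrite -/z z1 z2 z3 k2 k4 k6 !(mulr0, addr0, oppr0) in i12 i34 i13 i24 i14 i23.
have can t : ngram x * t = 0 -> t = 0.
  by move=> /eqP; rewrite mulf_eq0 (gt_eqF D0) => /eqP.
case: y {z z1 z2 z3 q0 q ge0 k2 k4 k6 s1 s2 s3 p1 p2 p3} i12 i34 i13 i24 i14 i23 => /= ? ? ? ? ? ?.
by do 6 move=> /can ->.
Qed.

Lemma qform_gt0_minors x y : gt1 x -> 0 < ngram x ->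
  0 < E12 x -> 0 < sminor2 x -> y <> Six 0 0 0 0 0 0 -> 0 < qform x y.
Proof.
move=> x1 D0 m1 m2 yn0; have [[w1 w2 w3] w4 w5 w6] := gt1_sh2 x1.
have [u [z1 z2 z3 ->]] := qform_split y x1 D0.
have [q0 qn] := qform_link_part_ge0 x1 D0 z1 z2 z3.
have [un0|] := boolP ((u.1.1 != 0) || (u.1.2 != 0) || (u.2 != 0)).
  have : 0 < sform x u; last by lra.
  apply: sym3_gt0 un0; [exact: divr_gt0 | | exact: sdet_gt0].
  by move: m2; rewrite /sminor2 sqrrN.
rewrite !negb_or !negbK => /andP[/andP[/eqP u1 /eqP u2] /eqP u3].
have -> : sform x u = 0 by rewrite /sform u1 u2 u3; ring.
rewrite add0r lt0r q0 andbT; apply/eqP => /qn yz; apply: yn0.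
by move: yz; rewrite /link_part u1 u2 u3 !subr0; case: (y).
Qed.

Lemma n13_le0 x : gt1 x -> 0 < ngram x -> n13 x <= 0 ->
  [/\ 0 < n12 x, 0 < n14 x, 0 < n23 x & 0 < n34 x].
Proof.
have [[p12 p34 p13] [p24 p14 p23] _ gg] := swap23E x.
by move=> x1 D0 n0; have := @n12_le0 _ (swap23 x); rewrite gt1_swap23 gg p12 p13 p14 p23 p24; exact.
Qed.

Lemma n14_le0 x : gt1 x -> 0 < ngram x -> n14 x <= 0 ->
  [/\ 0 < n12 x, 0 < n13 x, 0 < n24 x & 0 < n34 x].
Proof.
have [[p12 p34 p13] [p24 p14 p23] _ gg] := swap34E x.
move=> x1 D0 n0; have := @n13_le0 (swap34 x); rewrite gt1_swap34 gg p12 p13 p14 p23 p34; exact.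
Qed.

Lemma n23_le0 x : gt1 x -> 0 < ngram x -> n23 x <= 0 ->
  [/\ 0 < n12 x, 0 < n24 x, 0 < n13 x & 0 < n34 x].
Proof.
have [[p12 p34 p13] [p24 p14 p23] _ gg] := swap12E x.
move=> x1 D0 n0; have := @n13_le0 (swap12 x); rewrite gt1_swap12 gg p12 p13 p14 p23 p34; exact.
Qed.

Lemma n24_le0 x : gt1 x -> 0 < ngram x -> n24 x <= 0 ->
  [/\ 0 < n12 x, 0 < n23 x, 0 < n14 x & 0 < n34 x].
Proof.
have [[p12 p34 p13] [p24 p14 p23] _ gg] := swap12E x.
move=> x1 D0 n0; have := @n14_le0 (swap12 x); rewrite gt1_swap12 gg p12 p13 p14 p24 p34; exact.
Qed.

Lemma n34_le0 x : gt1 x -> 0 < ngram x -> n34 x <= 0 ->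
  [/\ 0 < n13 x, 0 < n14 x, 0 < n23 x & 0 < n24 x].
Proof.
have [[p12 p34 p13] [p24 p14 p23] _ gg] := swap23E x.
move=> x1 D0 n0; have := @n24_le0 (swap23 x); rewrite gt1_swap23 gg p12 p14 p23 p24 p34.
by move=> /(_ x1 D0 n0)[].
Qed.

(** Since (e23 + e12 e13)^2 = fd4 + sh2 (e12) sh2 (e13), the subtracted square cancels and only
    terms remain that are nonnegative for nonnegative cosines. *)
Lemma sminor2E x : gt1 x -> sminor2 x = 
  (n23 x ^+ 2 / fd4 x
   + n23 x / fd4 x * (n34 x / fd2 x) * ((e23 x + e12 x * e13 x) * (e34 x + e13 x * e14 x))
   + n24 x / fd3 x * (n23 x / fd4 x) * ((e24 x + e12 x * e14 x) * (e23 x + e12 x * e13 x))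
   + n24 x / fd3 x * (n34 x / fd2 x) * ((e24 x + e12 x * e14 x) * (e34 x + e13 x * e14 x)))
  / (sh2 (e12 x) * sh2 (e13 x)).
Proof.
move=> x1; have [[w1 _ w3] _ _ _] := gt1_sh2 x1; have [_ f2 f3 f4] := gt1_fd x1.
have l12 : (e23 x + e12 x * e13 x) ^+ 2 = fd4 x + sh2 (e12 x) * sh2 (e13 x)
    by rewrite /fd4 /face_det /sh2; ring.
have [m1 m3 k2 k3] : [/\ sh2 (e12 x) != 0, sh2 (e13 x) != 0, fd2 x != 0 & fd3 x != 0]
  by split; apply: lt0r_neq0.
have k4 := lt0r_neq0 f4.
rewrite /sminor2 /E12 /E13.
move: (e23 x + _) (e24 x + _) (e34 x + _) l12 (n23 x) (n24 x) (n34 x) => p q r l12 N1 N2 N3.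
have e4 : fd4 x = p ^+ 2 - sh2 (e12 x) * sh2 (e13 x) by rewrite l12 addrK.
rewrite {}e4 in k4 *.
by field; rewrite m1 m3 k2 k3 k4.
Qed.

(** Both quantities involve only the cosines at the face opposite to vertex 1. Two edges of a face
    share a vertex, so at most one of these cosines vanishes and some term is positive. *)
Lemma link_acute x : gt1 x -> 0 < ngram x -> 0 <= n34 x -> 0 <= n24 x -> 0 <= n23 x ->
  0 < E12 x /\ 0 < sminor2 x.
Proof.
move=> x1 D0 u0 v0 w0.
have [[a A b] B c C] := gt1P x1; have [_ f2 f3 f4] := gt1_fd x1.
have [[w1 _ w3] _ _ _] := gt1_sh2 x1.
have p12 : 0 < e23 x + e12 x * e13 x by nra.
have p13 : 0 < e24 x + e12 x * e14 x by nra.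
have p23 : 0 < e34 x + e13 x * e14 x by nra.
have U0 : 0 <= n34 x / fd2 x by rewrite divr_ge0 // ltW.
have V0 : 0 <= n24 x / fd3 x by rewrite divr_ge0 // ltW.
have W0 : 0 <= n23 x / fd4 x by rewrite divr_ge0 // ltW.
have t1 := mulr_ge0 (mulr_ge0 W0 U0) (ltW (mulr_gt0 p12 p23)).
have t2 := mulr_ge0 (mulr_ge0 V0 W0) (ltW (mulr_gt0 p13 p12)).
have t3 := mulr_ge0 (mulr_ge0 V0 U0) (ltW (mulr_gt0 p13 p23)).
rewrite sminor2E // /E12.
have eW : n23 x * (e23 x + e12 x * e13 x) / fd4 x = n23 x / fd4 x * (e23 x + e12 x * e13 x) by ring.
have eV : n24 x * (e24 x + e12 x * e14 x) / fd3 x = n24 x / fd3 x * (e24 x + e12 x * e14 x) by ring.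
have s1 := mulr_ge0 W0 (ltW p12); have s2 := mulr_ge0 V0 (ltW p13).
have [n23p|n23n] := ltP 0 (n23 x).
  have W1 : 0 < n23 x / fd4 x by rewrite divr_gt0.
  have := mulr_gt0 W1 p12; have : 0 < n23 x ^+ 2 / fd4 x by rewrite divr_gt0 // exprn_gt0.
  by split; [lra | apply: divr_gt0; [lra | exact: mulr_gt0]].
have [_ n24p _ n34p] := n23_le0 x1 D0 n23n.
have V1 : 0 < n24 x / fd3 x by rewrite divr_gt0.
have U1 : 0 < n34 x / fd2 x by rewrite divr_gt0.
have := mulr_gt0 V1 p13; have := mulr_gt0 (mulr_gt0 V1 U1) (mulr_gt0 p13 p23).
have : 0 <= n23 x ^+ 2 / fd4 x by rewrite divr_ge0 ?sqr_ge0 // ltW.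
by split; [lra | apply: divr_gt0; [lra | exact: mulr_gt0]].
Qed.

Lemma qform_gt0_vertex1 x y : gt1 x -> 0 < ngram x -> 0 <= n34 x -> 0 <= n24 x -> 0 <= n23 x ->
  y <> Six 0 0 0 0 0 0 -> 0 < qform x y.
Proof.
by move=> x1 D0 u v w; have [? ?] := link_acute x1 D0 u v w; apply: qform_gt0_minors.
Qed.

Lemma qform_gt0_vertex2 x y : gt1 x -> 0 < ngram x -> 0 <= n34 x -> 0 <= n14 x -> 0 <= n13 x ->
  y <> Six 0 0 0 0 0 0 -> 0 < qform x y.
Proof.
move=> x1 D0 u v w yn; rewrite -qform_swap12 //.
have [[p12 p34 p13] [p24 p14 p23] _ gg] := swap12E x.
apply: qform_gt0_vertex1; rewrite ?gt1_swap12 ?gg ?p34 ?p24 ?p23 //.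
by move=> e; apply: yn; case: y e => ? ? ? ? ? ? [] -> -> -> -> -> ->.
Qed.

Lemma qform_gt0_vertex3 x y : gt1 x -> 0 < ngram x -> 0 <= n24 x -> 0 <= n14 x -> 0 <= n12 x ->
  y <> Six 0 0 0 0 0 0 -> 0 < qform x y.
Proof.
move=> x1 D0 u v w yn; rewrite -qform_swap23 //.
have [[p12 p34 p13] [p24 p14 p23] _ gg] := swap23E x.
apply: qform_gt0_vertex2; rewrite ?gt1_swap23 ?gg ?p34 ?p14 ?p13 //.
by move=> e; apply: yn; case: y e => ? ? ? ? ? ? [] -> -> -> -> -> ->.
Qed.
End TetrahedronPositivity.

(** * Positivity in general, including two opposite obtuse edges *)

Section ObtuseTetrahedra.
Variable R : rcfType.
Implicit Types x y z : six R.

(** The form is tested on the vector of the plane of coordinates 12 and 13 that is orthogonal to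
    coordinate 12. *)
Lemma sminor2_gt0 x : gt1 x -> 0 < E12 x ->
  (forall y, y <> Six 0 0 0 0 0 0 -> 0 < qform x y) -> 0 < sminor2 x.
Proof.
move=> x1 m0 q; have [[w1 w2 w3] w4 w5 w6] := gt1_sh2 x1.
have [f1 f2 f3 f4] := gt1_fd x1.
have M0 : 0 < E12 x / sh2 (e12 x) by rewrite divr_gt0.
have := q (Six (n23 x / fd4 x) 0 (E12 x / sh2 (e12 x)) 0 0 0).
have -> : qform x (Six (n23 x / fd4 x) 0 (E12 x / sh2 (e12 x)) 0 0 0)
  = E12 x / sh2 (e12 x) * sminor2 x.
  rewrite /qform /zeta /sminor2 /=; move: (n23 x / _) (n24 x / _) (E12 x) (E13 x) => ? ? ? ?.
  by field; rewrite !lt0r_neq0.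
rewrite pmulr_rgt0 // => -> // -[_ h].
by move: M0; rewrite h ltxx.
Qed.

Definition with12 x (t : R) := Six t (e34 x) (e13 x) (e24 x) (e14 x) (e23 x).

(** [ngram] is quadratic in the label of 12 with derivative [2 * n34], so the trapezoidal rule is
    exact. *)
Lemma ngram_with12 x (s t : R) :
  ngram (with12 x t) - ngram (with12 x s) = (t - s) * (n34 (with12 x t) + n34 (with12 x s)).
Proof. by case: x => *; unfold_tet; ring. Qed.

(** The first entry times the determinant is the product of two principal minors minus a square; if
    this minor vanished, the determinant would not be positive. *)
Lemma sminor2_neq0 x : gt1 x -> 0 < ngram x -> 0 < E12 x -> sminor2 x != 0.
Proof.
move=> x1 D0 m0; have [[w1 _ w3] _ _ _] := gt1_sh2 x1.
have M0 : 0 < E12 x / sh2 (e12 x) by rewrite divr_gt0.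
apply/eqP => m2; have := sdet_gt0 x1 D0 => /=.
move: m2; rewrite /sminor2.
move: (E12 x / _) (E13 x / _) (E14 x / _) (n23 x / _) (n24 x / _) (n34 x / _) M0.
move=> m11 m22 m33 p q r M0 m2; rewrite -(pmulr_rgt0 _ M0).
have -> : m11 * (m11 * (m22 * m33 - (- r) ^+ 2) - - p * (- p * m33 - - q * - r)
   + - q * (- p * - r - - q * m22)) =
   (m11 * m22 - p ^+ 2) * (m11 * m33 - q ^+ 2) - (m11 * r + p * q) ^+ 2 by ring.
by rewrite m2 mul0r sub0r oppr_gt0 ltNge sqr_ge0.
Qed.

(** Closure under the ring operations lets [poly_ivt] be applied to expressions that are not written
    as polynomials. [sminor2_num] below clears denominators for the same purpose. *)
Definition polyfun (f : R -> R) := exists p : {poly R}, forall t, f t = p.[t].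

Lemma polyfun_cst c : polyfun (fun=> c).
Proof. by exists c%:P => t; rewrite hornerC. Qed.
Lemma polyfun_id : polyfun id.
Proof. by exists 'X => t; rewrite hornerX. Qed.
Lemma polyfunD f g : polyfun f -> polyfun g -> polyfun (fun t => f t + g t).
Proof. by move=> [p fp] [q gq]; exists (p + q) => t; rewrite hornerD fp gq. Qed.
Lemma polyfunN f : polyfun f -> polyfun (fun t => - f t).
Proof. by move=> [p fp]; exists (- p) => t; rewrite hornerN fp. Qed.
Lemma polyfunM f g : polyfun f -> polyfun g -> polyfun (fun t => f t * g t).
Proof. by move=> [p fp] [q gq]; exists (p * q) => t; rewrite hornerM fp gq. Qed.
Lemma polyfunX f n : polyfun f -> polyfun (fun t => f t ^+ n).
Proof. by move=> [p fp]; exists (p ^+ n) => t; rewrite horner_exp fp. Qed.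

Definition sminor2_num x :=
  (n23 x * (e23 x + e12 x * e13 x) * fd3 x + n24 x * (e24 x + e12 x * e14 x) * fd4 x)
  * (n23 x * (e23 x + e12 x * e13 x) * fd2 x + n34 x * (e34 x + e13 x * e14 x) * fd4 x)
  - n23 x ^+ 2 * (sh2 (e12 x) * sh2 (e13 x)) * fd3 x * fd2 x.

Lemma sminor2_numE x : gt1 x ->
  sminor2_num x = sminor2 x * (fd4 x ^+ 2 * fd3 x * fd2 x * (sh2 (e12 x) * sh2 (e13 x))).
Proof.
move=> x1; have [[w1 w2 w3] w4 w5 w6] := gt1_sh2 x1; have [f1 f2 f3 f4] := gt1_fd x1.
have [m1 m3 k2 k3] : [/\ sh2 (e12 x) != 0, sh2 (e13 x) != 0, fd2 x != 0 & fd3 x != 0]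
  by split; apply: lt0r_neq0.
have k4 := lt0r_neq0 f4.
rewrite /sminor2 /E12 /E13 /sminor2_num.
move: (e23 x + _) (e24 x + _) (e34 x + _) (n23 x) (n24 x) (n34 x) => *.
by field; rewrite m1 m3 k2 k3 k4.
Qed.

Lemma sminor2_num_sign x : gt1 x -> (0 < sminor2_num x) = (0 < sminor2 x).
Proof.
move=> x1; have [[w1 w2 w3] w4 w5 w6] := gt1_sh2 x1; have [f1 f2 f3 f4] := gt1_fd x1.
by rewrite sminor2_numE // pmulr_lgt0 // !mulr_gt0 // exprn_gt0.
Qed.

Lemma polyfun_sminor2_num x : polyfun (fun t => sminor2_num (with12 x t)).
Proof.
rewrite /sminor2_num; unfold_tet.
by do ?[exact: polyfun_cst | exact: polyfun_id | apply: polyfunD | apply: polyfunN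
  | apply: polyfunM | apply: polyfunX].
Qed.

Lemma polyfun_n12 x : polyfun (fun t => n12 (with12 x t)).
Proof.
unfold_tet.
by do ?[exact: polyfun_cst | exact: polyfun_id | apply: polyfunD | apply: polyfunN
  | apply: polyfunM | apply: polyfunX].
Qed.

Lemma polyfun_ivt f (s t : R) : polyfun f -> s <= t -> 0 < f s -> f t <= 0 ->
  exists2 r, s <= r <= t & f r = 0.
Proof.
move=> [p fp] st fs ft.
have [|r rst /rootP r0] := @poly_ivt R (- p) s t st.
  by rewrite !hornerN -!fp oppr_le0 oppr_ge0 (ltW fs).
by exists r; rewrite // fp; apply/eqP; rewrite -oppr_eq0 -hornerN r0.
Qed.

(* Shrinking edge 12 increases [ngram] and the cosine at the opposite edge 34;
   we stop when one of the two obtuse angles becomes right. *)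
Lemma sminor2_obtuse x : gt1 x -> 0 < ngram x -> n12 x < 0 -> n34 x < 0 -> 0 < sminor2 x.
Proof.
move=> x1 D0 n12x n34x; have [[a1 A1 b1] B1 c1 C1] := gt1P x1.
have ex : with12 x (e12 x) = x by case: (x).
have w34 := sh2_gt0 A1.
have gt1w t : 1 < t -> gt1 (with12 x t) by move=> t1; apply/and5P; split=> //; apply/andP.
have n34w s t : n34 (with12 x t) = n34 (with12 x s) - (t - s) * sh2 (e34 x).
  by case: (x) => *; unfold_tet; ring.
(* From such an r the cosine at 34 stays nonpositive and [ngram] positive up to [e12 x], so
   [sminor2_neq0] forbids a change of sign on the way. *)
suff [r /andP[r1 ra] [nr sr]] : exists2 r, 1 < r <= e12 x &
    n34 (with12 x r) <= 0 /\ 0 < sminor2 (with12 x r).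
  have path t : r <= t <= e12 x -> [/\ gt1 (with12 x t), 0 < ngram (with12 x t) &
      0 < E12 (with12 x t)].
    move=> /andP[rt ta]; have t1 := lt_le_trans r1 rt.
    have nt : n34 (with12 x t) <= 0 by rewrite (n34w r); nra.
    have Dt : 0 < ngram (with12 x t).
      have := ngram_with12 x (e12 x) t; rewrite ex; nra.
    split=> //; first exact: gt1w.
    have [_ _ n23t n24t] := n34_le0 (gt1w _ t1) Dt nt.
    have [_ _ f3 f4] := gt1_fd (gt1w _ t1).
    rewrite /E12 /=; apply: addr_gt0; apply: divr_gt0 => //; apply: mulr_gt0 => //; nra.
  rewrite ltNge; apply/negP => sx.
  have [t rta t0] : exists2 t, r <= t <= e12 x & sminor2_num (with12 x t) = 0.
    apply: polyfun_ivt; [exact: polyfun_sminor2_num | exact: ra | |].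
      by rewrite sminor2_num_sign // gt1w.
    by rewrite ex leNgt sminor2_num_sign // -leNgt.
  have [t1 Dt mt] := path _ rta.
  have := sminor2_neq0 t1 Dt mt.
  move: t0; rewrite sminor2_numE //.
  have [[w1 w2 w3] w4 w5 w6] := gt1_sh2 t1; have [f1 f2 f3 f4] := gt1_fd t1.
  move/eqP; rewrite mulf_eq0 => /orP[-> //|/negPn/negP[]].
  by rewrite lt0r_neq0 // !mulr_gt0 // exprn_gt0.
(* [n34] is affine in the label of 12 with slope [- sh2 (e34 x)]; this is its zero. *)
pose r0 := e12 x + n34 x / sh2 (e34 x).
have r0a : r0 < e12 x.
  by rewrite /r0 gtrDl pmulr_llt0 ?invr_gt0.
have nr0 : n34 (with12 x r0) = 0.
  by rewrite (n34w (e12 x)) ex /r0 (addrC (e12 x)) addrK divfK ?lt0r_neq0 // subrr.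
have [r01|r01] := ltP 1 r0.
  exists r0; first by rewrite r01 ltW.
  split; first by rewrite nr0.
  have Dt : 0 < ngram (with12 x r0).
    have := ngram_with12 x (e12 x) r0; rewrite ex nr0; nra.
  have [_ _ n23t n24t] : [/\ 0 < n13 (with12 x r0), 0 < n14 (with12 x r0),
    0 < n23 (with12 x r0) & 0 < n24 (with12 x r0)].
    by apply: n34_le0 => //; [exact: gt1w | rewrite nr0].
  by case: (@link_acute _ (with12 x r0)); rewrite ?nr0 ?gt1w // ltW.
(* If r0 <= 1, the cosine at 34 is nonpositive for all labels above 1, while [n12] is positive at 1
   and so vanishes in between. There vertex 3 provides the criterion. *)
have n34t t : 1 < t -> n34 (with12 x t) <= 0.
  by move=> t1; rewrite (n34w r0) nr0; nra.
have [r /andP[r1 ra] nr] : exists2 r, 1 <= r <= e12 x & n12 (with12 x r) = 0.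
  apply: polyfun_ivt; [exact: polyfun_n12 | exact: ltW | |by rewrite ex ltW].
  rewrite /with12; unfold_tet.
  have [p1 p2] : 0 < e13 x * e14 x /\ 0 < e23 x * e24 x by split; apply: mulr_gt0; lra.
  have [p3 p4] : 0 < e13 x * e24 x /\ 0 < e14 x * e23 x by split; apply: mulr_gt0; lra.
  lra.
have {}r1 : 1 < r.
  rewrite lt_neqAle r1 andbT; apply/eqP => er; move: nr; rewrite -er /with12; unfold_tet.
  have [p1 p2] : 0 < e13 x * e14 x /\ 0 < e23 x * e24 x by split; apply: mulr_gt0; lra.
  have [p3 p4] : 0 < e13 x * e24 x /\ 0 < e14 x * e23 x by split; apply: mulr_gt0; lra.
  lra.
exists r; first by rewrite r1.
have Dr : 0 < ngram (with12 x r).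
  have := ngram_with12 x (e12 x) r; rewrite ex; have := n34t _ r1; nra.
split; first exact: n34t.
have [_ n14r n23r n24r] := n34_le0 (gt1w _ r1) Dr (n34t _ r1).
apply: sminor2_gt0; first exact: gt1w.
  have [_ _ f3 f4] := gt1_fd (gt1w _ r1).
  rewrite /E12 /=; apply: addr_gt0; apply: divr_gt0 => //; apply: mulr_gt0 => //; nra.
by move=> y; apply: qform_gt0_vertex3; rewrite ?gt1w ?nr // ltW.
Qed.

Lemma qform_gt0_obtuse x y : gt1 x -> 0 < ngram x -> n12 x < 0 -> n34 x < 0 ->
  y <> Six 0 0 0 0 0 0 -> 0 < qform x y.
Proof.
move=> x1 D0 u v; have [[a1 A1 b1] B1 c1 C1] := gt1P x1.
have [_ _ n23p n24p] := n34_le0 x1 D0 (ltW v); have [_ _ f3 f4] := gt1_fd x1.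
apply: qform_gt0_minors => //; last exact: sminor2_obtuse.
by rewrite /E12 /=; apply: addr_gt0; apply: divr_gt0 => //; apply: mulr_gt0 => //; nra.
Qed.

(** Obtuse edges never share a vertex, so there are at most two and two must be opposite. With at
    most one, some face has no obtuse edge and the opposite vertex settles the case. *)
Theorem qform_gt0 x y : gt1 x -> 0 < ngram x -> y <> Six 0 0 0 0 0 0 -> 0 < qform x y.
Proof.
move=> x1 D0 yn.
have [n12n|n12p] := ltP (n12 x) 0.
  have [? ? n23p n24p] := n12_le0 x1 D0 (ltW n12n).
  have [n34n|n34p] := ltP (n34 x) 0; first exact: qform_gt0_obtuse.
  by apply: qform_gt0_vertex1 => //; apply: ltW.
have [n34n|n34p] := ltP (n34 x) 0.
  have [? n14p ? n24p] := n34_le0 x1 D0 (ltW n34n).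
  by apply: qform_gt0_vertex3 => //; apply: ltW.
have [n24n|n24p] := ltP (n24 x) 0.
  have [_ _ n14p _] := n24_le0 x1 D0 (ltW n24n).
  have [n13n|n13p] := ltP (n13 x) 0; last by apply: qform_gt0_vertex2 => //; apply: ltW.
  rewrite -qform_swap23 //; have [[p12 p34 p13] [p24 p14 p23] _ gg] := swap23E x.
  apply: qform_gt0_obtuse; rewrite ?gt1_swap23 ?gg ?p12 ?p34 //.
  by move=> e; apply: yn; case: y e => ? ? ? ? ? ? [] -> -> -> -> -> ->.
have [n23n|n23p] := ltP (n23 x) 0; last exact: qform_gt0_vertex1.
have [_ _ n13p _] := n23_le0 x1 D0 (ltW n23n).
have [n14n|n14p] := ltP (n14 x) 0; last by apply: qform_gt0_vertex2 => //; apply: ltW.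
rewrite -qform_swap34 // -qform_swap23 ?gt1_swap34 //.
have [[p12 p34 p13] [p24 p14 p23] _ gg] := swap34E x.
have [[q12 q34 q13] [q24 q14 q23] _ hh] := swap23E (swap34 x).
apply: qform_gt0_obtuse; rewrite ?gt1_swap23 ?gt1_swap34 ?hh ?gg ?q12 ?q34 ?p13 ?p24 //.
by move=> e; apply: yn; case: y e => ? ? ? ? ? ? [] -> -> -> -> -> ->.
Qed.
End ObtuseTetrahedra.

(** * Extended dihedral angles and their derivatives *)

Section DihedralAngles.
Variable R : realType.
Implicit Types x y : six R.

(** The rules of differentiation are put in pointwise form with ordinary products, so that
    derivatives are assembled by application and only their values are left to [ring]. *)
Lemma derD (f g : R -> R) (s a b : R) : is_derive s 1 f a -> is_derive s 1 g b ->
  is_derive s 1 (fun t => f t + g t) (a + b).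
Proof. exact: is_deriveD. Qed.
Lemma derN (f : R -> R) (s a : R) : is_derive s 1 f a ->
  is_derive s 1 (fun t => - f t) (- a).
Proof. exact: is_deriveN. Qed.
Lemma derM (f g : R -> R) (s a b : R) : is_derive s 1 f a -> is_derive s 1 g b ->
  is_derive s 1 (fun t => f t * g t) (a * g s + f s * b).
Proof.
by move=> fa gb; apply: is_derive_eq (is_deriveM fa gb) _; rewrite /GRing.scale /=; ring.
Qed.
Lemma derC (c s : R) : is_derive s 1 (fun=> c) (0 : R).
Proof. exact: is_derive_cst. Qed.
Lemma derX2 (f : R -> R) (s a : R) : is_derive s 1 f a ->
  is_derive s 1 (fun t => f t ^+ 2) (2 * f s * a).
Proof.
move=> fa; have -> : (fun t => f t ^+ 2) = (fun t => f t * f t) by apply/funext => t; rewrite expr2.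
by apply: is_derive_eq (derM fa fa) _; ring.
Qed.
Lemma derV (f : R -> R) (s a : R) : f s != 0 -> is_derive s 1 f a ->
  is_derive s 1 (fun t => (f t)^-1) (- a / f s ^+ 2).
Proof.
move=> f0 fa; apply: is_derive_eq (is_deriveV f0 fa) _.
by rewrite /GRing.scale /=; field.
Qed.
Lemma der_comp (f g : R -> R) (s a b : R) : is_derive (g s) 1 f a -> is_derive s 1 g b ->
  is_derive s 1 (fun t => f (g t)) (a * b).
Proof. exact: is_derive1_comp. Qed.
Lemma der_sqrt (f : R -> R) (s a : R) : 0 < f s -> is_derive s 1 f a ->
  is_derive s 1 (fun t => Num.sqrt (f t)) (a / (2 * Num.sqrt (f s))).
Proof.
move=> f0 fa; apply: is_derive_eq (der_comp (is_derive1_sqrt f0) fa) _; exact: mulrC.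
Qed.

Definition clamp1 (u : R) := Num.max (-1) (Num.min u 1).
Definition cacos (u : R) := acos (clamp1 u).

Lemma clamp1_itv (u : R) : -1 <= clamp1 u <= 1.
Proof. by rewrite /clamp1 le_max lexx /= ge_max ge_min lexx orbT andbT; lra. Qed.

Lemma clamp1_id (u : R) : -1 <= u <= 1 -> clamp1 u = u.
Proof. by case/andP=> ? ?; rewrite /clamp1 min_l // max_r. Qed.

Lemma cacos_ge0 u : 0 <= cacos u. Proof. exact/acos_ge0/clamp1_itv. Qed.
Lemma cacos_lepi u : cacos u <= pi. Proof. exact/acos_lepi/clamp1_itv. Qed.
Lemma cos_cacos u : cos (cacos u) = clamp1 u.
Proof. by rewrite /cacos acosK // in_itv /= clamp1_itv. Qed.

Lemma clamp1_le u v : u <= v -> clamp1 u <= clamp1 v.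
Proof.
by move=> uv; rewrite /clamp1 ge_max !le_max lexx /= le_min !ge_min uv lexx !orbT.
Qed.

Lemma cacos_le u v : u <= v -> cacos v <= cacos u.
Proof.
move=> uv; rewrite leNgt; apply/negP => /[dup] h; rewrite -ltr_cos ?in_itv /= ?cacos_ge0 ?cacos_lepi //.
by rewrite !cos_cacos ltNge clamp1_le.
Qed.

Lemma is_derive_cacos (u : R) : -1 < u < 1 -> is_derive u 1 cacos (- (Num.sqrt (1 - u ^+ 2))^-1).
Proof.
move=> u1; have := is_derive1_acos u1.
have /near_in_itvoo uI : u \in `]-1, 1[%R by rewrite in_itv.
apply: near_eq_is_derive; near=> v; rewrite /cacos clamp1_id //.
have : v \in `]-1, 1[%R by near: v.
by rewrite in_itv /= => /andP[? ?]; rewrite !ltW.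
Unshelve. all: by end_near. Qed.

(** At -1 and 1 there is no derivative to rely on. Strict monotonicity of cos turns both
    inequalities on [cacos v] into inequalities on [clamp1 v], whose continuity is clear. *)
Lemma continuous_cacos : continuous cacos.
Proof.
move=> u; apply/cvgrPdist_lt => e e0 /=.
have cl : clamp1 v @[v --> u] --> clamp1 u.
  apply: (@continuous_max _ _ (cst (-1)) (fun v : R^o => Num.min v 1)); first exact: cvg_cst.
  by apply: (@continuous_min _ _ (fun v : R^o => v) (cst 1)); [exact: cvg_id | exact: cvg_cst].
have up : \forall v \near u, cacos v < cacos u + e.
  have [pe|pe] := ltP pi (cacos u + e).
    by near=> v; exact: le_lt_trans (cacos_lepi v) pe.
  have h : cos (cacos u + e) < clamp1 u.
    rewrite -cos_cacos ltr_cos ?in_itv /= ?cacos_ge0 ?cacos_lepi ?pe ?addr_ge0 ?cacos_ge0 ?(ltW e0) //.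
    by rewrite ltrDl.
  near=> v; have : cos (cacos u + e) < clamp1 v by near: v; exact: cvgr_gt cl _ h.
  rewrite -cos_cacos.
  by rewrite ltr_cos ?in_itv /= ?cacos_ge0 ?cacos_lepi ?pe ?addr_ge0 ?cacos_ge0 ?(ltW e0).
have dn : \forall v \near u, cacos u - e < cacos v.
  have [pe|pe] := ltP (cacos u - e) 0.
    by near=> v; exact: lt_le_trans pe (cacos_ge0 v).
  have pi' : cacos u - e <= pi by have := cacos_lepi u; lra.
  have h : clamp1 u < cos (cacos u - e).
    rewrite -cos_cacos ltr_cos ?in_itv /= ?cacos_ge0 ?cacos_lepi ?pe ?pi' //.
    by rewrite ltrBlDr ltrDl.
  near=> v; have : clamp1 v < cos (cacos u - e) by near: v; exact: cvgr_lt cl _ h.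
  rewrite -cos_cacos.
  by rewrite ltr_cos ?in_itv /= ?cacos_ge0 ?cacos_lepi ?pe ?pi'.
near=> v.
have h1 : cacos v < cacos u + e by near: v.
have h2 : cacos u - e < cacos v by near: v.
by rewrite ltr_norml; lra.
Unshelve. all: by end_near. Qed.

Definition ang12 x := cacos (phi_formula (e12 x) (e13 x) (e14 x) (e23 x) (e24 x) (e34 x)).

Definition angs x : six R := Six (ang12 x) (ang12 (swap23 (swap12 (swap34 (swap23 x)))))
  (ang12 (swap23 x)) (ang12 (swap23 (swap12 (swap34 x))))
  (ang12 (swap23 (swap34 x))) (ang12 (swap23 (swap12 x))).

Lemma phi_formulaE x : phi_formula (e12 x) (e13 x) (e14 x) (e23 x) (e24 x) (e34 x)
  = n12 x / (Num.sqrt (fd4 x) * Num.sqrt (fd3 x)).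
Proof. by []. Qed.

Lemma one_sub_phi_sqr x : gt1 x ->
  1 - (n12 x / (Num.sqrt (fd4 x) * Num.sqrt (fd3 x))) ^+ 2
  = ngram x * sh2 (e12 x) / (fd4 x * fd3 x).
Proof.
move=> x1; have [f1 f2 f3 f4] := gt1_fd x1.
rewrite expr_div_n exprMn !sqr_sqrtr ?(ltW f3) ?(ltW f4) // n12_sqr.
by field; rewrite !lt0r_neq0.
Qed.

Lemma phi_itv x : gt1 x -> 0 < ngram x ->
  -1 < n12 x / (Num.sqrt (fd4 x) * Num.sqrt (fd3 x)) < 1.
Proof.
move=> x1 D0; have [f1 f2 f3 f4] := gt1_fd x1; have [[w1 _ _] _ _ _] := gt1_sh2 x1.
rewrite -ltr_norml -(@expr_lt1 _ 2) // -normrX ger0_norm ?sqr_ge0 // -subr_gt0.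
by rewrite one_sub_phi_sqr // divr_gt0 // mulr_gt0.
Qed.

(** 1 - phi^2 has the sign of [ngram], so phi is outside (-1, 1) and is clamped to an end point. *)
Lemma ang12_degenerate x : gt1 x -> ngram x <= 0 -> ang12 x = 0 \/ ang12 x = pi.
Proof.
move=> x1 D0; have [f1 f2 f3 f4] := gt1_fd x1; have [[w1 _ _] _ _ _] := gt1_sh2 x1.
rewrite /ang12 phi_formulaE.
have : 1 <= (n12 x / (Num.sqrt (fd4 x) * Num.sqrt (fd3 x))) ^+ 2.
  rewrite -subr_le0 one_sub_phi_sqr //.
  by rewrite pmulr_lle0 ?invr_gt0 ?mulr_gt0 // pmulr_lle0.
set u := _ / _ => u1.
have [un|up] := ltP u 0; [right | left].
  have u1' : u <= -1 by nra.
  suff -> : cacos u = cacos (-1) by rewrite /cacos clamp1_id ?acosN1 //; lra.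
  congr acos; rewrite [RHS]clamp1_id; last by lra.
  by rewrite /clamp1 min_l ?max_l //; lra.
have u1' : 1 <= u by nra.
suff -> : cacos u = cacos 1 by rewrite /cacos clamp1_id ?acos1 //; lra.
congr acos; rewrite [RHS]clamp1_id; last by lra.
by rewrite /clamp1 min_r ?max_r //; lra.
Qed.

Definition dphi_num (p q r s t w p' q' r' s' t' w' : R) :=
  q' * r + q * r' + (s' * t + s * t') + (p' * q * t + p * q' * t + p * q * t')
  + (p' * r * s + p * r' * s + p * r * s') - (2 * p * p' * w + p ^+ 2 * w') + w'.
Definition dface_det (p q r p' q' r' : R) :=
  2 * (p' * q * r + p * q' * r + p * q * r') + 2 * p * p' + 2 * q * q' + 2 * r * r'.

Lemma is_derive_face_det (p q r : R -> R) (s p' q' r' : R) :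
  is_derive s 1 p p' -> is_derive s 1 q q' -> is_derive s 1 r r' ->
  is_derive s 1 (fun u => face_det (p u) (q u) (r u)) (dface_det (p s) (q s) (r s) p' q' r').
Proof.
move=> dp dq dr; have h := derD (derD (derD (derD (derM (derM (derM (derC 2 s) dp) dq) dr)
  (derX2 dp)) (derX2 dq)) (derX2 dr)) (derC (-1) s).
apply: is_derive_eq h _.
by rewrite /dface_det; ring.
Qed.

Lemma is_derive_phi_num (p q r s t w : R -> R) (u p' q' r' s' t' w' : R) :
  is_derive u 1 p p' -> is_derive u 1 q q' -> is_derive u 1 r r' ->
  is_derive u 1 s s' -> is_derive u 1 t t' -> is_derive u 1 w w' ->
  is_derive u 1 (fun v => phi_num (p v) (q v) (r v) (s v) (t v) (w v))
    (dphi_num (p u) (q u) (r u) (s u) (t u) (w u) p' q' r' s' t' w').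
Proof.
move=> dp dq dr ds dt dw; have h := derD (derD (derD (derD (derD (derM dq dr) (derM ds dt))
  (derM (derM dp dq) dt)) (derM (derM dp dr) ds)) (derN (derM (derX2 dp) dw))) dw.
apply: is_derive_eq h _.
by rewrite /dphi_num; ring.
Qed.

Definition six_derive (X : R -> six R) (s : R) y :=
  [/\ [/\ is_derive s 1 (fun t => e12 (X t)) (e12 y), is_derive s 1 (fun t => e34 (X t)) (e34 y)
      & is_derive s 1 (fun t => e13 (X t)) (e13 y)],
      is_derive s 1 (fun t => e24 (X t)) (e24 y), is_derive s 1 (fun t => e14 (X t)) (e14 y)
      & is_derive s 1 (fun t => e23 (X t)) (e23 y)].

(** By the quotient rule this is - sqrt (fd3 fd4) times the derivative of phi; the square roots
    enter only through logarithmic derivatives. *)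
Lemma zeta12_deriv x y : gt1 x -> e12 (zeta x y) =
  - (dphi_num (e12 x) (e13 x) (e14 x) (e23 x) (e24 x) (e34 x)
       (e12 y) (e13 y) (e14 y) (e23 y) (e24 y) (e34 y)
     - n12 x * (dface_det (e12 x) (e13 x) (e23 x) (e12 y) (e13 y) (e23 y) / (2 * fd4 x)
       + dface_det (e12 x) (e14 x) (e24 x) (e12 y) (e14 y) (e24 y) / (2 * fd3 x))).
Proof.
case/gt1_fd => _ _ /lt0r_neq0 h3 /lt0r_neq0 h4; move: h3 h4.
case: x y => a A b B c C [a' A' b' B' c' C'].
rewrite /zeta /E12 /dphi_num /dface_det; unfold_tet => h3 h4.
by field; rewrite h3 h4.
Qed.

Lemma is_derive_ang12 X s y : six_derive X s y -> gt1 (X s) -> 0 < ngram (X s) ->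
  is_derive s 1 (fun t => ang12 (X t))
    (e12 (zeta (X s) y) / Num.sqrt (ngram (X s) * sh2 (e12 (X s)))).
Proof.
move=> [[dX12 dX34 dX13] dX24 dX14 dX23] x1 D0.
have [f1 f2 f3 f4] := gt1_fd x1; have [[w1 _ _] _ _ _] := gt1_sh2 x1.
have s3 : 0 < Num.sqrt (fd3 (X s)) by rewrite sqrtr_gt0.
have s4 : 0 < Num.sqrt (fd4 (X s)) by rewrite sqrtr_gt0.
have d3 := @der_sqrt (fun t => fd3 (X t)) s _ f3 (is_derive_face_det dX12 dX14 dX24).
have d4 := @der_sqrt (fun t => fd4 (X t)) s _ f4 (is_derive_face_det dX12 dX13 dX23).
have dn := is_derive_phi_num dX12 dX13 dX14 dX23 dX24 dX34.
have dphi := derM dn (@derV (fun t => Num.sqrt (fd4 (X t)) * Num.sqrt (fd3 (X t))) s _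
  (lt0r_neq0 (mulr_gt0 s4 s3)) (derM d4 d3)).
have h := @der_comp cacos (fun t => n12 (X t) * (Num.sqrt (fd4 (X t)) * Num.sqrt (fd3 (X t)))^-1)
  s _ _ (is_derive_cacos (phi_itv x1 D0)) dphi.
apply: is_derive_eq h _.
rewrite one_sub_phi_sqr // sqrtrM ?mulr_ge0 ?(ltW D0) ?(ltW w1) // sqrtrV ?mulr_ge0 ?(ltW f4) ?(ltW f3) //.
rewrite (sqrtrM (fd3 _)) ?(ltW f4) // zeta12_deriv // -[phi_num _ _ _ _ _ _]/(n12 (X s)).
have q3 := sqr_sqrtr (ltW f3); have q4 := sqr_sqrtr (ltW f4).
have r0 : 0 < Num.sqrt (ngram (X s) * sh2 (e12 (X s))) by rewrite sqrtr_gt0 mulr_gt0.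
move: (Num.sqrt _) (Num.sqrt (fd3 _)) (Num.sqrt (fd4 _)) q3 q4 r0 s3 s4 => r t3 t4 <- <- r0 s3 s4.
by field; rewrite !lt0r_neq0.
Qed.

Lemma is_derive_angs X s y : six_derive X s y -> gt1 (X s) -> 0 < ngram (X s) ->
  let z := zeta (X s) y in let D := ngram (X s) in
  six_derive (fun t => angs (X t)) s
   (Six (e12 z / Num.sqrt (D * sh2 (e12 (X s)))) (e34 z / Num.sqrt (D * sh2 (e34 (X s))))
        (e13 z / Num.sqrt (D * sh2 (e13 (X s)))) (e24 z / Num.sqrt (D * sh2 (e24 (X s))))
        (e14 z / Num.sqrt (D * sh2 (e14 (X s)))) (e23 z / Num.sqrt (D * sh2 (e23 (X s))))).
Proof.
move=> dX x1 D0 z D.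
have g12 (u : six R) : ngram (swap12 u) = ngram u by case: (swap12E u).
have g23 (u : six R) : ngram (swap23 u) = ngram u by case: (swap23E u).
have g34 (u : six R) : ngram (swap34 u) = ngram u by case: (swap34E u).
have d12 Y v : six_derive Y s v -> six_derive (fun t => swap12 (Y t)) s (swap12 v) by case=> -[].
have d23 Y v : six_derive Y s v -> six_derive (fun t => swap23 (Y t)) s (swap23 v) by case=> -[].
have d34 Y v : six_derive Y s v -> six_derive (fun t => swap34 (Y t)) s (swap34 v) by case=> -[].
split; first split.
- exact: is_derive_ang12.
- have := is_derive_ang12 (d23 _ _ (d12 _ _ (d34 _ _ (d23 _ _ dX)))).
  rewrite !(gt1_swap12, gt1_swap23, gt1_swap34, g12, g23, g34) => /(_ x1 D0).
  by rewrite !(zeta_swap12, zeta_swap23, zeta_swap34) ?gt1_posdet ?(gt1_swap12, gt1_swap23, gt1_swap34).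
- have := is_derive_ang12 (d23 _ _ dX).
  rewrite !(gt1_swap12, gt1_swap23, gt1_swap34, g12, g23, g34) => /(_ x1 D0).
  by rewrite !(zeta_swap12, zeta_swap23, zeta_swap34) ?gt1_posdet ?(gt1_swap12, gt1_swap23, gt1_swap34).
- have := is_derive_ang12 (d23 _ _ (d12 _ _ (d34 _ _ dX))).
  rewrite !(gt1_swap12, gt1_swap23, gt1_swap34, g12, g23, g34) => /(_ x1 D0).
  by rewrite !(zeta_swap12, zeta_swap23, zeta_swap34) ?gt1_posdet ?(gt1_swap12, gt1_swap23, gt1_swap34).
- have := is_derive_ang12 (d23 _ _ (d34 _ _ dX)).
  rewrite !(gt1_swap12, gt1_swap23, gt1_swap34, g12, g23, g34) => /(_ x1 D0).
  by rewrite !(zeta_swap12, zeta_swap23, zeta_swap34) ?gt1_posdet ?(gt1_swap12, gt1_swap23, gt1_swap34).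
- have := is_derive_ang12 (d23 _ _ (d12 _ _ dX)).
  rewrite !(gt1_swap12, gt1_swap23, gt1_swap34, g12, g23, g34) => /(_ x1 D0).
  by rewrite !(zeta_swap12, zeta_swap23, zeta_swap34) ?gt1_posdet ?(gt1_swap12, gt1_swap23, gt1_swap34).
Qed.
End DihedralAngles.

(** * Uniform bounds for labels between 1 + m and 2 + m *)

Section Box.
Variable R : realFieldType.
Implicit Types x y z : six R.

Definition allsix (P : R -> Prop) x :=
  [/\ [/\ P (e12 x), P (e34 x) & P (e13 x)], P (e24 x), P (e14 x) & P (e23 x)].
Definition inbox (p q : R) x := allsix (fun t => p <= t <= q) x.
Definition dot x y := e12 x * e12 y + e34 x * e34 y + e13 x * e13 y
  + e24 x * e24 y + e14 x * e14 y + e23 x * e23 y.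

(** The four positive products give at least 2 (1 + p) (1 + m)^2 and the rest costs (p^2 - 1) (2 +
    m); after factoring 1 + p, the bound p - 1 <= 1 + m leaves (1 + m) m. So no angle is obtuse in
    the box, and for m = 0 none in [1, 2]. *)
Lemma phi_num_ge (m p q r s t w : R) : 0 <= m ->
  1 + m <= p <= 2 + m -> 1 + m <= q -> 1 + m <= r -> 1 + m <= s ->
  1 + m <= t -> w <= 2 + m -> (1 + p) * (1 + m) * m <= phi_num p q r s t w.
Proof.
move=> m0 /andP[p1 p2] q1 r1 s1 t1 w2.
have pr (u v : R) : 1 + m <= u -> 1 + m <= v -> (1 + m) ^+ 2 <= u * v.
  by move=> u1 v1; rewrite expr2; apply: ler_pM => //; lra.
have h1 := pr _ _ q1 r1; have h2 := pr _ _ s1 t1; have h3 := pr _ _ q1 t1.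
have h4 := pr _ _ r1 s1.
have p0 : 0 <= p by lra.
have h5 := ler_wpM2l p0 h3; have h6 := ler_wpM2l p0 h4.
have p3 : 0 <= p ^+ 2 - 1 by nra.
have h7 := ler_wpM2l p3 w2.
have h9 : 0 <= (1 + p) * ((2 * (1 + m) ^+ 2 - (p - 1) * (2 + m)) - (1 + m) * m).
  by apply: mulr_ge0; nra.
rewrite /phi_num; lra.
Qed.

Lemma phi_num_le (p q r s t w : R) :
  0 <= p <= 3 -> 0 <= q <= 3 -> 0 <= r <= 3 -> 0 <= s <= 3 ->
  0 <= t <= 3 -> 0 <= w <= 3 -> phi_num p q r s t w <= 75.
Proof.
move=> /andP[p1 p2] /andP[q1 q2] /andP[r1 r2] /andP[s1 s2] /andP[t1 t2] /andP[w1 w2].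
have pr (u v a b : R) : 0 <= u -> 0 <= v -> u <= a -> v <= b -> u * v <= a * b.
  by move=> *; apply: ler_pM.
have h1 := pr _ _ _ _ q1 r1 q2 r2; have h2 := pr _ _ _ _ s1 t1 s2 t2.
have h3 := pr _ _ _ _ (mulr_ge0 p1 q1) t1 (pr _ _ _ _ p1 q1 p2 q2) t2.
have h4 := pr _ _ _ _ (mulr_ge0 p1 r1) s1 (pr _ _ _ _ p1 r1 p2 r2) s2.
have h5 := mulr_ge0 (sqr_ge0 p) w1.
rewrite /phi_num; lra.
Qed.

Lemma face_det_le (p q r : R) : 0 <= p <= 3 -> 0 <= q <= 3 -> 0 <= r <= 3 ->
  face_det p q r <= 80.
Proof.
move=> /andP[p1 p2] /andP[q1 q2] /andP[r1 r2].
have h : p * q * r <= 3 * 3 * 3 by apply: ler_pM => //; [exact: mulr_ge0 | exact: ler_pM].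
by rewrite /face_det; nra.
Qed.

Definition numsix x := Six (n12 x) (n34 x) (n13 x) (n24 x) (n14 x) (n23 x).

(** All labels are at most 3, whence 75 = 9 + 9 + 27 + 27 + 3, 80 = 54 + 27 - 1, 800 >= 80 + 3 * (3
    * 75) and 8 = 9 - 1. *)
Lemma box_nums (m : R) x : 0 < m <= 1 -> inbox (1 + m) (2 + m) x ->
  [/\ gt1 x, allsix (fun t => m <= t <= 75) (numsix x),
   [/\ 4 <= fd1 x <= 80, 4 <= fd2 x <= 80, 4 <= fd3 x <= 80 & 4 <= fd4 x <= 80],
   4 <= ngram x <= 800 &
   allsix (fun t => 2 * m <= sh2 t <= 8) x].
Proof.
case/andP=> m0 m1 [[a A b] B c C].
have g t : 1 + m <= t <= 2 + m -> 1 < t by case/andP=> *; lra.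
have le3 t : 1 + m <= t <= 2 + m -> 0 <= t <= 3 by case/andP=> *; apply/andP; split; lra.
have nn p q r s t w : 1 + m <= p <= 2 + m -> 1 + m <= q <= 2 + m -> 1 + m <= r <= 2 + m ->
    1 + m <= s <= 2 + m -> 1 + m <= t <= 2 + m -> 1 + m <= w <= 2 + m ->
    m <= phi_num p q r s t w <= 75.
  move=> p1 q1 r1 s1 t1 w1; rewrite phi_num_le ?le3 // andbT.
  have := @phi_num_ge m p q r s t w (ltW m0) p1.
  case/andP: (q1) => -> _; case/andP: (r1) => -> _; case/andP: (s1) => -> _.
  case/andP: (t1) => -> _; case/andP: (w1) => _ ->; case/andP: p1 => p1 _.
  move=> /(_ erefl erefl erefl erefl erefl); apply: le_trans.
  have : 1 <= (1 + p) * (1 + m) by nra.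
  by move=> h; rewrite -[leLHS]mul1r; apply: ler_wpM2r => //; exact: ltW.
have ff p q r : 1 + m <= p <= 2 + m -> 1 + m <= q <= 2 + m -> 1 + m <= r <= 2 + m ->
    4 <= face_det p q r <= 80.
  by move=> p1 q1 r1; rewrite face_det_le ?le3 // andbT; apply: face_det_ge4; apply: ltW; exact: g.
have ns : allsix (fun t => m <= t <= 75) (numsix x) by split=> /=; first split; apply: nn.
have f1 : 4 <= fd1 x <= 80 by apply: ff.
split=> //.
- by apply/and5P; split; rewrite ?g //; apply/andP; split; rewrite ?g.
- by split; apply: ff.
- case: ns => -[_ /andP[u1 u2] _] /andP[v1 v2] _ /andP[w1 w2] /=; rewrite /ngram.
  case/andP: f1 => f1 f1'; move: (le3 _ a) (le3 _ b) (le3 _ c).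
  case/andP=> a1 a2 /andP[b1 b2] /andP[c1 c2].
  have p1 : 0 <= e12 x * n34 x <= 3 * 75.
    by rewrite mulr_ge0 //=; [apply: ler_pM => //; apply: le_trans u1; exact: ltW | apply: le_trans u1; exact: ltW].
  have p2 : 0 <= e13 x * n24 x <= 3 * 75.
    by rewrite mulr_ge0 //=; [apply: ler_pM => //; apply: le_trans v1; exact: ltW | apply: le_trans v1; exact: ltW].
  have p3 : 0 <= e14 x * n23 x <= 3 * 75.
    by rewrite mulr_ge0 //=; [apply: ler_pM => //; apply: le_trans w1; exact: ltW | apply: le_trans w1; exact: ltW].
  case/andP: p1 => ? ?; case/andP: p2 => ? ?; case/andP: p3 => ? ?.
  by apply/andP; split; lra.
- have ss t : 1 + m <= t <= 2 + m -> 2 * m <= sh2 t <= 8.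
    by case/andP=> t1 t2; rewrite /sh2; apply/andP; split; nra.
  by split; first split; apply: ss.
Qed.

Lemma sqr_div8_le (s v : R) : 0 < v -> v <= 8 -> s ^+ 2 / 8 <= s ^+ 2 / v.
Proof. by move=> v0 v8; rewrite ler_wpM2l ?sqr_ge0 // lef_pV2 // posrE; lra. Qed.

Lemma le3_mul (u v : R) : 0 <= u <= 3 -> 0 <= v <= 3 -> 0 <= u * v <= 9.
Proof.
move=> /andP[u0 u3] /andP[v0 v3]; rewrite mulr_ge0 //=.
have -> : 9 = 3 * 3 :> R by ring.
exact: ler_pM.
Qed.

Lemma link_cosh_itv (p q r : R) : 0 < p <= 3 -> 0 < q <= 3 -> 0 < r <= 3 -> 0 < r + p * q <= 12.
Proof.
move=> /andP[p0 p3] /andP[q0 q3] /andP[r0 r3].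
have /andP[_ h] : 0 <= p * q <= 9 by apply: le3_mul; apply/andP; split=> //; exact: ltW.
have := mulr_gt0 p0 q0; move: (p * q) h => u h u0.
by apply/andP; split; lra.
Qed.

Lemma itv_le3 (m t : R) : 0 < m <= 1 -> 1 + m <= t <= 2 + m -> 0 < t <= 3.
Proof. by case/andP=> ? ? /andP[? ?]; apply/andP; split; lra. Qed.

(** 972 = 3 * 18^2, where 18 = 72 / 4 bounds the coefficients after division by D and 3 is the
    Cauchy-Schwarz factor. *)
Lemma linear_bound72 (D t p q r z1 z2 z3 : R) : 4 <= D ->
  D * t = p * z1 + q * z2 + r * z3 -> `|p| <= 72 -> `|q| <= 72 -> `|r| <= 72 ->
  t ^+ 2 <= 972 * (z1 ^+ 2 + z2 ^+ 2 + z3 ^+ 2).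
Proof.
move=> D4 et p72 q72 r72; set S := `|z1| + `|z2| + `|z3|.
have D0 : 0 <= D by apply: le_trans D4.
have b1 : `|D * t| <= 72 * S.
  have hm (k v : R) : `|k| <= 72 -> `|k * v| <= 72 * `|v| by move=> hk; rewrite normrM ler_wpM2r.
  have := ler_normD (p * z1 + q * z2) (r * z3); have := ler_normD (p * z1) (q * z2).
  have := hm _ z1 p72; have := hm _ z2 q72; have := hm _ z3 r72.
  rewrite et /S {et hm p72 q72 r72 D4 D0}; lra.
have b2 : 4 * `|t| <= 72 * S.
  by apply: le_trans b1; rewrite normrM (ger0_norm D0) ler_wpM2r.
have S0 : 0 <= S by rewrite /S !addr_ge0.
have b3 : t ^+ 2 <= (18 * S) ^+ 2.
  rewrite -(ger0_norm (sqr_ge0 t)) normrX lerXn2r ?nnegrE ?mulr_ge0 //.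
  by move: b2 {et b1 S0 p72 q72 r72}; move: `|t| S => v w; lra.
apply: le_trans b3 _.
rewrite -(ger0_norm (sqr_ge0 z1)) -(ger0_norm (sqr_ge0 z2)) -(ger0_norm (sqr_ge0 z3)).
rewrite !normrX /S; move: `|z1| `|z2| `|z3| => p' q' r'.
rewrite -subr_ge0.
have -> : 972 * (p' ^+ 2 + q' ^+ 2 + r' ^+ 2) - (18 * (p' + q' + r')) ^+ 2
    = 324 * ((p' - q') ^+ 2 + (p' - r') ^+ 2 + (q' - r') ^+ 2) by ring.
by apply: mulr_ge0; [exact: ler0n | rewrite !addr_ge0 ?sqr_ge0].
Qed.

Lemma sh2_mul_le72 (w k : R) : 0 < w -> w <= 8 -> 0 <= k <= 3 -> `|w * k| <= 72.
Proof.
move=> w0 w8 /andP[k0 k3]; rewrite ger0_norm ?mulr_ge0 ?(ltW w0) //.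
by apply: (@le_trans _ _ (8 * 3)); [apply: ler_pM => //; exact: ltW | lra].
Qed.

Lemma sh2_opp_le72 (w : R) : 0 < w -> w <= 8 -> `|- w| <= 72.
Proof. by move=> w0 w8; rewrite normrN ger0_norm ?(ltW w0) //; lra. Qed.

Lemma facet_coef_ge (p q r k : R) : 0 < p <= 3 -> 0 < q <= 3 -> 0 < r <= 3 -> 1 < k ->
  1 / 12 <= k / (r + p * q).
Proof.
move=> p3 q3 r3 k1; have /andP[d0 d12] := link_cosh_itv p3 q3 r3.
by rewrite ler_pdivlMr //; move: (_ + _) d0 d12 => d d0 d12; lra.
Qed.

Lemma mul_div_ge (m n F S T : R) : 0 < m -> m <= n -> 0 < F -> 0 <= S -> F / 192 * S <= T ->
  m / 192 * S <= n / F * T.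
Proof.
move=> m0 mn F0 S0 h.
have n0 : 0 <= n by apply: le_trans mn; exact: ltW.
have nF : 0 <= n / F by rewrite divr_ge0 // ltW.
apply: le_trans (ler_wpM2l nF h).
have -> : n / F * (F / 192 * S) = n / 192 * S by field; rewrite lt0r_neq0.
by apply: ler_wpM2r => //; rewrite ler_pM2r // invr_gt0.
Qed.

(** 192 = (2 * 12) * 8, from the bounds on 2 e and on w, w' in [pair_form_ge]. *)
Lemma pair_form_box (e w w' F t t' : R) : 0 < w <= 8 -> 0 < w' <= 8 -> 0 < e <= 12 ->
  e ^+ 2 - w * w' = F -> 0 < F ->
  F / 192 * (t ^+ 2 + t' ^+ 2) <= e * (t ^+ 2 / w + t' ^+ 2 / w') + 2 * t * t'.
Proof.
move=> /andP[w0 w8] /andP[w0' w8'] /andP[e0 e12] eF F0.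
have h : w * w' < e ^+ 2 by rewrite -subr_gt0 eF.
apply: le_trans (pair_form_ge t t' w0 w0' e0 h); rewrite eF.
have h1 := sqr_div8_le t w0 w8; have h2 := sqr_div8_le t' w0' w8'.
have -> : F / 192 * (t ^+ 2 + t' ^+ 2) = F / 24 * (t ^+ 2 / 8 + t' ^+ 2 / 8) by field.
apply: ler_pM; rewrite ?lerD //.
- by rewrite divr_ge0 // ltW.
- by rewrite addr_ge0 // divr_ge0 ?sqr_ge0.
- by rewrite ler_wpM2l ?(ltW F0) // lef_pV2 ?posrE; lra.
Qed.

(** With nonobtuse angles the link form is a sum of three pair forms with positive weights such as
    n23 / fd4; the opposite signs of the two variables match its negative mixed terms. Each
    coordinate occurs in two pairs, which turns 192 into 96. *)
Lemma sform_box_ge (m : R) x u : 0 < m <= 1 -> inbox (1 + m) (2 + m) x ->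
  m / 96 * (u.1.1 ^+ 2 + u.1.2 ^+ 2 + u.2 ^+ 2) <= sform x u.
Proof.
move=> m01 xb; have [x1 [[_ /andP[n34m _] _] /andP[n24m _] _ /andP[n23m _]] _ _] := box_nums m01 xb.
have [f1 f2 f3 f4] := gt1_fd x1; have [[w1 _ w3] _ w5 _] := gt1_sh2 x1.
move=> [[/andP[_ w1'] _ /andP[_ w3']] _ /andP[_ w5'] _]; have /andP[m0 m1] := m01.
case: (xb) => -[/(itv_le3 m01) a /(itv_le3 m01) A /(itv_le3 m01) b]
  /(itv_le3 m01) B /(itv_le3 m01) c /(itv_le3 m01) C.
rewrite /= in n34m n24m n23m.
have h12 : fd4 x / 192 * (u.1.1 ^+ 2 + (- u.1.2) ^+ 2) <=
    (e23 x + e12 x * e13 x) * (u.1.1 ^+ 2 / sh2 (e12 x) + (- u.1.2) ^+ 2 / sh2 (e13 x))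
    + 2 * u.1.1 * (- u.1.2).
  apply: pair_form_box; rewrite ?w1 ?w3 ?link_cosh_itv //.
  by rewrite /sh2 /fd4 /face_det; ring.
have h13 : fd3 x / 192 * (u.1.1 ^+ 2 + (- u.2) ^+ 2) <=
    (e24 x + e12 x * e14 x) * (u.1.1 ^+ 2 / sh2 (e12 x) + (- u.2) ^+ 2 / sh2 (e14 x))
    + 2 * u.1.1 * (- u.2).
  apply: pair_form_box; rewrite ?w1 ?w5 ?link_cosh_itv //.
  by rewrite /sh2 /fd3 /face_det; ring.
have h23 : fd2 x / 192 * (u.1.2 ^+ 2 + (- u.2) ^+ 2) <=
    (e34 x + e13 x * e14 x) * (u.1.2 ^+ 2 / sh2 (e13 x) + (- u.2) ^+ 2 / sh2 (e14 x))
    + 2 * u.1.2 * (- u.2).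
  apply: pair_form_box; rewrite ?w3 ?w5 ?link_cosh_itv //.
  by rewrite /sh2 /fd2 /face_det; ring.
have sq (s t : R) : 0 <= s ^+ 2 + t ^+ 2 by rewrite addr_ge0 ?sqr_ge0.
have g12 := mul_div_ge m0 n23m f4 (sq _ _) h12.
have g13 := mul_div_ge m0 n24m f3 (sq _ _) h13.
have g23 := mul_div_ge m0 n34m f2 (sq _ _) h23.
have := lerD (lerD g12 g13) g23.
rewrite -subr_ge0 => h; rewrite -subr_ge0; apply: le_trans h _.
rewrite le_eqVlt; apply/orP; left; apply/eqP; rewrite /sform /E12 /E13 /E14.
by field; rewrite !lt0r_neq0.
Qed.

Lemma P12_le x : allsix (fun t => 0 <= t <= 3) x -> `|P12 x| <= 72.
Proof.
case=> -[a A b] B c C.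
have /andP[h1 h2] := le3_mul b B; have /andP[h3 h4] := le3_mul c C.
have /andP[h5 h6] := le3_mul b c; have /andP[h7 h8] := le3_mul C B.
have /andP[a0 a3] := a.
have h9 : e12 x * (e13 x * e14 x + e23 x * e24 x) <= 3 * 18 by apply: ler_pM => //; lra.
have h10 : 0 <= e12 x * (e13 x * e14 x + e23 x * e24 x) by apply: mulr_ge0 => //; lra.
by rewrite ger0_norm /P12; lra.
Qed.

(** Each of the 6 coordinates of y is bounded by the inverse of [zeta] with constant 972;
    [facet_form_ge] bounds the squares of the angle velocities by 24 times [ngram x * qform x y],
    and [ngram] is at most 800. *)
Lemma link_part_box (m : R) x y : 0 < m <= 1 -> inbox (1 + m) (2 + m) x ->
  let z := zeta x y in e12 z = 0 -> e13 z = 0 -> e14 z = 0 ->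
  dot y y <= 972 * 6 * 24 * 800 * qform x y.
Proof.
move=> m01 xb z z1 z2 z3.
have [x1 _ [/andP[fd1l _] _ _ _] /andP[D1 D2]] := box_nums m01 xb.
move=> [[/andP[_ w1] /andP[_ w2] /andP[_ w3]] /andP[_ w4] /andP[_ w5] /andP[_ w6]].
have [[w1' w2' w3'] w4' w5' w6'] := gt1_sh2 x1.
case: (xb) => -[/(itv_le3 m01) pa /(itv_le3 m01) pA /(itv_le3 m01) pb]
  /(itv_le3 m01) pB /(itv_le3 m01) pc /(itv_le3 m01) pC.
have wk t : 0 < t <= 3 -> 0 <= t <= 3 by case/andP=> /ltW-> ->.
have [[a A b] B c C] : allsix (fun t => 0 <= t <= 3) x by split; first split; apply: wk.
have [[i12 i34 i13] i24 i14 i23] := zeta_invs y x1.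
rewrite -/z z1 z2 z3 in i12 i34 i13 i24 i14 i23.
have D0 : 0 < ngram x by apply: lt_le_trans D1.
have [P34b P24b P23b] : [/\ `|P34 x| <= 72, `|P24 x| <= 72 & `|P23 x| <= 72].
  by rewrite /P34 /P24 /P23; split; apply: P12_le; split=> //; split.
have l12 : e12 y ^+ 2 <= 972 * (e34 z ^+ 2 + e24 z ^+ 2 + e23 z ^+ 2).
  apply: (@linear_bound72 _ _ (- sh2 (e12 x)) (sh2 (e12 x) * e23 x) (sh2 (e12 x) * e24 x) _ _ _ D1);
    rewrite ?sh2_mul_le72 ?sh2_opp_le72 //; by rewrite i12; ring.
have l34 : e34 y ^+ 2 <= 972 * (e34 z ^+ 2 + e24 z ^+ 2 + e23 z ^+ 2).
  apply: (@linear_bound72 _ _ (P34 x) (sh2 (e34 x) * e14 x) (sh2 (e34 x) * e13 x) _ _ _ D1);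
    rewrite ?sh2_mul_le72 ?sh2_opp_le72 //; by rewrite i34; ring.
have l13 : e13 y ^+ 2 <= 972 * (e34 z ^+ 2 + e24 z ^+ 2 + e23 z ^+ 2).
  apply: (@linear_bound72 _ _ (sh2 (e13 x) * e23 x) (- sh2 (e13 x)) (sh2 (e13 x) * e34 x) _ _ _ D1);
    rewrite ?sh2_mul_le72 ?sh2_opp_le72 //; by rewrite i13; ring.
have l24 : e24 y ^+ 2 <= 972 * (e34 z ^+ 2 + e24 z ^+ 2 + e23 z ^+ 2).
  apply: (@linear_bound72 _ _ (sh2 (e24 x) * e14 x) (P24 x) (sh2 (e24 x) * e12 x) _ _ _ D1);
    rewrite ?sh2_mul_le72 ?sh2_opp_le72 //; by rewrite i24; ring.
have l14 : e14 y ^+ 2 <= 972 * (e34 z ^+ 2 + e24 z ^+ 2 + e23 z ^+ 2).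
  apply: (@linear_bound72 _ _ (sh2 (e14 x) * e24 x) (sh2 (e14 x) * e34 x) (- sh2 (e14 x)) _ _ _ D1);
    rewrite ?sh2_mul_le72 ?sh2_opp_le72 //; by rewrite i14; ring.
have l23 : e23 y ^+ 2 <= 972 * (e34 z ^+ 2 + e24 z ^+ 2 + e23 z ^+ 2).
  apply: (@linear_bound72 _ _ (sh2 (e23 x) * e13 x) (sh2 (e23 x) * e12 x) (P23 x) _ _ _ D1);
    rewrite ?sh2_mul_le72 ?sh2_opp_le72 //; by rewrite i23; ring.
have low : (e34 z ^+ 2 + e24 z ^+ 2 + e23 z ^+ 2) / 24 <= ngram x * qform x y.
  rewrite qform_link_part // -/z; apply: le_trans (facet_form_ge _ _ _ x1).
  have [[a1 A1 b1] B1 c1 C1] := gt1P x1.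
  have r1 := facet_coef_ge pA pB pC c1.
  have r2 := facet_coef_ge pA pC pB b1.
  have r3 := facet_coef_ge pB pC pA a1.
  have k1 := sqr_div8_le (e34 z) w2' w2; have k2 := sqr_div8_le (e24 z) w4' w4.
  have k3 := sqr_div8_le (e23 z) w6' w6.
  have f2 : 2 <= fd1 x / 2 by rewrite ler_pdivlMr // -natrM.
  have n34 : 0 <= e34 z ^+ 2 / 8 by rewrite divr_ge0 ?sqr_ge0.
  have n24 : 0 <= e24 z ^+ 2 / 8 by rewrite divr_ge0 ?sqr_ge0.
  have n23 : 0 <= e23 z ^+ 2 / 8 by rewrite divr_ge0 ?sqr_ge0.
  have i0 : 0 <= 1 / 12 :> R by rewrite divr_ge0.
  have t1 := ler_pM i0 (addr_ge0 n34 n24) r1 (lerD k1 k2).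
  have t2 := ler_pM i0 (addr_ge0 n34 n23) r2 (lerD k1 k3).
  have t3 := ler_pM i0 (addr_ge0 n24 n23) r3 (lerD k2 k3).
  have tt := lerD (lerD t1 t2) t3.
  have t0 := addr_ge0 (addr_ge0 (mulr_ge0 i0 (addr_ge0 n34 n24)) (mulr_ge0 i0 (addr_ge0 n34 n23)))
    (mulr_ge0 i0 (addr_ge0 n24 n23)).
  apply: le_trans (ler_pM _ t0 f2 tt) => //.
  by rewrite le_eqVlt; apply/orP; left; apply/eqP; field.
have q0 : 0 <= qform x y by rewrite -(pmulr_rge0 _ D0); apply: le_trans low; rewrite divr_ge0 // !addr_ge0 ?sqr_ge0.
have h800 : ngram x * qform x y <= 800 * qform x y by rewrite ler_wpM2r.
have hs := lerD (lerD (lerD (lerD (lerD l12 l34) l13) l24) l14) l23.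
rewrite /dot -!expr2; apply: le_trans hs _.
clear - low h800; lra.
Qed.

(** The two pieces of [qform_split] are bounded below separately; the factor 2 in the witness comes
    from |u + v|^2 <= 2 |u|^2 + 2 |v|^2. *)
Lemma qform_box_ge (m : R) : 0 < m <= 1 -> exists2 c, 0 < c &
  forall x y, inbox (1 + m) (2 + m) x -> c * dot y y <= qform x y.
Proof.
move=> m01; have /andP[m0 m1] := m01; pose K : R := 972 * 6 * 24 * 800.
have K0 : 96 <= K by rewrite /K; lra.
exists (m / (2 * K)); first by apply: divr_gt0 => //; lra.
move=> x y xb; have [x1 _ _ /andP[D1 _] _] := box_nums m01 xb.
have D0 : 0 < ngram x by lra.
have [u [z1 z2 z3 ->]] := qform_split y x1 D0.
have su := sform_box_ge u m01 xb.
have yb := link_part_box m01 xb z1 z2 z3.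
have [q0 _] := qform_link_part_ge0 x1 D0 z1 z2 z3.
rewrite -/K in yb; clearbody K; move: (qform x _) q0 yb => q q0; rewrite /dot /link_part /= => yb.
have sq2 (s t : R) : s * s <= 2 * ((s - t) * (s - t)) + 2 * t ^+ 2.
  have := sqr_ge0 (s - 2 * t); lra.
have h1 := sq2 (e12 y) u.1.1; have h2 := sq2 (e13 y) u.1.2; have h3 := sq2 (e14 y) u.2.
have p1 := sqr_ge0 (e34 y); have p2 := sqr_ge0 (e24 y); have p3 := sqr_ge0 (e23 y).
set N := e12 y * e12 y + _ + _ + _ + _ + _; set U := u.1.1 ^+ 2 + u.1.2 ^+ 2 + u.2 ^+ 2 in su *.
have hN : N <= 2 * U + 2 * (K * q) by rewrite /N /U; lra.
have U0 : 0 <= U by rewrite /U !addr_ge0 ?sqr_ge0.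
have c0 : 0 <= m / (2 * K) by apply: divr_ge0; lra.
have := ler_wpM2l c0 hN.
have Kn : K != 0 by apply: lt0r_neq0; lra.
have -> : m / (2 * K) * (2 * U + 2 * (K * q)) = m / K * U + m * q by field.
have : m / K * U <= m / 96 * U.
  by rewrite ler_wpM2r // ler_wpM2l ?(ltW m0) // lef_pV2 ?posrE //; lra.
have : m * q <= q by rewrite -[leRHS]mul1r ler_wpM2r.
lra.
Qed.

Definition norm1 y := `|e12 y| + `|e34 y| + `|e13 y| + `|e24 y| + `|e14 y| + `|e23 y|.

Lemma zeta_box_le (m : R) x y : 0 < m <= 1 -> inbox (1 + m) (2 + m) x ->
  allsix (fun t => `|t| <= 1000 * norm1 y) (zeta x y).
Proof.
move=> m01 xb; have [x1 ns fs _ ws] := box_nums m01 xb.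
have /andP[m0 m1] := m01.
have le3 t : 1 + m <= t <= 2 + m -> 0 <= t <= 3 by case/andP=> *; apply/andP; split; lra.
have nf (n f : R) : m <= n <= 75 -> 4 <= f <= 80 -> `|n / f| <= 19.
  move=> /andP[n0 n1] /andP[f0 f1].
  have fp : 0 < f by lra.
  rewrite ger0_norm; first by rewrite ler_pdivrMr //; lra.
  by rewrite divr_ge0 //; lra.
have en (n f e : R) p q : m <= n <= 75 -> 4 <= f <= 80 -> 1 + m <= e <= 2 + m ->
   1 + m <= p <= 2 + m -> 1 + m <= q <= 2 + m -> `|n * (e + p * q) / f| <= 228.
  move=> nb fb /le3/andP[e0 e3] /le3/andP[p0 p3] /le3/andP[q0 q3].
  have -> : n * (e + p * q) / f = n / f * (e + p * q) by ring.
  have pq : p * q <= 3 * 3 by apply: ler_pM.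
  have pq0 := mulr_ge0 p0 q0.
  have -> : 228 = 19 * 12 :> R by ring.
  by rewrite normrM; apply: ler_pM => //; [exact: nf | rewrite ger0_norm; lra].
have lin (E E' w p q r s y1 y2 y3 y4 y5 y6 : R) : `|E| <= 228 -> `|E'| <= 228 ->
   2 * m <= w <= 8 -> `|p| <= 19 -> `|q| <= 19 -> `|r| <= 19 -> `|s| <= 19 ->
   `|(E + E') * y1 + w * (y2 - p * y3 - q * y4 - r * y5 - s * y6)| <=
   1000 * (`|y1| + `|y2| + `|y3| + `|y4| + `|y5| + `|y6|).
  move=> hE hE' /andP[w0 w8] hp hq hr hs.
  have mm (k v c : R) : `|k| <= c -> `|k * v| <= c * `|v|.
    by move=> hk; rewrite normrM ler_wpM2r.
  have h1 : `|(E + E') * y1| <= 456 * `|y1|.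
    by apply: mm; apply: le_trans (ler_normD _ _) _; lra.
  have hin : `|y2 - p * y3 - q * y4 - r * y5 - s * y6| <=
     `|y2| + 19 * `|y3| + 19 * `|y4| + 19 * `|y5| + 19 * `|y6|.
    have := ler_normB (y2 - p * y3 - q * y4 - r * y5) (s * y6).
    have := ler_normB (y2 - p * y3 - q * y4) (r * y5).
    have := ler_normB (y2 - p * y3) (q * y4).
    have := ler_normB y2 (p * y3).
    have := mm _ y3 _ hp; have := mm _ y4 _ hq; have := mm _ y5 _ hr; have := mm _ y6 _ hs.
    lra.
  have h2 : `|w * (y2 - p * y3 - q * y4 - r * y5 - s * y6)| <=
     8 * (`|y2| + 19 * `|y3| + 19 * `|y4| + 19 * `|y5| + 19 * `|y6|).
    rewrite normrM; apply: ler_pM => //; rewrite ger0_norm //; lra.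
  have := ler_normD ((E + E') * y1) (w * (y2 - p * y3 - q * y4 - r * y5 - s * y6)).
  have := normr_ge0 y1; have := normr_ge0 y2; have := normr_ge0 y3.
  have := normr_ge0 y4; have := normr_ge0 y5; have := normr_ge0 y6.
  lra.
case: ns fs ws => -[k1 k2 k3] k4 k5 k6 [f1 f2 f3 f4] [[w1 w2 w3] w4 w5 w6].
case: xb => -[a A b] B c C.
have perm (y1 y2 y3 y4 y5 y6 : R) t : norm1 y = y1 + y2 + y3 + y4 + y5 + y6 ->
  t <= 1000 * (y1 + y2 + y3 + y4 + y5 + y6) -> t <= 1000 * norm1 y by move=> ->.
split; first split; rewrite /zeta /E12 /E34 /E13 /E24 /E14 /E23 /=;
  (apply: perm; last by apply: lin => //; first [exact: en | exact: nf]); rewrite /norm1; ring.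
Qed.
End Box.

(** * The hyperbolic cosine and a criterion for monotonicity *)

Section Lengths.
Variable R : realType.
Implicit Types x y L W : six R.

Definition hsin (t : R) := (expR t - expR (- t)) / 2.

Lemma cosh_sqrB1 (t : R) : sh2 (cosh t) = hsin t ^+ 2.
Proof.
rewrite /sh2 /cosh /hsin expRN; have := lt0r_neq0 (expR_gt0 t).
by move: (expR t) => e e0; field.
Qed.

Lemma hsin_gt0 (t : R) : 0 < t -> 0 < hsin t.
Proof.
move=> t0; rewrite /hsin divr_gt0 // subr_gt0 ltr_expR; lra.
Qed.

Lemma cosh_lt (s t : R) : 0 <= s -> s < t -> cosh s < cosh t.
Proof.
move=> s0 st; rewrite -subr_gt0.
have -> : cosh t - cosh s = (expR t - expR s) * (1 - expR (- (s + t))) / 2.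
  rewrite /cosh opprD !expRD !expRN.
  have := lt0r_neq0 (expR_gt0 t); have := lt0r_neq0 (expR_gt0 s).
  by move: (expR t) (expR s) => u v u0 v0; field; rewrite u0 v0.
apply: divr_gt0 => //; apply: mulr_gt0; rewrite subr_gt0 ?ltr_expR //.
by rewrite -expR0 ltr_expR; lra.
Qed.

Lemma cosh_le (s t : R) : 0 <= s -> s <= t -> cosh s <= cosh t.
Proof. by move=> s0; rewrite le_eqVlt => /predU1P[->//|/(cosh_lt s0)/ltW]. Qed.

Lemma cosh0 : cosh (0 : R) = 1.
Proof. by rewrite /cosh oppr0 expR0; field. Qed.

Lemma cosh_gt1 (t : R) : 0 < t -> 1 < cosh t.
Proof. by move=> t0; rewrite -cosh0 cosh_lt. Qed.

Lemma is_derive_cosh (t : R) : is_derive t 1 (@cosh R) (hsin t).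
Proof.
have h := derM (derD (is_derive_expR t) (der_comp (f := @expR R) (is_derive_expR (- t))
  (derN (is_derive_id t 1)))) (derC 2^-1 t).
by apply: is_derive_eq h _; rewrite /hsin; ring.
Qed.

Lemma arccosh_arg_gt0 (y : R) : 1 <= y -> 0 < y + Num.sqrt (y ^+ 2 - 1).
Proof. by move=> y1; rewrite ltr_pwDl ?sqrtr_ge0 //; lra. Qed.

Lemma arccoshK (y : R) : 1 <= y -> cosh (arccosh y) = y.
Proof.
move=> y1; have p := arccosh_arg_gt0 y1.
rewrite /cosh /arccosh expRN lnK ?posrE //.
have h : (y + Num.sqrt (y ^+ 2 - 1))^-1 = y - Num.sqrt (y ^+ 2 - 1).
  apply: (mulfI (lt0r_neq0 p)); rewrite mulfV ?lt0r_neq0 // [RHS]mulrC -subr_sqr sqr_sqrtr; first by ring.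
  by rewrite subr_ge0; nra.
by rewrite h; field.
Qed.

Lemma arccosh_ge0 (y : R) : 1 <= y -> 0 <= arccosh y.
Proof.
by move=> y1; apply: ln_ge0; have := sqrtr_ge0 (y ^+ 2 - 1); lra.
Qed.

Lemma arccosh_gt0 (y : R) : 1 < y -> 0 < arccosh y.
Proof.
by move=> y1; apply: ln_gt0; have := sqrtr_ge0 (y ^+ 2 - 1); lra.
Qed.

Lemma cosh_le_mono (s t : R) : 0 <= s -> 0 <= t -> (cosh s <= cosh t) = (s <= t).
Proof.
move=> s0 t0; apply/idP/idP; last exact: cosh_le.
by move=> h; rewrite leNgt; apply/negP => /(cosh_lt t0); rewrite ltNge h.
Qed.

Lemma arccosh_le (s t : R) : 1 <= s -> s <= t -> arccosh s <= arccosh t.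
Proof.
move=> s1 st; have t1 := le_trans s1 st.
by rewrite -cosh_le_mono ?arccosh_ge0 // !arccoshK.
Qed.

Lemma avoid_seq (V : seq R) (a b : R) : a < b -> exists2 c, a < c < b & c \notin V.
Proof.
elim: V a b => [|v V IH] a b ab; first by exists ((a + b) / 2); rewrite // !midf_lt.
have [vab|vab] := boolP (a < v < b).
  case/andP: vab => av vb; have [c /andP[vc cb] cV] := IH _ _ vb.
  exists c; first by rewrite cb (lt_trans av).
  by rewrite inE negb_or cV andbT gt_eqF.
have [c cab cV] := IH _ _ ab; exists c => //.
by rewrite inE negb_or cV andbT; apply: contraNneq vab => <-.
Qed.

(** If g 1 < g 0, choose a level c strictly between them and outside V. At the last time s with g s
    >= c one has g s = c, so the derivative there is positive, although g < c right after s. *)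
Lemma nondecreasing_off_finite (g : R -> R) (V : seq R) :
  (forall t, 0 <= t <= 1 -> {for t, continuous g}) ->
  (forall t, 0 <= t <= 1 -> g t \in V \/ exists2 d, 0 < d & is_derive t 1 g d) ->
  g 0 <= g 1.
Proof.
move=> gc gd; rewrite leNgt; apply/negP => /(avoid_seq V)[c /andP[c1 c0] cV].
pose A := [set t | 0 <= t <= 1 /\ c <= g t].
have A0 : A 0 by split; [rewrite lexx ler01 | exact: ltW].
have Aub : ubound A 1 by move=> t [/andP[]].
have sA : has_sup A by split; [exists 0 | exists 1].
pose s := sup A.
have s0 : 0 <= s by apply: sup_upper_bound.
have s1 : s <= 1 by apply: ge_sup => //; exists 0.
have s01 : 0 <= s <= 1 by rewrite s0.
have near_dist (P : R -> Prop) : (\forall t \near s, P t) ->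
    exists2 e, 0 < e & forall t, `|s - t| < e -> P t.
  by case/nbhs_ballP => e e0 h; exists e => // t st; apply: h.
have gs : c <= g s.
  rewrite leNgt; apply/negP => gsc.
  have [e e0 he] := near_dist _ (cvgr_lt _ (gc _ s01) _ gsc).
  have [t At st] := sup_adherent e0 sA.
  have ts : t <= s by apply: sup_upper_bound.
  have : g t < c by apply: he; rewrite ger0_norm ?subr_ge0 //; rewrite -/s in st; lra.
  by case: At => _; rewrite leNgt => /negP.
have s1' : s < 1.
  by rewrite lt_neqAle s1 andbT; apply/eqP => s1e; move: gs; rewrite s1e leNgt c1.
have after t : s < t -> t <= 1 -> g t < c.
  move=> st t1; rewrite ltNge; apply/negP => ct.
  have : t <= s by apply: sup_upper_bound => //; split=> //; rewrite t1 andbT; lra.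
  lra.
have step e : 0 < e -> exists2 t, s < t <= 1 & `|s - t| < e.
  move=> e0; exists (s + Num.min (e / 2) (1 - s)).
    by rewrite ltrDl lt_min divr_gt0 //= subr_gt0 s1' /= -lerBrDl ge_min lexx orbT.
  rewrite opprD addrA subrr sub0r normrN ger0_norm.
    by rewrite gt_min; apply/orP; left; lra.
  by rewrite le_min; apply/andP; split; lra.
have gsE : g s = c.
  apply/eqP; rewrite eq_le gs andbT leNgt; apply/negP => gsc.
  have [e e0 he] := near_dist _ (cvgr_gt _ (gc _ s01) _ gsc).
  have [t /andP[st t1] te] := step _ e0.
  by have := after _ st t1; have := he _ te; lra.
case: (gd _ s01) => [|[d d0 [gder gdE]]]; first by rewrite gsE (negPf cV).
have : h^-1 *: (g (h *: (1 : R) + s) - g s) @[h --> 0^'] --> d by rewrite -gdE; exact: gder.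
move=> /(cvgr_gt _)/(_ _ d0).
move=> /nbhs_ballP[e e0 he].
have [t /andP[st t1] te] := step _ e0.
have := he (t - s); rewrite /ball /= sub0r normrN distrC => /(_ te).
have ts0 : t - s != 0 by rewrite subr_eq0 gt_eqF.
move=> /(_ ts0); rewrite /GRing.scale /= mulr1 subrK gsE pmulr_rgt0 ?invr_gt0 ?subr_gt0 //.
by have := after _ st t1; lra.
Qed.

End Lengths.

(** * Angles along a segment of lengths *)

Section Segments.
Variable R : realType.
Implicit Types x y L W : six R.

Definition coshs L := Six (cosh (e12 L)) (cosh (e34 L)) (cosh (e13 L))
  (cosh (e24 L)) (cosh (e14 L)) (cosh (e23 L)).
Definition seg L W (t : R) := Six (e12 L + t * e12 W) (e34 L + t * e34 W)
  (e13 L + t * e13 W) (e24 L + t * e24 W) (e14 L + t * e14 W) (e23 L + t * e23 W).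
Definition hsins L W := Six (hsin (e12 L) * e12 W) (hsin (e34 L) * e34 W) (hsin (e13 L) * e13 W)
  (hsin (e24 L) * e24 W) (hsin (e14 L) * e14 W) (hsin (e23 L) * e23 W).
Definition positive L := allsix (fun t => 0 < t) L.

Lemma positive_gt1 L : positive L -> gt1 (coshs L).
Proof.
by case=> -[*] *; apply/and5P; split; rewrite ?cosh_gt1 //; apply/andP; rewrite !cosh_gt1.
Qed.

Lemma positive_seg L W (t : R) : positive L -> positive (seg L W 1) -> 0 <= t <= 1 ->
  positive (seg L W t).
Proof.
have aux (a b : R) : 0 < a -> 0 < a + 1 * b -> 0 <= t <= 1 -> 0 < a + t * b.
  move=> a0; rewrite mul1r => b0 /andP[t0 t1].
  have -> : a + t * b = (1 - t) * a + t * (a + b) by ring.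
  have [t2|t2] := leP t (1 / 2); first by have := mulr_ge0 t0 (ltW b0); nra.
  have t1' : 0 <= 1 - t by lra.
  by have := mulr_ge0 t1' (ltW a0); nra.
by case=> -[? ? ?] ? ? ? [[? ? ?] ? ? ?] ?; split; first split; apply: aux.
Qed.

Lemma six_derive_seg L W (t : R) :
  six_derive (fun s => coshs (seg L W s)) t (hsins (seg L W t) W).
Proof.
have aux (a b : R) : is_derive t 1 (fun s => cosh (a + s * b)) (hsin (a + t * b) * b).
  have h := derD (derC a t) (derM (is_derive_id t 1) (derC b t)).
  have h' : is_derive t 1 (fun s => a + s * b) b.
    by apply: is_derive_eq h _; ring.
  exact: (@der_comp _ (@cosh R) (fun s => a + s * b) t _ _ (is_derive_cosh _) h').
by split; first split; apply: aux.
Qed.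

Lemma is_derive_dot_angs L W (t : R) : positive (seg L W t) -> 0 < ngram (coshs (seg L W t)) ->
  is_derive t 1 (fun s => dot W (angs (coshs (seg L W s))))
    (qform (coshs (seg L W t)) (hsins (seg L W t) W) / Num.sqrt (ngram (coshs (seg L W t)))).
Proof.
move=> Lp D0; have x1 := positive_gt1 Lp.
have [[d12 d34 d13] d24 d14 d23] := is_derive_angs (six_derive_seg L W t) x1 D0.
have h := derD (derD (derD (derD (derD (derM (derC (e12 W) t) d12) (derM (derC (e34 W) t) d34))
  (derM (derC (e13 W) t) d13)) (derM (derC (e24 W) t) d24)) (derM (derC (e14 W) t) d14))
  (derM (derC (e23 W) t) d23).
apply: is_derive_eq h _; rewrite /qform.
move: (zeta (coshs (seg L W t)) (hsins (seg L W t) W)) => z.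
have r0 : 0 < Num.sqrt (ngram (coshs (seg L W t))) by rewrite sqrtr_gt0.
have sq (s : R) : 0 < s -> Num.sqrt (ngram (coshs (seg L W t)) * sh2 (cosh s)) =
    Num.sqrt (ngram (coshs (seg L W t))) * hsin s.
  move=> s0; rewrite sqrtrM ?(ltW D0) // cosh_sqrB1 sqrtr_sqr ger0_norm //.
  by apply: ltW; exact: hsin_gt0.
have [[p12 p34 p13] p24 p14 p23] := Lp.
rewrite !sq // !cosh_sqrB1 /hsins /=.
move: (hsin_gt0 p12) (hsin_gt0 p34) (hsin_gt0 p13) (hsin_gt0 p24) (hsin_gt0 p14) (hsin_gt0 p23).
move: (Num.sqrt _) r0 => r r0.
move: (hsin _) (hsin _) (hsin _) (hsin _) (hsin _) (hsin _) => h1 h2 h3 h4 h5 h6.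
move=> /lt0r_neq0 q1 /lt0r_neq0 q2 /lt0r_neq0 q3 /lt0r_neq0 q4 /lt0r_neq0 q5 /lt0r_neq0 q6.
by field; rewrite q1 q2 q3 q4 q5 q6 lt0r_neq0.
Qed.

Lemma is_derive_continuous (f : R -> R) (t d : R) : is_derive t 1 f d -> {for t, continuous f}.
Proof. by move=> [fd _]; apply: differentiable_continuous; exact/derivable1_diffP. Qed.

Lemma continuous_ang12 (X : R -> six R) t y : six_derive X t y ->
  0 < fd3 (X t) -> 0 < fd4 (X t) -> {for t, continuous (fun s => ang12 (X s))}.
Proof.
move=> [[dX12 dX34 dX13] dX24 dX14 dX23] f3 f4.
have s3 : 0 < Num.sqrt (fd3 (X t)) by rewrite sqrtr_gt0.
have s4 : 0 < Num.sqrt (fd4 (X t)) by rewrite sqrtr_gt0.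
have d3 := @der_sqrt _ (fun t => fd3 (X t)) t _ f3 (is_derive_face_det dX12 dX14 dX24).
have d4 := @der_sqrt _ (fun t => fd4 (X t)) t _ f4 (is_derive_face_det dX12 dX13 dX23).
have dn := is_derive_phi_num dX12 dX13 dX14 dX23 dX24 dX34.
have dphi := derM dn (@derV _ (fun t => Num.sqrt (fd4 (X t)) * Num.sqrt (fd3 (X t))) t _
  (lt0r_neq0 (mulr_gt0 s4 s3)) (derM d4 d3)).
exact: continuous_comp (is_derive_continuous dphi) (@continuous_cacos R _).
Qed.

Lemma continuous_dot_angs L W (t : R) : positive (seg L W t) ->
  {for t, continuous (fun s => dot W (angs (coshs (seg L W s))))}.
Proof.
move=> Lp; have x1 := positive_gt1 Lp; have dX := six_derive_seg L W t.
have d12 Y v : six_derive Y t v -> six_derive (fun s => swap12 (Y s)) t (swap12 v) by case=> -[].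
have d23 Y v : six_derive Y t v -> six_derive (fun s => swap23 (Y s)) t (swap23 v) by case=> -[].
have d34 Y v : six_derive Y t v -> six_derive (fun s => swap34 (Y s)) t (swap34 v) by case=> -[].
have cM (c : R) (f : R -> R) : {for t, continuous f} -> {for t, continuous (fun s => c * f s)}.
  by move=> cf; apply: continuousM => //; exact: cst_continuous.
have cD (f g : R -> R) : {for t, continuous f} -> {for t, continuous g} ->
   {for t, continuous (fun s => f s + g s)}.
  by move=> cf cg; exact: continuousD.
rewrite /dot /angs /=; do 5 ?[apply: (cD _ _)]; apply: cM.
all: have cA Y v (dY : six_derive Y t v) (y1 : gt1 (Y t)) : {for t, continuous (fun s => ang12 (Y s))}
  by have [_ _ f3 f4] := gt1_fd y1; exact: continuous_ang12 dY f3 f4.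
- exact: cA dX x1.
- apply: cA (d23 _ _ (d12 _ _ (d34 _ _ (d23 _ _ dX)))) _.
  by rewrite !(gt1_swap12, gt1_swap23, gt1_swap34).
- by apply: cA (d23 _ _ dX) _; rewrite !(gt1_swap12, gt1_swap23, gt1_swap34).
- apply: cA (d23 _ _ (d12 _ _ (d34 _ _ dX))) _.
  by rewrite !(gt1_swap12, gt1_swap23, gt1_swap34).
- apply: cA (d23 _ _ (d34 _ _ dX)) _.
  by rewrite !(gt1_swap12, gt1_swap23, gt1_swap34).
- apply: cA (d23 _ _ (d12 _ _ dX)) _.
  by rewrite !(gt1_swap12, gt1_swap23, gt1_swap34).
Qed.

(** All sums in which each of the six angles is 0 or pi. That this list is finite is what allows a
    segment to cross the degenerate region. *)
Definition degenerate_values W : seq R :=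
  let v (w : R) := [:: w * 0; w * pi] in
  let add s t := [seq a + b | a <- s, b <- t] in
  add (add (add (add (add (v (e12 W)) (v (e34 W))) (v (e13 W))) (v (e24 W))) (v (e14 W))) (v (e23 W)).

Lemma degenerate_dot W x : gt1 x -> ngram x <= 0 -> dot W (angs x) \in degenerate_values W.
Proof.
move=> x1 D0.
have g12 (u : six R) : ngram (swap12 u) = ngram u by case: (swap12E u).
have g23 (u : six R) : ngram (swap23 u) = ngram u by case: (swap23E u).
have g34 (u : six R) : ngram (swap34 u) = ngram u by case: (swap34E u).
have v w z : gt1 z -> ngram z <= 0 -> w * ang12 z \in [:: w * 0; w * pi].
  by move=> z1 Dz; rewrite !inE; case: (ang12_degenerate z1 Dz) => ->; rewrite eqxx ?orbT.
rewrite /dot /angs /=.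
by do 5 (apply: allpairs_f; last by
   apply: v; rewrite ?(gt1_swap12, gt1_swap23, gt1_swap34, g12, g23, g34));
  apply: v; rewrite ?(gt1_swap12, gt1_swap23, gt1_swap34, g12, g23, g34).
Qed.

Lemma hsins_neq0 L W : positive L -> W <> Six 0 0 0 0 0 0 -> hsins L W <> Six 0 0 0 0 0 0.
Proof.
have c (a b : R) : 0 < a -> hsin a * b = 0 -> b = 0.
  by move=> /hsin_gt0 a0 /eqP; rewrite mulf_eq0 gt_eqF //= => /eqP.
case=> -[p1 p2 p3] p4 p5 p6 W0 [] /(c _ _ p1) h1 /(c _ _ p2) h2 /(c _ _ p3) h3 /(c _ _ p4) h4
  /(c _ _ p5) h5 /(c _ _ p6) h6.
by apply: W0; case: W h1 h2 h3 h4 h5 h6 => /= ? ? ? ? ? ? -> -> -> -> -> ->.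
Qed.

Lemma seg0 L W : seg L W 0 = L.
Proof. by case: L => *; rewrite /seg /= !mul0r !addr0. Qed.

Lemma dot0l x : dot (Six 0 0 0 0 0 0) x = 0.
Proof. by rewrite /dot /= !mul0r !addr0. Qed.

Lemma dot_angs_le L W : positive L -> positive (seg L W 1) ->
  dot W (angs (coshs L)) <= dot W (angs (coshs (seg L W 1))).
Proof.
move=> Lp L1p; have [->|W0] := pselect (W = Six 0 0 0 0 0 0).
  by rewrite !dot0l.
rewrite -{1}(seg0 L W).
apply: (@nondecreasing_off_finite _ (fun t => dot W (angs (coshs (seg L W t)))) (degenerate_values W)).
  by move=> t t01; apply: continuous_dot_angs; exact: positive_seg.
move=> t t01; have Lt := positive_seg Lp L1p t01.
have x1 := positive_gt1 Lt.
have [D0|D0] := ltP 0 (ngram (coshs (seg L W t))); last by left; exact: degenerate_dot.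
right; exists (qform (coshs (seg L W t)) (hsins (seg L W t) W) / Num.sqrt (ngram (coshs (seg L W t)))).
  by rewrite divr_gt0 ?sqrtr_gt0 //; apply: qform_gt0 => //; exact: hsins_neq0.
exact: is_derive_dot_angs.
Qed.

End Segments.

(** * Strong monotonicity and Lipschitz bounds for one tetrahedron *)

Section Coercivity.
Variable R : realType.
Implicit Types x y L W : six R.

Lemma inbox_seg (p q t : R) L W : positive L -> positive (seg L W 1) -> 0 <= t <= 1 ->
  inbox p q (coshs L) -> inbox p q (coshs (seg L W 1)) -> inbox p q (coshs (seg L W t)).
Proof.
have aux (a b : R) : 0 < a -> 0 < a + 1 * b -> 0 <= t <= 1 -> p <= cosh a <= q ->
    p <= cosh (a + 1 * b) <= q -> p <= cosh (a + t * b) <= q.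
  move=> a0; rewrite mul1r => b0 /andP[t0 t1] /andP[pa aq] /andP[pb bq].
  have [b1|b1] := leP 0 b.
    have h1 : cosh a <= cosh (a + t * b) by apply: cosh_le; [exact: ltW | rewrite lerDl mulr_ge0].
    have h2 : cosh (a + t * b) <= cosh (a + b).
      by have tb := mulr_ge0 t0 b1; apply: cosh_le; nra.
    by rewrite (le_trans pa) ?(le_trans h2).
  have h3 : a + b <= a + t * b by nra.
  have h1 : cosh (a + b) <= cosh (a + t * b) by apply: cosh_le => //; exact: ltW.
  have h2 : cosh (a + t * b) <= cosh a by apply: cosh_le; nra.
  by rewrite (le_trans pb) ?(le_trans h2).
by case=> -[? ? ?] ? ? ? [[? ? ?] ? ? ?] ? [[? ? ?] ? ? ?] [[? ? ?] ? ? ?];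
  split; first split; apply: aux.
Qed.

Lemma dot_hsins_ge (m : R) L W : positive L -> allsix (fun t => 2 * m <= sh2 t <= 8) (coshs L) ->
  2 * m * dot W W <= dot (hsins L W) (hsins L W).
Proof.
move=> _; have aux (a b : R) : 2 * m <= sh2 (cosh a) <= 8 -> 2 * m * (b * b) <= hsin a * b * (hsin a * b).
  rewrite cosh_sqrB1 => /andP[h _].
  have -> : hsin a * b * (hsin a * b) = hsin a ^+ 2 * (b * b) by ring.
  by apply: ler_wpM2r => //; rewrite -expr2 sqr_ge0.
rewrite /dot /hsins /= => -[[h1 h2 h3] h4 h5 h6].
by rewrite !mulrDr; do ?apply: lerD; apply: aux.
Qed.

Lemma coercive_box (m : R) : 0 < m <= 1 -> exists2 c, 0 < c & forall L W,
  positive L -> positive (seg L W 1) -> inbox (1 + m) (2 + m) (coshs L) ->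
  inbox (1 + m) (2 + m) (coshs (seg L W 1)) ->
  c * dot W W <= dot W (angs (coshs (seg L W 1))) - dot W (angs (coshs L)).
Proof.
move=> m01; have [c c0 hc] := qform_box_ge m01; have /andP[m0 _] := m01.
(* On the box sinh^2 is at least 2 m, and sqrt (ngram) is at most 30 because [ngram] is at most
   800. *)
exists (c * (2 * m) / 30); first by rewrite divr_gt0 // !mulr_gt0.
move=> L W Lp L1p Lb L1b.
have inb (t : R) : 0 <= t <= 1 -> inbox (1 + m) (2 + m) (coshs (seg L W t)).
  by move=> t01; apply: inbox_seg.
pose df t := qform (coshs (seg L W t)) (hsins (seg L W t) W) / Num.sqrt (ngram (coshs (seg L W t))).
have der (t : R) : 0 <= t <= 1 -> is_derive t 1 (fun s => dot W (angs (coshs (seg L W s)))) (df t).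
  move=> t01; apply: is_derive_dot_angs; first exact: positive_seg.
  by have [_ _ _ /andP[D1 _] _] := box_nums m01 (inb _ t01); lra.
have [||t] := @MVT_segment R (fun s => dot W (angs (coshs (seg L W s)))) df 0 1 ler01.
- by move=> t; rewrite in_itv /= => /andP[t0 t1]; apply: der; rewrite !ltW.
- apply: derivable_within_continuous => t; rewrite in_itv /= => t01.
  by case: (der _ t01).
rewrite in_itv /= subr0 mulr1 => t01; rewrite seg0 => ->.
have [x1 _ _ /andP[D1 D2] ws] := box_nums m01 (inb _ t01).
have h1 := hc _ (hsins (seg L W t) W) (inb _ t01).
have h2 := dot_hsins_ge W (positive_seg Lp L1p t01) ws.
have q : c * (2 * m) * dot W W <= qform (coshs (seg L W t)) (hsins (seg L W t) W).
  by apply: le_trans h1; rewrite -mulrA ler_wpM2l // ltW.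
have d0 : 0 <= dot W W by rewrite /dot -!expr2 !addr_ge0 ?sqr_ge0.
have r0 : 0 < Num.sqrt (ngram (coshs (seg L W t))) by rewrite sqrtr_gt0; lra.
have r30 : Num.sqrt (ngram (coshs (seg L W t))) <= 30.
  have -> : 30 = Num.sqrt (30 ^+ 2) :> R by rewrite sqrtr_sqr ger0_norm.
  by rewrite ler_wsqrtr //; lra.
rewrite /df mulrAC; apply: ler_pM => //.
- by rewrite !mulr_ge0 // ?mulr_ge0 // ltW.
- by rewrite lef_pV2 ?posrE.
Qed.

Definition sixB (u v : six R) := Six (e12 u - e12 v) (e34 u - e34 v) (e13 u - e13 v)
  (e24 u - e24 v) (e14 u - e14 v) (e23 u - e23 v).

Lemma lipschitz_box (m : R) : 0 < m <= 1 -> exists2 K, 0 < K & forall L W,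
  positive L -> positive (seg L W 1) -> inbox (1 + m) (2 + m) (coshs L) ->
  inbox (1 + m) (2 + m) (coshs (seg L W 1)) ->
  allsix (fun t => `|t| <= K * norm1 W) (sixB (angs (coshs (seg L W 1))) (angs (coshs L))).
Proof.
move=> m01; have /andP[m0 _] := m01.
(* [ngram] is at least 4 and [sh2] at least 2 m, so r bounds the denominators of the angle
   velocities from below. The 3 in the final constant bounds sinh. *)
pose r := Num.sqrt (8 * m); have r0 : 0 < r by rewrite sqrtr_gt0 mulr_gt0.
have [K1 K10 zb] : exists2 K1 : R, 0 < K1 & forall x y, inbox (1 + m) (2 + m) x ->
    allsix (fun t => `|t| <= K1 * norm1 y) (zeta x y).
  by exists 1000; [rewrite ltr0n | move=> x y; exact: zeta_box_le].
exists (3 * K1 / r); first by rewrite divr_gt0 // mulr_gt0.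
move=> L W Lp L1p Lb L1b.
have inb (t : R) : 0 <= t <= 1 -> inbox (1 + m) (2 + m) (coshs (seg L W t)).
  by move=> t01; apply: inbox_seg.
have nh (t : R) : 0 <= t <= 1 -> norm1 (hsins (seg L W t) W) <= 3 * norm1 W.
  move=> t01; have [_ _ _ _ ws] := box_nums m01 (inb _ t01).
  have aux (a b : R) : 2 * m <= sh2 (cosh a) <= 8 -> `|hsin a * b| <= 3 * `|b|.
    rewrite cosh_sqrB1 => /andP[_ h]; rewrite normrM ler_wpM2r //.
    by rewrite -(@ler_pXn2r _ 2) ?nnegrE // -normrX ger0_norm ?sqr_ge0 //; lra.
  by case: ws => -[? ? ?] ? ? ?; rewrite /norm1 !mulrDr; do ?apply: lerD; apply: aux.
have step (f : R -> R) (k : six R -> R) :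
    (forall t : R, 0 <= t <= 1 -> `|k (zeta (coshs (seg L W t)) (hsins (seg L W t) W))|
       <= K1 * norm1 (hsins (seg L W t) W)) ->
    (forall t : R, 0 <= t <= 1 -> 2 * m <= sh2 (k (coshs (seg L W t)))) ->
    (forall t : R, 0 <= t <= 1 -> is_derive t 1 f (k (zeta (coshs (seg L W t)) (hsins (seg L W t) W))
       / Num.sqrt (ngram (coshs (seg L W t)) * sh2 (k (coshs (seg L W t)))))) ->
    `|f 1 - f 0| <= 3 * K1 / r * norm1 W.
  move=> kz ks der.
  pose df (t : R) := k (zeta (coshs (seg L W t)) (hsins (seg L W t) W))
       / Num.sqrt (ngram (coshs (seg L W t)) * sh2 (k (coshs (seg L W t)))).
  have [||t] := @MVT_segment R f df 0 1 ler01.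
  - by move=> t; rewrite in_itv /= => /andP[t0 t1]; apply: der; rewrite !ltW.
  - apply: derivable_within_continuous => t; rewrite in_itv /= => t01.
    by case: (der _ t01).
  rewrite in_itv /= subr0 mulr1 => t01 ->; rewrite /df.
  have [_ _ _ /andP[D1 _] _] := box_nums m01 (inb _ t01).
  have rs : r <= Num.sqrt (ngram (coshs (seg L W t)) * sh2 (k (coshs (seg L W t)))).
    rewrite /r ler_wsqrtr //; have -> : 8 * m = 4 * (2 * m) by ring.
    by apply: ler_pM => //; [lra | exact: ks].
  have s0 := lt_le_trans r0 rs.
  rewrite normrM normfV (gtr0_norm s0) [leRHS]mulrAC; apply: ler_pM => //.
  - apply: le_trans (kz _ t01) _.
    by rewrite (mulrC 3) -mulrA ler_wpM2l ?(ltW K10) // nh.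
  - by rewrite lef_pV2 ?posrE.
have der (t : R) (t01 : 0 <= t <= 1) := is_derive_angs (six_derive_seg L W t)
   (positive_gt1 (positive_seg Lp L1p t01)).
have D0 (t : R) : 0 <= t <= 1 -> 0 < ngram (coshs (seg L W t)).
  by move=> t01; have [_ _ _ /andP[D1 _] _] := box_nums m01 (inb _ t01); lra.
have sb (t : R) (t01 : 0 <= t <= 1) := box_nums m01 (inb _ t01).
rewrite -{2}(seg0 L W).
split; first split.
- apply: (step (fun t => e12 (angs (coshs (seg L W t)))) (@e12 R)).
  + by move=> t t01; case: (zb _ (hsins (seg L W t) W) (inb _ t01)) => -[].
  + by move=> t t01; case: (sb t t01) => _ _ _ _ [[/andP[]]].
  + by move=> t t01; case: (der t t01 (D0 t t01)) => -[].
- apply: (step (fun t => e34 (angs (coshs (seg L W t)))) (@e34 R)).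
  + by move=> t t01; case: (zb _ (hsins (seg L W t) W) (inb _ t01)) => -[].
  + by move=> t t01; case: (sb t t01) => _ _ _ _ [[_ /andP[]]].
  + by move=> t t01; case: (der t t01 (D0 t t01)) => -[].
- apply: (step (fun t => e13 (angs (coshs (seg L W t)))) (@e13 R)).
  + by move=> t t01; case: (zb _ (hsins (seg L W t) W) (inb _ t01)) => -[].
  + by move=> t t01; case: (sb t t01) => _ _ _ _ [[_ _ /andP[]]].
  + by move=> t t01; case: (der t t01 (D0 t t01)) => -[].
- apply: (step (fun t => e24 (angs (coshs (seg L W t)))) (@e24 R)).
  + by move=> t t01; case: (zb _ (hsins (seg L W t) W) (inb _ t01)) => -[].
  + by move=> t t01; case: (sb t t01) => _ _ _ _ [_ /andP[]].
  + by move=> t t01; case: (der t t01 (D0 t t01)) => -[].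
- apply: (step (fun t => e14 (angs (coshs (seg L W t)))) (@e14 R)).
  + by move=> t t01; case: (zb _ (hsins (seg L W t) W) (inb _ t01)) => -[].
  + by move=> t t01; case: (sb t t01) => _ _ _ _ [_ _ /andP[]].
  + by move=> t t01; case: (der t t01 (D0 t t01)) => -[].
- apply: (step (fun t => e23 (angs (coshs (seg L W t)))) (@e23 R)).
  + by move=> t t01; case: (zb _ (hsins (seg L W t) W) (inb _ t01)) => -[].
  + by move=> t t01; case: (sb t t01) => _ _ _ _ [_ _ _ /andP[]].
  + by move=> t t01; case: (der t t01 (D0 t t01)) => -[].
Qed.

(* Coercivity on the initial part of a segment propagates to its end point by
   monotonicity. *)
Lemma coercive_far (m : R) : 0 < m <= 1 -> exists2 c, 0 < c & forall L W s,
  0 < s <= 1 -> positive L -> positive (seg L W 1) -> inbox (1 + m) (2 + m) (coshs L) ->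
  inbox (1 + m) (2 + m) (coshs (seg L W s)) ->
  c * s * dot W W <= dot W (angs (coshs (seg L W 1))) - dot W (angs (coshs L)).
Proof.
move=> m01; have [c c0 hc] := coercive_box m01; exists c => // L W s /andP[s0 s1] Lp L1p Lb Lsb.
pose scale k := Six (k * e12 W) (k * e34 W) (k * e13 W) (k * e24 W) (k * e14 W) (k * e23 W).
have segs : seg L (scale s) 1 = seg L W s by rewrite /seg /scale /= !mul1r.
have Lsp : positive (seg L W s) by apply: positive_seg => //; rewrite s1 ltW.
have h1 := hc L (scale s); rewrite segs in h1; have {}h1 := h1 Lp Lsp Lb Lsb.
have seg1 : seg (seg L W s) (scale (1 - s)) 1 = seg L W 1.
  by rewrite /seg /scale /=; congr Six; ring.
have := @dot_angs_le _ (seg L W s) (scale (1 - s)); rewrite seg1 => /(_ Lsp L1p) h2.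
have ds k v : dot (scale k) v = k * dot W v by rewrite /dot /scale /=; ring.
have dss k : dot (scale k) (scale k) = k ^+ 2 * dot W W by rewrite /dot /scale /=; ring.
rewrite !ds in h2; rewrite dss !ds in h1.
have h3 : c * s * dot W W <= dot W (angs (coshs (seg L W s))) - dot W (angs (coshs L)).
  by rewrite -(ler_pM2l s0); lra.
have [e1|s1'] := eqVneq s 1; first by rewrite -e1; rewrite e1 in h3 *.
have s2 : 0 < 1 - s by rewrite subr_gt0 lt_neqAle s1'.
have h4 : dot W (angs (coshs (seg L W s))) <= dot W (angs (coshs (seg L W 1))).
  by rewrite -(ler_pM2l s2).
lra.
Qed.

End Coercivity.

(** * Monotonicity of the angles in the labels *)

Section AngleBounds.
Variable R : realType.
Implicit Types x y : six R.

Definition phi12 x := n12 x / (Num.sqrt (fd4 x) * Num.sqrt (fd3 x)).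

Lemma ang12E x : ang12 x = cacos (phi12 x). Proof. by []. Qed.

Lemma phi12_swap12 x : phi12 (swap12 x) = phi12 x.
Proof. by have [[p _ _] _ [_ _ q3 q4] _] := swap12E x; rewrite /phi12 p q3 q4. Qed.

Lemma phi12_swap34 x : phi12 (swap34 x) = phi12 x.
Proof. by have [[p _ _] _ [_ _ q3 q4] _] := swap34E x; rewrite /phi12 p q3 q4 (mulrC (Num.sqrt _)). Qed.

Definition box12 x := inbox 1 2 x.

Lemma box12_ge0 x : box12 x -> allsix (fun t => 0 <= t) (numsix x) /\
  [/\ 0 < fd1 x, 0 < fd2 x, 0 < fd3 x & 0 < fd4 x].
Proof.
have nn (p q r s t w : R) : 1 <= p <= 2 -> 1 <= q <= 2 -> 1 <= r <= 2 ->
    1 <= s <= 2 -> 1 <= t <= 2 -> 1 <= w <= 2 -> 0 <= phi_num p q r s t w.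
  move=> p1 /andP[q1 _] /andP[r1 _] /andP[s1 _] /andP[t1 _] /andP[_ w1].
  by have := @phi_num_ge R 0 p q r s t w (lexx 0); rewrite !addr0 mulr0; apply.
have ff (p q r : R) : 1 <= p <= 2 -> 1 <= q <= 2 -> 1 <= r <= 2 -> 0 < face_det p q r.
  move=> /andP[p1 _] /andP[q1 _] /andP[r1 _].
  exact: lt_le_trans (face_det_ge4 p1 q1 r1).
by case=> -[a A b] B c C; split; [split; first split; apply: nn | split; apply: ff].
Qed.

Definition with13 x t := Six (e12 x) (e34 x) t (e24 x) (e14 x) (e23 x).
Definition with34 x t := Six (e12 x) t (e13 x) (e24 x) (e14 x) (e23 x).

Lemma sqrt_ratio_le (n n' F F' : R) : 0 <= n -> 0 <= n' -> 0 < F -> 0 < F' ->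
  n ^+ 2 * F' <= n' ^+ 2 * F -> n / Num.sqrt F <= n' / Num.sqrt F'.
Proof.
move=> n0 n0' F0 F0' h.
have s0 : 0 < Num.sqrt F by rewrite sqrtr_gt0.
have s0' : 0 < Num.sqrt F' by rewrite sqrtr_gt0.
rewrite ler_pdivrMr // mulrAC ler_pdivlMr //.
rewrite -(@ler_pXn2r _ 2) ?nnegrE ?mulr_ge0 // ?(ltW s0) ?(ltW s0') //.
by rewrite !exprMn !sqr_sqrtr // ltW.
Qed.

(** After squaring and clearing denominators, the difference is (t - e13) sh2 (e12) times a
    combination of cosine numerators, all nonnegative on [1, 2]. *)
Lemma phi12_mono13 x t : box12 x -> box12 (with13 x t) -> e13 x <= t -> phi12 x <= phi12 (with13 x t).
Proof.
move=> bx bt xt.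
have [[[n12x _ _] _ _ n23x] [_ _ f3x f4x]] := box12_ge0 bx.
have [[[n12t _ _] _ _ n23t] [_ _ f3t f4t]] := box12_ge0 bt.
rewrite /= in n12x n23x n12t n23t.
have e3 : fd3 (with13 x t) = fd3 x by [].
rewrite /phi12 e3 !invfM !mulrA; apply: ler_wpM2r; first by rewrite invr_ge0 sqrtr_ge0.
apply: sqrt_ratio_le => //; rewrite -subr_ge0.
have -> : n12 (with13 x t) ^+ 2 * fd4 x - n12 x ^+ 2 * fd4 (with13 x t) =
  (t - e13 x) * sh2 (e12 x) * (n12 x * n23 (with13 x t) + n12 (with13 x t) * n23 x).
  by case: (x) => *; unfold_tet; ring.
have w0 : 0 <= sh2 (e12 x).
  by case: bx => -[/andP[a1 _] _ _] _ _ _; rewrite /sh2; nra.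
by apply: mulr_ge0; [apply: mulr_ge0 => //; rewrite subr_ge0 | apply: addr_ge0; exact: mulr_ge0].
Qed.

Lemma phi12_mono34 x t : box12 x -> box12 (with34 x t) -> e34 x <= t -> phi12 (with34 x t) <= phi12 x.
Proof.
move=> bx bt xt.
have [_ [_ _ f3x f4x]] := box12_ge0 bx.
have e3 : fd3 (with34 x t) = fd3 x by [].
have e4 : fd4 (with34 x t) = fd4 x by [].
rewrite /phi12 e3 e4; apply: ler_wpM2r; first by rewrite invr_ge0 mulr_ge0 ?sqrtr_ge0.
have -> : n12 (with34 x t) = n12 x - sh2 (e12 x) * (t - e34 x).
  by case: (x) => *; unfold_tet; ring.
have w0 : 0 <= sh2 (e12 x).
  by case: bx => -[/andP[a1 _] _ _] _ _ _; rewrite /sh2; nra.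
by rewrite gerBl mulr_ge0 // subr_ge0.
Qed.

Lemma phi12_mono x x' : box12 x -> box12 x' -> e12 x = e12 x' ->
  e13 x <= e13 x' -> e24 x <= e24 x' -> e14 x <= e14 x' -> e23 x <= e23 x' ->
  e34 x' <= e34 x -> phi12 x <= phi12 x'.
Proof.
case: x x' => a A b B c C [a' A' b' B' c' C'] /=.
case=> /= -[ha hA hb] hB hc hC [/= [ha' hA' hb'] hB' hc' hC'] <- lb lB lc lC lA.
have h1 : phi12 (Six a A b B c C) <= phi12 (Six a A b' B c C).
  exact: (@phi12_mono13 (Six a A b B c C) b').
have h2 : phi12 (Six a A b' B c C) <= phi12 (Six a A b' B c C').
  rewrite -(phi12_swap12 (Six a A b' B c C)) -(phi12_swap12 (Six a A b' B c C')).
  exact: (@phi12_mono13 (Six a A C c B b') C').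
have h3 : phi12 (Six a A b' B c C') <= phi12 (Six a A b' B c' C').
  rewrite -(phi12_swap34 (Six a A b' B c C')) -(phi12_swap34 (Six a A b' B c' C')).
  exact: (@phi12_mono13 (Six a A c C' b' B) c').
have h4 : phi12 (Six a A b' B c' C') <= phi12 (Six a A b' B' c' C').
  rewrite -(phi12_swap34 (Six a A b' B c' C')) -(phi12_swap34 (Six a A b' B' c' C')).
  rewrite -(phi12_swap12 (swap34 (Six a A b' B c' C'))) -(phi12_swap12 (swap34 (Six a A b' B' c' C'))).
  exact: (@phi12_mono13 (Six a A B b' C' c') B').
have h5 : phi12 (Six a A b' B' c' C') <= phi12 (Six a A' b' B' c' C').
  exact: (@phi12_mono34 (Six a A' b' B' c' C') A).
exact: (le_trans h1 (le_trans h2 (le_trans h3 (le_trans h4 h5)))).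
Qed.

End AngleBounds.

(** * Extremal tetrahedra in the box [1, 2] *)

Section ExtremalAngles.
Variable R : realType.
Implicit Types x y : six R.

Lemma box12_ngram x : box12 x -> 0 < ngram x.
Proof.
move=> bx; have [[[_ n34x _] n24x _ n23x] [f1 _ _ _]] := box12_ge0 bx.
case: bx => -[/andP[a1 _] _ /andP[b1 _]] _ /andP[c1 _] _; rewrite /= in n34x n24x n23x.
have p1 : 0 <= e12 x * n34 x by apply: mulr_ge0 => //; apply: le_trans a1.
have p2 : 0 <= e13 x * n24 x by apply: mulr_ge0 => //; apply: le_trans b1.
have p3 : 0 <= e14 x * n23 x by apply: mulr_ge0 => //; apply: le_trans c1.
by rewrite /ngram; clear - p1 p2 p3 f1; lra.
Qed.

Lemma box12_extend (a A b B c C : R) : 1 <= a <= 2 -> 1 <= A <= 2 -> 1 <= b <= 2 ->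
  1 <= B <= 2 -> 1 <= c <= 2 -> 1 <= C <= 2 -> box12 (Six a A b B c C).
Proof. by []. Qed.

Lemma sqrt_mul_self (t : R) : 0 <= t -> Num.sqrt t * Num.sqrt t = t.
Proof. by move=> t0; rewrite -expr2 sqr_sqrtr. Qed.

Let i1 : 1 <= (1 : R) <= 2. Proof. by apply/andP; split; lra. Qed.
Let i2 : 1 <= (2 : R) <= 2. Proof. by apply/andP; split; lra. Qed.

(** By monotonicity the largest cosine occurs with opposite label 1 and adjacent labels 2; the lower
    bound below uses the reverse choice. *)
Lemma phi12_upper x : box12 x -> phi12 x <= (9 - e12 x) / (7 + e12 x).
Proof.
move=> bx; have [[a A b] B c C] := bx; have /andP[a1 a2] := a.
have h : phi12 x <= phi12 (Six (e12 x) 1 2 2 2 2).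
  by move: A b B c C => /andP[? ?] /andP[? ?] /andP[? ?] /andP[? ?] /andP[? ?]; apply: phi12_mono.
apply: le_trans h _; rewrite /phi12; unfold_tet.
rewrite sqrt_mul_self; last by nra.
have p1 : 0 < e12 x + 1 by lra.
have p7 : 0 < 7 + e12 x by lra.
rewrite le_eqVlt; apply/orP; left; apply/eqP.
have -> : 2 * e12 x * 2 * 2 + e12 x ^+ 2 + 2 ^+ 2 + 2 ^+ 2 - 1 = (e12 x + 1) * (7 + e12 x) by ring.
by field; rewrite !lt0r_neq0.
Qed.

Lemma phi12_lower x : box12 x -> 2 * (2 - e12 x) / (1 + e12 x) <= phi12 x.
Proof.
move=> bx; have [[a A b] B c C] := bx; have /andP[a1 a2] := a.
have h : phi12 (Six (e12 x) 2 1 1 1 1) <= phi12 x.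
  by move: A b B c C => /andP[? ?] /andP[? ?] /andP[? ?] /andP[? ?] /andP[? ?]; apply: phi12_mono.
apply: le_trans _ h; rewrite /phi12; unfold_tet.
rewrite sqrt_mul_self; last by nra.
have p1 : 0 < 1 + e12 x by lra.
rewrite le_eqVlt; apply/orP; left; apply/eqP.
have -> : 2 * e12 x * 1 * 1 + e12 x ^+ 2 + 1 ^+ 2 + 1 ^+ 2 - 1 = (1 + e12 x) ^+ 2 by ring.
by field; rewrite lt0r_neq0.
Qed.

(* Edge 12 has [cosh = 2]; edges 13 and 23 lie on the face shared with the
   neighbouring tetrahedron. *)
Definition extremal (b : R) : six R := Six 2 1 b 2 2 b.

Lemma key_ineqs (b f j : R) : 9 / 5 <= b <= 2 -> 1 <= f <= 2 -> 1 <= j <= 2 ->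
  let x := Six 2 f b j 2 b in fd3 x <= 3 * n14 x /\ n14 x <= 3 * fd2 x.
Proof.
move=> /andP[b1 b2] /andP[f1 f2] /andP[j1 j2]; unfold_tet; split.
  have h1 : 0 <= (j - 1) * (f - 1) by apply: mulr_ge0; lra.
  have h2 : 0 <= (j - 1) * (b - 9 / 5) by apply: mulr_ge0; lra.
  have h3 : 0 <= (j - 1) * (2 - j) by apply: mulr_ge0; lra.
  lra.
have h1 : 0 <= (b - 9 / 5) * (f - 1) by apply: mulr_ge0; lra.
have h2 : 0 <= (2 - j) * (f - 1) by apply: mulr_ge0; lra.
have h3 : 0 <= (b - 9 / 5) * (2 - j) by apply: mulr_ge0; lra.
have h4 := sqr_ge0 (b - 9 / 5); have h5 := sqr_ge0 (f - 1).
lra.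
Qed.

(** With s = sqrt w <= t = sqrt w' the sum is (v (s - 3 p t) + u (3 t - q s)) / d, and both terms
    are nonpositive. The bounds on p and q are those provided by [key_ineqs]. *)
Lemma weighted_sum_le0 (w w' d p q u v : R) : 0 < w -> w <= w' -> 0 < d ->
  0 <= q -> 1 <= 3 * p -> q <= 3 -> u <= 0 -> 0 <= v ->
  w * (v - q * u) / (d * Num.sqrt w) + 3 * (w' * (u - p * v) / (d * Num.sqrt w')) <= 0.
Proof.
move=> w0 ww d0 q0 p1 q3 u0 v0.
have w0' := lt_le_trans w0 ww.
have s0 : 0 < Num.sqrt w by rewrite sqrtr_gt0.
have ss : Num.sqrt w <= Num.sqrt w' by rewrite ler_wsqrtr.
move: (sqr_sqrtr (ltW w0)) (sqr_sqrtr (ltW w0')) s0 ss.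
move: (Num.sqrt w) (Num.sqrt w') => s t <- <- s0 st.
have t0 := lt_le_trans s0 st.
have -> : s ^+ 2 * (v - q * u) / (d * s) + 3 * (t ^+ 2 * (u - p * v) / (d * t))
  = (v * (s - t * (3 * p)) + u * (t * 3 - s * q)) / d.
  by field; rewrite !lt0r_neq0.
rewrite pmulr_lle0 ?invr_gt0 //.
have g1 : s - t * (3 * p) <= 0.
  by rewrite subr_le0; apply: le_trans st _; rewrite ler_peMr // ltW.
have g2 : 0 <= t * 3 - s * q by rewrite subr_ge0; apply: ler_pM => //; exact: ltW.
have := mulr_ge0_le0 v0 g1; have := mulr_le0_ge0 u0 g2; lra.
Qed.

Lemma path_deriv_le0 (b f j u v : R) : 9 / 5 <= b <= 2 -> 1 < f <= 2 -> 1 < j <= 2 ->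
  u <= 0 -> 0 <= v ->
  let x := Six 2 f b j 2 b in let y := Six 0 u 0 v 0 0 in
  e13 (zeta x y) / Num.sqrt (ngram x * sh2 (e13 x))
  + 3 * (e12 (zeta x y) / Num.sqrt (ngram x * sh2 (e12 x))) <= 0.
Proof.
move=> hb hf hj u0 v0; cbv zeta.
set x := Six 2 f b j 2 b; set y := Six 0 u 0 v 0 0.
have hf' : 1 <= f <= 2 by case/andP: hf => /ltW-> ->.
have hj' : 1 <= j <= 2 by case/andP: hj => /ltW-> ->.
have [k1 k2] := key_ineqs hb hf' hj'; rewrite -/x in k1 k2.
have /andP[b1 b2] := hb.
have bx : box12 x by apply: box12_extend => //; apply/andP; split; lra.
have D0 := box12_ngram bx; have [_ [f1 f2 f3 f4]] := box12_ge0 bx.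
have w12 : sh2 (e12 x) = 3 by rewrite /sh2 /=; ring.
have w13p : 0 < sh2 (e13 x) by rewrite /sh2 /=; nra.
have w13 : sh2 (e13 x) <= 3 by rewrite /sh2 /=; nra.
rewrite !sqrtrM ?(ltW D0) //.
have r0 : 0 < Num.sqrt (ngram x) by rewrite sqrtr_gt0.
have z13 : e13 (zeta x y) = sh2 (e13 x) * (v - n14 x / fd2 x * u).
  by rewrite /zeta [e13 _]/=; ring.
have z12 : e12 (zeta x y) = sh2 (e12 x) * (u - n14 x / fd3 x * v).
  by rewrite /zeta [e12 _]/=; ring.
rewrite z13 z12; apply: weighted_sum_le0 => //.
- by rewrite w12.
- by have [[_ _ n14x _] _] := box12_ge0 bx; rewrite divr_ge0 // ltW.
- by rewrite mulrA ler_pdivlMr // mul1r.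
- by rewrite ler_pdivrMr.
Qed.

Lemma ang12_extremal_le x : box12 x -> e12 x = 2 -> e23 x <= e13 x -> 1 <= e13 x <= 2 ->
  ang12 (extremal (e13 x)) <= ang12 x.
Proof.
case: x => a A b B c C bx /= a2 Cb ib; subst a.
case: (bx) => /= -[_ /andP[A1 A2] /andP[_ b2]] /andP[_ B2] /andP[_ c2] /andP[C1 C2].
have be : box12 (extremal b) by apply: box12_extend.
by rewrite !ang12E; apply: cacos_le; apply: phi12_mono => //=; exact: ltW.
Qed.

(** Raising label 14 to 2 and label 23 to that of 13 lowers both angles. Labels 34 and 24 act in
    opposite directions on the angles at 12 and 13, so only a weighted sum can be compared, by its
    derivative on the straight path of (34, 24) to (1, 2). *)
Lemma ang_extremal x : gt1 x -> box12 x -> e12 x = 2 -> 9 / 5 <= e13 x -> e23 x <= e13 x ->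
  ang12 (swap23 (extremal (e13 x))) + 3 * ang12 (extremal (e13 x))
    <= ang12 (swap23 x) + 3 * ang12 x.
Proof.
case: x => a A b B c C x1 bx /= a2 b1 Cb; subst a.
have [[/= _ A1 _] B1 c1 _] := gt1P x1.
case: (bx) => /= -[_ /andP[_ A2] /andP[_ b2]] /andP[_ B2] /andP[_ c2] /andP[C1 C2].
have hb : 9 / 5 <= b <= 2 by rewrite b1.
have ib : 1 <= b <= 2 by rewrite b2 andbT; lra.
have iA : 1 <= A <= 2 by rewrite A2 andbT ltW.
have iB : 1 <= B <= 2 by rewrite B2 andbT ltW.
have ic : 1 <= c <= 2 by rewrite c2 andbT ltW.
have iC : 1 <= C <= 2 by rewrite C1.
have s1 : ang12 (Six 2 A b B 2 b) <= ang12 (Six 2 A b B c C).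
  by rewrite !ang12E; apply: cacos_le; apply: phi12_mono => //=; apply: box12_extend.
have s2 : ang12 (swap23 (Six 2 A b B 2 b)) <= ang12 (swap23 (Six 2 A b B c C)).
  by rewrite !ang12E; apply: cacos_le; apply: phi12_mono => //=; apply: box12_extend.
suff : ang12 (swap23 (extremal b)) + 3 * ang12 (extremal b)
  <= ang12 (swap23 (Six 2 A b B 2 b)) + 3 * ang12 (Six 2 A b B 2 b) by lra.
pose y : six R := Six 0 (1 - A) 0 (2 - B) 0 0.
pose X (s : R) := Six 2 (A + s * (1 - A)) b (B + s * (2 - B)) 2 b.
have X0 : X 0 = Six 2 A b B 2 b by rewrite /X !mul0r !addr0.
have X1 : X 1 = extremal b by rewrite /X /extremal; congr Six; ring.
rewrite -X0 -X1.
have dX s : six_derive X s y.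
  have aux (p q : R) : is_derive s 1 (fun s => p + s * q) q.
    by apply: is_derive_eq (derD (derC p s) (derM (is_derive_id s 1) (derC q s))) _; ring.
  by split; [split|..] => /=; first [exact: aux | exact: derC].
have rng (s : R) : 0 <= s <= 1 -> [/\ 1 <= A + s * (1 - A) <= 2, 1 <= B + s * (2 - B) <= 2 & 1 < B + s * (2 - B)].
  move=> /andP[s0 s1'].
  have s1n : 0 <= 1 - s by rewrite subr_ge0.
  have p1 : 0 <= s * (A - 1) by rewrite mulr_ge0 // subr_ge0 ltW.
  have p2 : 0 <= (1 - s) * (A - 1) by rewrite mulr_ge0 // subr_ge0 ltW.
  have p3 : 0 <= s * (2 - B) by rewrite mulr_ge0 // subr_ge0.
  have p4 : 0 <= (1 - s) * (2 - B) by rewrite mulr_ge0 // subr_ge0.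
  clear - p1 p2 p3 p4 A1 A2 B1 B2.
  by split; [apply/andP; split | apply/andP; split |]; lra.
have bX (s : R) : 0 <= s <= 1 -> box12 (X s).
  by move=> s01; have [h1 h2 _] := rng _ s01; apply: box12_extend.
pose G s := ang12 (swap23 (X s)) + 3 * ang12 (X s).
pose dG s := e13 (zeta (X s) y) / Num.sqrt (ngram (X s) * sh2 (e13 (X s)))
  + 3 * (e12 (zeta (X s) y) / Num.sqrt (ngram (X s) * sh2 (e12 (X s)))).
have gt1A (s : R) : 0 < s < 1 -> 1 < A + s * (1 - A).
  move=> /andP[s0 s1']; rewrite -subr_gt0.
  have -> : A + s * (1 - A) - 1 = (1 - s) * (A - 1) by ring.
  by rewrite mulr_gt0 // subr_gt0.
have gt1X (s : R) : 0 < s < 1 -> gt1 (X s).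
  move=> s01; have s01' : 0 <= s <= 1 by case/andP: s01 => /ltW-> /ltW->.
  have [_ _ h3] := rng _ s01'; have h1 := gt1A _ s01.
  by rewrite /gt1 /= h1 h3 ltr1n /= (lt_le_trans _ b1) // ltr_pdivlMr // mul1r ltr_nat.
have derG (s : R) : s \in `]0, 1[%R -> is_derive s 1 G (dG s).
  rewrite in_itv /= => s01; have /andP[s0 s1'] := s01.
  have s01' : 0 <= s <= 1 by rewrite !ltW.
  have D0 := box12_ngram (bX _ s01').
  have [[d12 _ d13] _ _ _] := is_derive_angs (dX s) (gt1X _ s01) D0.
  by apply: is_derive_eq (derD d13 (derM (derC 3 s) d12)) _; rewrite mul0r add0r.
(* At s = 1 the label of 34 is 1 and [gt1] fails, so the derivative is used on the open interval and
   the end points are reached by continuity. *)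
have cG : {within `[0, 1], continuous G}.
  apply: continuous_in_subspaceT => s; rewrite inE /= in_itv /= => s01.
  have [_ [_ f2 f3 f4]] := box12_ge0 (bX _ s01).
  have k1 : {for s, continuous (fun s => ang12 (X s))} by apply: continuous_ang12 (dX s) f3 f4.
  have k2 : {for s, continuous (fun s => ang12 (swap23 (X s)))}.
    have [[h1 h2 h3] h4 h5 h6] := dX s.
    have [_ _ [_ _ q3 q4] _] := swap23E (X s).
    apply: (@continuous_ang12 _ (fun s => swap23 (X s)) s (swap23 y)); last 2 first.
    - by rewrite q3.
    - by rewrite q4.
    by split.
  by apply: cvgD k2 _; apply: cvgM k1; exact: cvg_cst.
have [c0] := MVT ltr01 derG cG.
rewrite in_itv /= subr0 mulr1 => /andP[c00 c01] GE.
rewrite -[_ + 3 * ang12 (X 1)]/(G 1) -[_ + 3 * ang12 (X 0)]/(G 0) -subr_le0 GE.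
have c0b : 0 <= c0 <= 1 by rewrite (ltW c00) (ltW c01).
have c0o : 0 < c0 < 1 by rewrite c00.
have [/andP[_ h1] /andP[_ h2] h3] := rng _ c0b.
have h4 := gt1A _ c0o.
by apply: path_deriv_le0 => //; rewrite ?h1 ?h2 ?h3 ?h4 // ?subr_le0 ?subr_ge0 // ltW.
Qed.

(** The extremal cosines are (4 b - 1) / (3 sqrt (2 b^2 + 1)) at 12 and sqrt (3 / (2 b^2 + 1)) at
    13; squaring leaves rational conditions. *)
Lemma phi12_extremal_le (b H : R) : 1 <= b -> 0 <= H -> (4 * b - 1) ^+ 2 <= 9 * H ^+ 2 * (2 * b ^+ 2 + 1) ->
  phi12 (extremal b) <= H.
Proof.
move=> b1 H0 h; rewrite /phi12; unfold_tet.
have f0 : 0 < 2 * b ^+ 2 + 1 by nra.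
have -> : 2 * 2 * b * b + 2 ^+ 2 + b ^+ 2 + b ^+ 2 - 1 = 3 * (2 * b ^+ 2 + 1) by ring.
have -> : 2 * 2 * 2 * 2 + 2 ^+ 2 + 2 ^+ 2 + 2 ^+ 2 - 1 = 27 :> R by ring.
have g0 : 0 < 3 * (2 * b ^+ 2 + 1) by lra.
rewrite -sqrtrM ?(ltW g0) // ler_pdivrMr; last by rewrite sqrtr_gt0; lra.
rewrite -(@ler_pXn2r _ 2) ?nnegrE //; last 2 first.
- by lra.
- by rewrite mulr_ge0 // sqrtr_ge0.
rewrite exprMn sqr_sqrtr; last by lra.
lra.
Qed.

Lemma phi12_extremal_ge (b y : R) : 1 <= b -> 0 <= y -> y <= phi12 (extremal b) ->
  9 * y ^+ 2 * (2 * b ^+ 2 + 1) <= (4 * b - 1) ^+ 2.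
Proof.
move=> b1 y0; rewrite /phi12; unfold_tet.
have f0 : 0 < 2 * b ^+ 2 + 1 by nra.
have -> : 2 * 2 * b * b + 2 ^+ 2 + b ^+ 2 + b ^+ 2 - 1 = 3 * (2 * b ^+ 2 + 1) by ring.
have -> : 2 * 2 * 2 * 2 + 2 ^+ 2 + 2 ^+ 2 + 2 ^+ 2 - 1 = 27 :> R by ring.
have g0 : 0 < 3 * (2 * b ^+ 2 + 1) by lra.
rewrite -sqrtrM ?(ltW g0) // ler_pdivlMr; last by rewrite sqrtr_gt0; lra.
rewrite -(@ler_pXn2r _ 2) ?nnegrE //; last 2 first.
- by rewrite mulr_ge0 // sqrtr_ge0.
- by lra.
rewrite exprMn sqr_sqrtr; last by lra.
lra.
Qed.

Lemma phi12_extremal23_le (b Q : R) : 1 <= b -> 0 <= Q -> 3 <= Q ^+ 2 * (2 * b ^+ 2 + 1) ->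
  phi12 (swap23 (extremal b)) <= Q.
Proof.
move=> b1 Q0 h; rewrite /phi12; unfold_tet.
have f0 : 0 < 2 * b ^+ 2 + 1 by nra.
have -> : 2 * b * 2 * b + b ^+ 2 + 2 ^+ 2 + b ^+ 2 - 1 = 3 * (2 * b ^+ 2 + 1) by ring.
have -> : 2 * b * 2 * 1 + b ^+ 2 + 2 ^+ 2 + 1 ^+ 2 - 1 = (b + 2) ^+ 2 by ring.
have g0 : 0 < 3 * (2 * b ^+ 2 + 1) by lra.
rewrite sqrtr_sqr ger0_norm; last by lra.
have b2 : 0 < b + 2 by lra.
rewrite ler_pdivrMr; last by rewrite mulr_gt0 // sqrtr_gt0.
have -> : 2 * 2 + b * 1 + b * 2 * 1 + b * 2 * b - b ^+ 2 * 2 + 2 = 3 * (b + 2) by ring.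
rewrite mulrA ler_pM2r // -(@ler_pXn2r _ 2) ?nnegrE // ?mulr_ge0 ?sqrtr_ge0 //.
rewrite exprMn sqr_sqrtr; last by lra.
lra.
Qed.

End ExtremalAngles.

(** * Numerical bounds on arccosines and on cos (2 pi / n) *)

Section TrigBounds.
Variable R : realType.
Implicit Types u v r : R.

Lemma cacos_mvt u v : 0 <= u -> u < v -> v < 1 ->
  exists2 c, u < c < v & cacos u - cacos v = (v - u) / Num.sqrt (1 - c ^+ 2).
Proof.
move=> u0 uv v1.
have der c : c \in `]u, v[%R -> is_derive c 1 (@cacos R) (- (Num.sqrt (1 - c ^+ 2))^-1).
  rewrite in_itv /= => /andP[c1 c2]; apply: is_derive_cacos; apply/andP; split; lra.
have cont : {within `[u, v], continuous (@cacos R)}.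
  by apply: continuous_subspaceT; exact: continuous_cacos.
have [c] := MVT uv der cont; rewrite in_itv /= => c01 E.
by exists c => //; rewrite -opprB E; ring.
Qed.

Lemma cacos_step_le u v r : 0 <= u -> u <= v -> v < 1 -> 0 < r -> r ^+ 2 <= 1 - v ^+ 2 ->
  cacos u - cacos v <= (v - u) / r.
Proof.
move=> u0; rewrite le_eqVlt => /orP[/eqP->|uv] v1 r0 rv; first by rewrite !subrr mul0r.
have [c /andP[uc cv] ->] := cacos_mvt u0 uv v1.
have c0 : 0 < 1 - c ^+ 2 by nra.
rewrite ler_pM2l ?subr_gt0 // lef_pV2 ?posrE ?sqrtr_gt0 //.
rewrite -(@ler_pXn2r _ 2) ?nnegrE ?sqrtr_ge0 // ?(ltW r0) // sqr_sqrtr ?ltW //; nra.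
Qed.

Lemma cacos_step_ge u v r : 0 <= u -> u <= v -> v < 1 -> 0 < r -> 1 - u ^+ 2 <= r ^+ 2 ->
  (v - u) / r <= cacos u - cacos v.
Proof.
move=> u0; rewrite le_eqVlt => /orP[/eqP->|uv] v1 r0 rv; first by rewrite !subrr mul0r.
have [c /andP[uc cv] ->] := cacos_mvt u0 uv v1.
have c0 : 0 < 1 - c ^+ 2 by nra.
rewrite ler_pM2l ?subr_gt0 // lef_pV2 ?posrE ?sqrtr_gt0 //.
rewrite -(@ler_pXn2r _ 2) ?nnegrE ?sqrtr_ge0 // ?(ltW r0) // sqr_sqrtr ?ltW //; nra.
Qed.

Lemma rescale_slope (a b c k : R) : c != 0 -> k != 0 ->
  (a - b) / c = (a / k - b / k) / (c / k).
Proof. by move=> c0 k0; field; rewrite c0 k0. Qed.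

(** The mean value theorem with the slope replaced by a rational bound. Integers in thousandths
    reduce each numerical use to a closed inequality of integers. *)
Lemma cacos_milli_le (u v r : nat) : (u <= v < 1000)%N -> (0 < r)%N ->
  (r%:R / 1000) ^+ 2 <= 1 - (v%:R / 1000) ^+ 2 :> R ->
  cacos (u%:R / 1000 : R) - cacos (v%:R / 1000) <= (v%:R - u%:R) / r%:R.
Proof.
move=> /andP[uv v1] r0 h; have k0 : 0 < (1000 : R) by rewrite ltr0n.
have rn : r%:R != 0 :> R by rewrite pnatr_eq0 -lt0n.
rewrite (rescale_slope v%:R u%:R rn (lt0r_neq0 k0)).
apply: cacos_step_le h.
- by rewrite divr_ge0 ?ler0n.
- by rewrite ler_pM2r ?invr_gt0 // ler_nat.
- by rewrite ltr_pdivrMr // mul1r ltr_nat.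
- by rewrite divr_gt0 ?ltr0n.
Qed.

Lemma cacos_milli_ge (u v r : nat) : (u <= v < 1000)%N -> (0 < r)%N ->
  1 - (u%:R / 1000) ^+ 2 <= (r%:R / 1000) ^+ 2 :> R ->
  (v%:R - u%:R) / r%:R <= cacos (u%:R / 1000 : R) - cacos (v%:R / 1000).
Proof.
move=> /andP[uv v1] r0 h; have k0 : 0 < (1000 : R) by rewrite ltr0n.
have rn : r%:R != 0 :> R by rewrite pnatr_eq0 -lt0n.
rewrite (rescale_slope v%:R u%:R rn (lt0r_neq0 k0)).
apply: cacos_step_ge h.
- by rewrite divr_ge0 ?ler0n.
- by rewrite ler_pM2r ?invr_gt0 // ler_nat.
- by rewrite ltr_pdivrMr // mul1r ltr_nat.
- by rewrite divr_gt0 ?ltr0n.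
Qed.

Lemma cos_injective_itv (a b : R) : 0 <= a <= pi -> 0 <= b <= pi -> (cos a < cos b) = (b < a).
Proof. by move=> ha hb; rewrite ltr_cos // in_itv. Qed.

Lemma cos_three (a : R) : cos (a *+ 3) = 4 * cos a ^+ 3 - 3 * cos a.
Proof.
rewrite mulrS cosD mulr2n cosD sinD.
have := cos2Dsin2 a; move: (cos a) (sin a) => c s E.
have s2 : s * s = 1 - c ^+ 2 by rewrite -expr2 -E addrC addKr.
transitivity (c * (c * c) - 3 * c * (s * s)); first by ring.
by rewrite s2; ring.
Qed.

Lemma cospiB (a : R) : cos (pi - a) = - cos a.
Proof. by rewrite addrC cosDpi cosN. Qed.

Lemma pi_frac (n : nat) : (2 < n)%N -> 0 < 2 * (pi : R) / n%:R < pi.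
Proof.
move=> n2; have p0 := pi_gt0 R; have n0 : 0 < (n%:R : R) by rewrite ltr0n (ltn_trans _ n2).
by rewrite divr_gt0 ?mulr_gt0 //= ltr_pdivrMr // mulrC ltr_pM2l // ltr_nat.
Qed.

Lemma cos_third : cos (2 * pi / 3 : R) = - (1 / 2).
Proof.
have /andP[t0 tp] := pi_frac (isT : 2 < 3)%N.
set c := cos _.
have E : 4 * c ^+ 3 - 3 * c = 1.
  rewrite -cos_three -[RHS](cos0 R) -(cosD2pi 0) add0r.
  by congr cos; field.
have c1 : c < 1 by rewrite -(cos0 R) cos_injective_itv ?lexx ?pi_ge0 // !ltW.
have : (c - 1) * (2 * c + 1) ^+ 2 = 0.
  by transitivity (4 * c ^+ 3 - 3 * c - 1); [ring | rewrite E subrr].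
by move/eqP; rewrite mulf_eq0 subr_eq0 lt_eqF //= sqrf_eq0 => /eqP h; lra.
Qed.

Definition ycos (n : nat) : R := cos (2 * pi / n%:R).

Lemma ycos_le (m n : nat) : (2 < m)%N -> (m <= n)%N -> ycos m <= ycos n.
Proof.
move=> m2 mn; have n2 := leq_trans m2 mn.
have /andP[a0 a1] := pi_frac m2.
have /andP[b0 b1] := pi_frac n2.
rewrite leNgt cos_injective_itv ?ltW // -leNgt ler_pM2l ?mulr_gt0 ?pi_gt0 //.
by rewrite lef_pV2 ?posrE ?ltr0n ?ler_nat // (ltn_trans _ m2, ltn_trans _ n2).
Qed.

Lemma ycos_lt1 (n : nat) : (2 < n)%N -> ycos n < 1.
Proof.
move=> n2; have /andP[a0 a1] := pi_frac n2.
by rewrite -(cos0 R) cos_injective_itv ?lexx ?pi_ge0 // !ltW.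
Qed.

Lemma ycos_gt0 (n : nat) : (4 < n)%N -> 0 < ycos n.
Proof.
move=> n4; apply: cos_gt0_pihalf; have p0 := pi_gt0 R.
have n0 : 0 < (n%:R : R) by rewrite ltr0n (ltn_trans _ n4).
rewrite (@lt_trans _ _ 0) ?oppr_lt0 ?divr_gt0 ?mulr_gt0 //=.
rewrite ltr_pdivrMr // -subr_gt0.
have -> : pi / 2 * n%:R - 2 * pi = pi / 2 * (n%:R - 4) :> R by field.
by rewrite mulr_gt0 ?divr_gt0 // subr_gt0 ltr_nat.
Qed.

(** Tripling the angle gives 8 c^3 - 6 c + 1 = 0. This cubic is negative on [1/2, 0.766], and c >=
    cos (pi / 3) excludes its smaller roots. *)
Lemma ycos9_ge : 766 / 1000 <= ycos 9.
Proof.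
have E : 8 * ycos 9 ^+ 3 - 6 * ycos 9 + 1 = 0.
  have : cos ((2 * pi / 9) *+ 3) = - (1 / 2 : R).
    by rewrite -cos_third; congr cos; field.
  by rewrite cos_three -/(ycos 9) => h; lra.
have c0 : 0 < ycos 9 by exact: ycos_gt0.
have c6 : 1 / 2 <= ycos 9.
  have := @ycos_le 6 9 isT isT; apply: le_trans.
  rewrite /ycos; have -> : 2 * pi / 6 = pi - 2 * pi / 3 :> R by field.
  by rewrite cospiB cos_third; lra.
move: (ycos 9) E c0 c6 => c E c0 c6.
rewrite leNgt; apply/negP => h.
have h1 : 0 <= (c - 1 / 2) * (766 / 1000 - c) by apply: mulr_ge0; lra.
nra.
Qed.

Lemma ycos10_ge : 8 / 10 <= ycos 10.
Proof.
have c0 : 0 < ycos 10 by exact: ycos_gt0.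
have E : (ycos 10 + 1) * (4 * ycos 10 ^+ 2 - 2 * ycos 10 - 1) = 0.
  have : cos ((2 * pi / 10) *+ 3) = - cos ((2 * pi / 10) *+ 2) :> R.
    by rewrite -cospiB; congr cos; field.
  by rewrite cos_three cos_mulr2n -/(ycos 10) => h; lra.
have c1 : 0 < ycos 10 + 1 by lra.
move/eqP: E; rewrite mulf_eq0 (gt_eqF c1) /= => /eqP.
by move: (ycos 10) c0 => c c0 {c1} E; rewrite leNgt; apply/negP => h; nra.
Qed.

Lemma cacos_le_theta (u : R) : 0 <= u <= 1 -> cacos u <= 2 * pi / 9 -> ycos 9 <= u.
Proof.
move=> /andP[u0 u1] h; have /andP[a0 a1] := pi_frac (isT : 2 < 9)%N.
have <- : cos (cacos u) = u by rewrite cos_cacos clamp1_id // u1 andbT; lra.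
by rewrite leNgt cos_injective_itv ?cacos_ge0 ?cacos_lepi ?(ltW a0) ?(ltW a1) // -leNgt.
Qed.

Lemma theta_le : 2 * pi / 9 <= cacos (766 / 1000 : R).
Proof.
have /andP[a0 a1] := pi_frac (isT : 2 < 9)%N.
have -> : 2 * pi / 9 = cacos (ycos 9) :> R.
  have y1 := @ycos_lt1 9 isT; have y0 := @ycos_gt0 9 isT.
  rewrite /cacos clamp1_id; last by apply/andP; split; lra.
  by rewrite cosK // in_itv /= (ltW a0) (ltW a1).
exact/cacos_le/ycos9_ge.
Qed.

Lemma cacos_660_766 : 1459 / 10 / 1000 <= cacos (660 / 1000 : R) - cacos (766 / 1000).
Proof.
have q2 := @cacos_milli_ge 660 713 752 isT isT ltac:(clear; lra).
have q3 := @cacos_milli_ge 713 766 702 isT isT ltac:(clear; lra).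
have := lerD q2 q3; rewrite subrKA; apply: le_trans; clear; lra.
Qed.

Lemma weighted_sum_gt (y a b c d e P P' Q H T : R) : y - a <= P -> a - b <= P' ->
  Q <= c - d -> y - e <= H -> T <= d - y -> 7 * (P + P') + 6 * H < 2 * (Q + T) ->
  15 * y < 7 * b + 2 * c + 6 * e.
Proof. lra. Qed.

Lemma cacos_sum_bin1 : 15 * cacos (766 / 1000 : R) <
  7 * cacos (801 / 1000) + 2 * cacos (608 / 1000) + 6 * cacos (767 / 1000).
Proof.
have p0 := @cacos_milli_le 766 783 622 isT isT ltac:(clear; lra).
have p1 := @cacos_milli_le 783 801 598 isT isT ltac:(clear; lra).
have q := @cacos_milli_ge 608 660 794 isT isT ltac:(clear; lra).
have h := @cacos_milli_le 766 767 641 isT isT ltac:(clear; lra).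
apply: (weighted_sum_gt p0 p1 q h cacos_660_766); clear; lra.
Qed.

Lemma cacos_sum_bin2 : 15 * cacos (766 / 1000 : R) <
  7 * cacos (799 / 1000) + 2 * cacos (606 / 1000) + 6 * cacos (770 / 1000).
Proof.
have p0 := @cacos_milli_le 766 783 622 isT isT ltac:(clear; lra).
have p1 := @cacos_milli_le 783 799 601 isT isT ltac:(clear; lra).
have q := @cacos_milli_ge 606 660 796 isT isT ltac:(clear; lra).
have h := @cacos_milli_le 766 770 638 isT isT ltac:(clear; lra).
apply: (weighted_sum_gt p0 p1 q h cacos_660_766); clear; lra.
Qed.

Lemma cacos_sum_bin3 : 15 * cacos (766 / 1000 : R) <
  7 * cacos (794 / 1000) + 2 * cacos (599 / 1000) + 6 * cacos (774 / 1000).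
Proof.
have p0 := @cacos_milli_le 766 794 607 isT isT ltac:(clear; lra).
have q := @cacos_milli_ge 599 660 801 isT isT ltac:(clear; lra).
have h := @cacos_milli_le 766 774 633 isT isT ltac:(clear; lra).
have p1 : cacos (794 / 1000 : R) - cacos (794 / 1000) <= 0 by rewrite subrr.
apply: (weighted_sum_gt p0 p1 q h cacos_660_766); clear; lra.
Qed.

Lemma cacos_sum_bin4 : 15 * cacos (766 / 1000 : R) <
  7 * cacos (786 / 1000) + 2 * cacos (588 / 1000) + 6 * cacos (778 / 1000).
Proof.
have p0 := @cacos_milli_le 766 786 618 isT isT ltac:(clear; lra).
have q := @cacos_milli_ge 588 660 809 isT isT ltac:(clear; lra).
have h := @cacos_milli_le 766 778 628 isT isT ltac:(clear; lra).
have p1 : cacos (786 / 1000 : R) - cacos (786 / 1000) <= 0 by rewrite subrr.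
apply: (weighted_sum_gt p0 p1 q h cacos_660_766); clear; lra.
Qed.

(** The weights fit [shared_edge_arith]: seven angles at the edge with cosh b are bounded by the
    first arccosine and two by [ang_extremal]. Removing 3 times the two small angles costs less than
    6 of the 15 units 2 pi / 9, and the remaining 9 make 2 pi. *)
Lemma extremal_sum_gt (b : R) : 1 <= b <= 2 -> ang12 (extremal b) <= 2 * pi / 9 ->
  9 / 5 <= b /\ 15 * (2 * pi / 9) <
    7 * cacos ((9 - b) / (7 + b)) + 2 * ang12 (swap23 (extremal b)) + 6 * ang12 (extremal b).
Proof.
move=> /andP[b1 b2] h.
have y9 : (766 / 1000 : R) <= phi12 (extremal b).
  apply: le_trans ycos9_ge _; apply: cacos_le_theta h.
  rewrite phi12_extremal_le //; [rewrite andbT | nra].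
  apply: divr_ge0; last by rewrite mulr_ge0 ?sqrtr_ge0.
  by unfold_tet; lra.
have y0 : (0 : R) <= 766 / 1000 by lra.
have bq := phi12_extremal_ge b1 y0 y9.
(* [bq] is a quadratic condition on b that fails from 1 up to its larger root, about 1.888. *)
have b188 : 1887 / 1000 <= b.
  rewrite leNgt; apply/negP => b3.
  have h1 : 0 <= (b - 1) * (1887 / 1000 - b).
    by apply: mulr_ge0; rewrite subr_ge0 // ltW.
  clear - b1 b3 bq h1; lra.
clear y0 y9 bq; split; first by clear - b188; lra.
have b7 : 0 < 7 + b by clear - b1; lra.
apply: le_lt_trans (_ : 15 * cacos (766 / 1000) < _); first by rewrite ler_pM2l // theta_le.
(* P, Q and H are upper bounds, in thousandths, for the three cosines on [lo, hi], so their
   arccosines bound the angles from below. Four bins keep the loss under the available margin. *)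
have bin (lo hi P Q H : R) : 0 <= lo -> lo <= b -> b <= hi -> 0 <= Q -> 0 <= H ->
    (9 - b) <= P * (7 + b) -> 3 <= Q ^+ 2 * (2 * lo ^+ 2 + 1) ->
    (0 <= (b - lo) * (hi - b) -> (4 * b - 1) ^+ 2 <= 9 * H ^+ 2 * (2 * b ^+ 2 + 1)) ->
    15 * cacos (766 / 1000 : R) < 7 * cacos P + 2 * cacos Q + 6 * cacos H ->
    15 * cacos (766 / 1000) < 7 * cacos ((9 - b) / (7 + b)) + 2 * ang12 (swap23 (extremal b)) + 6 * ang12 (extremal b).
  move=> lo0 lob bhi Q0 H0; rewrite -ler_pdivrMr // => hP hQ hH.
  have kQ : phi12 (swap23 (extremal b)) <= Q.
    apply: phi12_extremal23_le => //; apply: le_trans hQ _.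
    by rewrite ler_wpM2l ?sqr_ge0 // lerD2r ler_pM2l // lerXn2r ?nnegrE // (le_trans lo0).
  have kH : phi12 (extremal b) <= H.
    by apply: phi12_extremal_le => //; apply: hH; rewrite mulr_ge0 // subr_ge0.
  rewrite !ang12E => h15; apply: lt_le_trans h15 _.
  by rewrite !lerD ?ler_pM2l // cacos_le.
have [c0|/ltW c0] := leP b (1895 / 1000).
  apply: (bin (1887 / 1000) (1895 / 1000) _ _ _ _ b188 c0 _ _ _ _ _ cacos_sum_bin1); clear - b188 c0; lra.
have [c1|/ltW c1] := leP b (1920 / 1000).
  apply: (bin (1895 / 1000) (1920 / 1000) _ _ _ _ c0 c1 _ _ _ _ _ cacos_sum_bin2); clear - c0 c1; lra.
have [c2|/ltW c2] := leP b (1960 / 1000).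
  apply: (bin (1920 / 1000) (1960 / 1000) _ _ _ _ c1 c2 _ _ _ _ _ cacos_sum_bin3); clear - c1 c2; lra.
apply: (bin (1960 / 1000) 2 _ _ _ _ c2 b2 _ _ _ _ _ cacos_sum_bin4); clear - c2 b2; lra.
Qed.

End TrigBounds.

(** * The constants mu_n and b_n *)

Section EdgeBounds.
Variable R : realType.
Implicit Types xi y t : R.

Definition etapoly xi y t := (2 + y) * t ^+ 2 + 2 * (2 + 5 * y - (1 + xi) ^+ 2) * t
  - 4 * (1 - y) * (1 + xi) ^+ 2.

Let disc xi y := (2 + 5 * y - (1 + xi) ^+ 2) ^+ 2 + 4 * (2 + y) * (1 - y) * (1 + xi) ^+ 2.

Lemma disc_gt xi y : 0 <= xi -> 0 < y < 1 -> (2 + 5 * y - (1 + xi) ^+ 2) ^+ 2 < disc xi y.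
Proof.
move=> x0 /andP[y0 y1]; rewrite /disc ltrDl; apply: mulr_gt0; last by rewrite exprn_gt0 // ltr_wpDr.
by apply: mulr_gt0; lra.
Qed.

Lemma eta_gt0 xi y : 0 <= xi -> 0 < y < 1 -> 0 < Defs.eta xi y.
Proof.
move=> x0 yI; have dg := disc_gt x0 yI; have /andP[y0 y1] := yI.
have p2 : 0 < 2 + y by lra.
apply: divr_gt0 => //; rewrite -/(disc xi y).
have : `|2 + 5 * y - (1 + xi) ^+ 2| < Num.sqrt (disc xi y).
  by rewrite -sqrtr_sqr ltr_sqrt // (le_lt_trans _ dg) // sqr_ge0.
move=> /(le_lt_trans (ler_norm _)).
by move: (Num.sqrt _) ((1 + xi) ^+ 2) => *; lra.
Qed.

Lemma etapoly_eta xi y : 0 <= xi -> 0 < y < 1 -> etapoly xi y (Defs.eta xi y) = 0.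
Proof.
move=> x0 yI; have dg := disc_gt x0 yI; have /andP[y0 y1] := yI.
have p2 : 2 + y != 0 by rewrite lt0r_neq0 //; lra.
have d0 : 0 <= disc xi y by rewrite ltW // (le_lt_trans _ dg) // sqr_ge0.
have q : Num.sqrt (disc xi y) ^+ 2 = disc xi y by rewrite sqr_sqrtr.
rewrite /etapoly /Defs.eta -/(disc xi y).
transitivity ((Num.sqrt (disc xi y) ^+ 2 - disc xi y) / (2 + y)); last by rewrite q subrr mul0r.
by move: (Num.sqrt (disc xi y)) => r; rewrite /disc; field.
Qed.

(** The quadratic opens upwards and is negative at 0, so on positive arguments it is nonnegative
    only from its positive root on. *)
Lemma eta_le xi y t : 0 <= xi -> 0 < y < 1 -> 0 < t -> 0 <= etapoly xi y t -> Defs.eta xi y <= t.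
Proof.
move=> x0 yI t0 h; have dg := disc_gt x0 yI; have /andP[y0 y1] := yI.
have p2 : 0 < 2 + y by lra.
rewrite ler_pdivrMr // -/(disc xi y).
have hB : 0 <= (2 + y) * t + (2 + 5 * y - (1 + xi) ^+ 2).
  have : 0 <= t * ((2 + y) * t + 2 * (2 + 5 * y - (1 + xi) ^+ 2)).
    have : 0 <= 4 * (1 - y) * (1 + xi) ^+ 2 by apply: mulr_ge0; [apply: mulr_ge0 => //; lra | exact: sqr_ge0].
    by move: h; rewrite /etapoly; move: ((1 + xi) ^+ 2) => s; lra.
  rewrite pmulr_rge0 //.
  have : 0 <= (2 + y) * t by apply: mulr_ge0; exact: ltW.
  by move: ((2 + y) * t) ((1 + xi) ^+ 2) => a s; lra.
have hs : Num.sqrt (disc xi y) <= (2 + y) * t + (2 + 5 * y - (1 + xi) ^+ 2).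
  rewrite -(@ler_pXn2r _ 2) ?nnegrE ?sqrtr_ge0 // sqr_sqrtr; last first.
    by rewrite ltW // (le_lt_trans _ dg) // sqr_ge0.
  rewrite -subr_ge0; have -> : ((2 + y) * t + (2 + 5 * y - (1 + xi) ^+ 2)) ^+ 2 - disc xi y
    = (2 + y) * etapoly xi y t by rewrite /disc /etapoly; ring.
  by rewrite mulr_ge0 // ltW.
by move: hs; move: (Num.sqrt _) ((1 + xi) ^+ 2) => a s; lra.
Qed.

Lemma eta_mono xi xi' y : 0 <= xi -> xi <= xi' -> 0 < y < 1 -> Defs.eta xi y <= Defs.eta xi' y.
Proof.
move=> x0 xx yI; have x0' := le_trans x0 xx; have /andP[y0 y1] := yI.
have e0 := eta_gt0 x0' yI; apply: eta_le => //.
have -> : etapoly xi y (Defs.eta xi' y) = etapoly xi' y (Defs.eta xi' y)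
  + ((1 + xi') ^+ 2 - (1 + xi) ^+ 2) * (2 * Defs.eta xi' y + 4 * (1 - y)) by rewrite /etapoly; ring.
rewrite etapoly_eta // add0r mulr_ge0 //.
  by rewrite subr_ge0 lerXn2r ?nnegrE ?addr_ge0 // lerD2l.
by clear - e0 y1; lra.
Qed.

(** The bound is the t for which x = 1 + t makes the lower bound 2 (2 - x) / (1 + x) of
    [phi12_lower] equal to y. It is at most 0.17 for y >= 0.766, so the recursion for [xi_seq] never
    leaves [0, 0.17]. *)
Lemma eta_upper xi y : 0 <= xi <= 17 / 100 -> 766 / 1000 <= y < 1 ->
  0 < Defs.eta xi y <= 2 * (1 - y) / (2 + y).
Proof.
move=> /andP[x0 x1] /andP[y0 y1].
have yI : 0 < y < 1 by rewrite y1 andbT; lra.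
rewrite eta_gt0 //=.
have p2 : 0 < 2 + y by lra.
have t0 : 0 < 2 * (1 - y) / (2 + y) by rewrite divr_gt0 ?mulr_gt0 ?subr_gt0.
apply: eta_le => //.
have -> : etapoly xi y (2 * (1 - y) / (2 + y))
  = 2 * (1 - y) / (2 + y) * (6 + 8 * y - (6 + 2 * y) * (1 + xi) ^+ 2).
  by rewrite /etapoly; field; rewrite lt0r_neq0.
apply: mulr_ge0; first exact: ltW.
have s : (1 + xi) ^+ 2 <= 14 / 10 by nra.
move: ((1 + xi) ^+ 2) s => s sl; clear - y0 y1 sl p2.
have : (6 + 2 * y) * s <= (6 + 2 * y) * (14 / 10) by rewrite ler_pM2l //; lra.
lra.
Qed.

Let y9 : 766 / 1000 <= ycos R 9 < 1. Proof. by rewrite ycos9_ge ycos_lt1. Qed.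

Lemma lower_le17 y : 766 / 1000 <= y -> 2 * (1 - y) / (2 + y) <= 17 / 100.
Proof. by move=> y0; rewrite ler_pdivrMr; lra. Qed.

Lemma xi_seq_itv k : 0 <= xi_seq R k <= 17 / 100.
Proof.
elim: k => [|k IH] /=; first by rewrite lexx divr_ge0.
have /andP[h1 h2] := eta_upper IH y9.
rewrite (ltW h1) (le_trans h2) //; apply: lower_le17; exact: ycos9_ge.
Qed.

Lemma xi_seq_nondecreasing : nondecreasing_seq (xi_seq R).
Proof.
apply/nondecreasing_seqP => k.
have yI : 0 < ycos R 9 < 1 by rewrite ycos_gt0 ?ycos_lt1.
elim: k => [|k IH]; first by have /andP[] := xi_seq_itv 1.
by apply: eta_mono => //; have /andP[] := xi_seq_itv k.
Qed.

Lemma xi_inf_itv : 0 <= xi_inf R <= 17 / 100.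
Proof.
have c : cvgn (xi_seq R).
  apply: nondecreasing_is_cvgn; first exact: xi_seq_nondecreasing.
  by exists (17 / 100) => _ [k _ <-]; have /andP[] := xi_seq_itv k.
apply/andP; split.
  by apply: limr_ge => //; near=> k; have /andP[] := xi_seq_itv k.
by apply: limr_le => //; near=> k; have /andP[] := xi_seq_itv k.
Unshelve. all: by end_near. Qed.

Lemma ycos_ge (n : nat) : (9 <= n)%N -> 766 / 1000 <= ycos R n < 1.
Proof.
move=> n9; rewrite ycos_lt1 ?andbT; last exact: leq_trans n9.
by apply: le_trans (ycos_le R _ n9) => //; exact: ycos9_ge.
Qed.

Lemma mu_itv (n : nat) : (9 <= n)%N -> 0 < mu R n <= 2 * (1 - ycos R n) / (2 + ycos R n).
Proof. by move=> n9; apply: eta_upper xi_inf_itv (ycos_ge n9). Qed.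

Lemma mu_le (n : nat) : (9 <= n)%N -> mu R n <= 17 / 100.
Proof.
move=> n9; have /andP[_ h] := mu_itv n9; apply: le_trans h (lower_le17 _).
by have /andP[] := ycos_ge n9.
Qed.

Lemma ycos_ge_8 n : (9 < n)%N -> 8 / 10 <= ycos R n < 1.
Proof.
move=> n9; rewrite ycos_lt1 ?andbT; last by apply: leq_trans n9.
by apply: le_trans (ycos_le R _ n9) => //; exact: ycos10_ge.
Qed.

Lemma bconstE n : (9 < n)%N -> bconst R n = 16 / (1 + ycos R n) - 7.
Proof. by move=> n9; rewrite /bconst; case: eqP n9 => // ->. Qed.

(** The origin of b_n: at this cosh the upper bound of [phi12_upper] on the cosine equals cos (2 pi
    / n). *)
Lemma bconst_ratio n : (9 < n)%N -> (9 - bconst R n) / (7 + bconst R n) = ycos R n.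
Proof.
move=> n9; rewrite bconstE //; have /andP[c0 _] := ycos_ge_8 n9.
by field; rewrite !lt0r_neq0 //; lra.
Qed.

Lemma bconst_itv n : (9 <= n)%N -> 1 + mu R n <= bconst R n <= 2.
Proof.
move=> n9; have m17 := mu_le n9; have /andP[_ mu1] := mu_itv n9.
move: n9; rewrite leq_eqVlt => /orP[/eqP n9|n9].
  by rewrite /bconst -n9 eqxx lexx andbT; rewrite -n9 in m17; lra.
rewrite bconstE //; have /andP[c0 c1] := ycos_ge_8 n9.
have p1 : 0 < 1 + ycos R n by lra.
apply/andP; split; last by rewrite lerBlDr ler_pdivrMr //; lra.
have h : 16 / (1 + ycos R n) = 8 + 8 * (1 - ycos R n) / (1 + ycos R n).
  by field; rewrite lt0r_neq0.
have k : 2 * (1 - ycos R n) / (2 + ycos R n) <= 8 * (1 - ycos R n) / (1 + ycos R n).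
  apply: ler_pM; rewrite ?invr_ge0 ?mulr_ge0 ?subr_ge0 //; try lra.
  by rewrite lef_pV2 ?posrE //; lra.
lra.
Qed.

End EdgeBounds.

(** * Combinatorics of the gluing *)

Section Gluing.
Local Close Scope classical_set_scope.
Variables (n : nat) (pr : face n -> face n) (sg : face n -> {perm 'I_4}).
Hypothesis glu : is_gluing pr sg.
Implicit Types (x y : hatEdge n) (v : 'I_4).

(* The edge glued to [x] across the face opposite to [v]. *)
Definition nb x v : hatEdge n := ((pr (x.1, v)).1, (sg (x.1, v) @: x.2)).

Lemma mem_hatE x : (x \in hatE n) = (#|x.2| == 2%N). Proof. by rewrite inE. Qed.

Lemma nb_hatE x v : (nb x v \in hatE n) = (x \in hatE n).
Proof. by rewrite !mem_hatE card_imset //; exact: perm_inj. Qed.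

Lemma nb_notin x v : v \notin x.2 -> (pr (x.1, v)).2 \notin (nb x v).2.
Proof.
have [_ _ h _] := glu (x.1, v); rewrite -h /= mem_imset //; exact: perm_inj.
Qed.

Lemma nbK x v : nb (nb x v) (pr (x.1, v)).2 = x.
Proof.
have [_ h1 _ h2] := glu (x.1, v); rewrite /nb /= -surjective_pairing h1 h2 /=.
case: x {h1 h2} => t s /=; congr pair; rewrite -imset_comp -[RHS]imset_id.
by apply: eq_imset => i /=; rewrite permK.
Qed.

Lemma glueP x y : reflect (exists2 v, v \notin x.2 & y = nb x v) (Defs.glue pr sg x y).
Proof.
apply: (iffP orP) => [[/existsP[v /andP[v1 /eqP e]]|/existsP[v /andP[v1 /eqP e]]]|[v v1 ->]].
- by exists v.
- exists (pr (y.1, v)).2; rewrite e.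
    exact: (@nb_notin y v).
  by rewrite -[LHS](nbK y v).
- by left; apply/existsP; exists v; rewrite v1 eqxx.
Qed.

Lemma glue_sym : symmetric (Defs.glue pr sg).
Proof. by move=> x y; rewrite /Defs.glue orbC. Qed.

Lemma cls_nb x v : v \notin x.2 -> cls pr sg (nb x v) = cls pr sg x.
Proof.
move=> vx; apply/setP => y; rewrite !inE; apply: same_connect.
  exact: sym_connect_sym glue_sym.
by rewrite (sym_connect_sym glue_sym); apply: connect1; apply/glueP; exists v.
Qed.

Lemma cls_hatE x y : x \in hatE n -> y \in cls pr sg x -> y \in hatE n.
Proof.
move=> xE; rewrite inE => /connectP[p pp ->]; elim: p x xE pp => //= z p IH x xE.
by move=> /andP[/glueP[v _ ->] pp]; apply: IH => //; rewrite nb_hatE.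
Qed.

Lemma preE_cls (e : Edge pr sg) x : x \in preE e -> preE e = cls pr sg x.
Proof.
rewrite inE => /andP[xE /eqP ce]; apply/setP => y; rewrite !inE -ce.
have sym := sym_connect_sym glue_sym.
apply/andP/idP => [[_ /eqP h]|h].
  have : y \in cls pr sg y by rewrite inE connect0.
  by rewrite h inE.
split; first by have := @cls_hatE x y xE; rewrite !inE; apply.
apply/eqP/setP => z; rewrite !inE; apply: (same_connect sym); by rewrite sym.
Qed.

(* If crossing the face returned to the same edge of the same tetrahedron, the
   edge class would be a singleton. *)
Lemma nb_neq (e : Edge pr sg) x v : (1 < valence e)%N -> x \in preE e -> v \notin x.2 -> nb x v != x.
Proof.
move=> e1 xe vx; apply/negP => /eqP nx.
have xE : #|x.2| == 2%N by move: xe; rewrite inE mem_hatE => /andP[].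
have [pf _ sv _] := glu (x.1, v).
set v' := (pr (x.1, v)).2 in sv.
have v'x : v' \notin x.2 by have := nb_notin vx; rewrite nx.
have vv' : v' != v.
  apply/eqP => E; case/eqP: pf; rewrite [LHS]surjective_pairing -/v' E; congr pair.
  by rewrite -[LHS]/((nb x v).1) nx.
have nx' : nb x v' = x by rewrite -[RHS](nbK x v) nx.
(* Crossing either of the two faces through x then leads back to x, so its class is closed. *)
have cpl : ~: x.2 = [set v; v'].
  apply/esym/eqP; rewrite eqEcard; apply/andP; split.
    by apply/fintype.subsetP => w; rewrite !inE => /orP[] /eqP->.
  by rewrite cards2 eq_sym vv' cardsCs finset.setCK card_ord (eqP xE).
have gx y : Defs.glue pr sg x y -> y = x.
  move=> /glueP[w wx ->]; have : w \in ~: x.2 by rewrite inE.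
  by rewrite cpl !inE => /orP[] /eqP->.
suff c1 : preE e = [set x] by move: e1; rewrite /valence c1 cards1.
rewrite (preE_cls xe); apply/setP => y; rewrite !inE; apply/connectP/eqP => [[p pp ->]|->].
  by elim: p pp => //= z p IH /andP[/gx -> /IH].
by exists [::].
Qed.

Definition cross (p : hatEdge n * 'I_4) : hatEdge n * 'I_4 := (nb p.1 p.2, (pr (p.1.1, p.2)).2).

Lemma crossK : involutive cross.
Proof.
move=> [x v]; rewrite /cross /= nbK; congr pair.
by rewrite -surjective_pairing; have [_ -> _ _] := glu (x.1, v).
Qed.

Lemma nb_preE (e : Edge pr sg) x v : v \notin x.2 -> (nb x v \in preE e) = (x \in preE e).
Proof. by move=> vx; rewrite inE [RHS]inE nb_hatE cls_nb. Qed.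

(** Two faces pass through each corner, and [cross] permutes the pairs (corner, face), so each of
    the two terms contributes twice the sum. *)
Lemma sum_cross (R : realType) (e : Edge pr sg) (F : hatEdge n -> R) :
  \sum_(p : hatEdge n * 'I_4 | (p.1 \in preE e) && (p.2 \notin p.1.2)) (F p.1 + F (nb p.1 p.2))
  = 4 * \sum_(x in preE e) F x.
Proof.
have half : \sum_(p : hatEdge n * 'I_4 | (p.1 \in preE e) && (p.2 \notin p.1.2)) F p.1
    = 2 * \sum_(x in preE e) F x.
  rewrite -(pair_big_dep (mem (preE e)) (fun x v => v \notin x.2) (fun x _ => F x)) /=.
  rewrite mulr_sumr; apply: eq_bigr => x xe.
  have c2 : #|[pred v | v \notin x.2]| = 2%N.
    transitivity #|~: x.2|; first by apply: eq_card => v; rewrite !inE.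
    by move: xe; rewrite inE mem_hatE => /andP[/eqP xc _]; rewrite cardsCs finset.setCK card_ord xc.
  by rewrite sumr_const c2 mulr_natl.
rewrite big_split /= half [X in _ + X](_ : _ = 2 * \sum_(x in preE e) F x); first by ring.
rewrite -half.
rewrite (reindex_inj (inv_inj crossK)) /=; apply: eq_big => [[x v]|[x v] _] /=.
  have [vx|vx] := boolP (v \in x.2); last by rewrite nb_notin // nb_preE.
  rewrite !andbF; apply/negbTE; rewrite negb_and; apply/orP; right; rewrite negbK.
  by have [_ _ <- _] := glu (x.1, v); rewrite mem_imset //; exact: perm_inj.
by rewrite nbK.
Qed.

Lemma card_cross (e : Edge pr sg) :
  #|[pred p : hatEdge n * 'I_4 | (p.1 \in preE e) && (p.2 \notin p.1.2)]| = (2 * valence e)%N.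
Proof.
rewrite -sum1_card -(pair_big_dep (mem (preE e)) (fun x v => v \notin x.2) (fun _ _ => 1%N)) /=.
rewrite /valence -sum1_card big_distrr /=; apply: eq_bigr => x xe; rewrite sum1_card muln1.
have -> : #|[pred v | v \notin x.2]| = #|~: x.2| by apply: eq_card => v; rewrite !inE.
by move: xe; rewrite inE mem_hatE => /andP[/eqP xc _]; rewrite cardsCs finset.setCK card_ord xc.
Qed.

Lemma edge_of x : x \in hatE n -> exists e : Edge pr sg, x \in preE e.
Proof.
move=> xE; have h : cls pr sg x \in edgeSet pr sg by apply/imsetP; exists x.
by exists (Sub (cls pr sg x) h : {X | X \in edgeSet pr sg}); rewrite inE xE SubK eqxx.
Qed.

Lemma preE_inj (e e' : Edge pr sg) x : x \in preE e -> x \in preE e' -> e = e'.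
Proof.
by rewrite !inE => /andP[_ /eqP h1] /andP[_ /eqP h2]; apply: val_inj; rewrite /= -h1 -h2.
Qed.

Lemma preE_inh (e : Edge pr sg) : exists x, x \in preE e.
Proof.
by have /imsetP[x xE h] := valP e; exists x; rewrite inE xE h eqxx.
Qed.

Lemma lenOf_preE (R : realType) (l : Edge pr sg -> R) e x : x \in preE e -> lenOf l x = l e.
Proof. by rewrite inE => /andP[_ /eqP h]; rewrite /lenOf h valK. Qed.

Lemma sum_edges (R : realType) (F : hatEdge n -> R) :
  \sum_(e : {X | X \in edgeSet pr sg}) \sum_(x in preE (e : Edge pr sg)) F x = \sum_(x in hatE n) F x.
Proof.
rewrite (exchange_big_dep (mem (hatE n))) /=; last first.
  by move=> e x _; rewrite inE => /andP[].
apply: eq_bigr => x xE; have [e xe] := edge_of xE.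
rewrite (big_pred1 (e : {X | X \in edgeSet pr sg})) // => e'; apply/idP/eqP => [h|->//].
exact: preE_inj h xe.
Qed.

End Gluing.

(** * From edges of the disjoint union to labelled tetrahedra *)

Section Tetrahedra.
Local Close Scope classical_set_scope.
Variables (R : realType) (n : nat).

Definition tet6 (T : Type) (f : hatEdge n -> T) (t : 'I_n) (i j k h : 'I_4) : six T :=
  Six (f (t, [set i; j])) (f (t, [set k; h])) (f (t, [set i; k])) (f (t, [set j; h]))
      (f (t, [set i; h])) (f (t, [set j; k])).

Lemma phi_formula_swap12 (a b c B C A : R) : phi_formula a C B b c A = phi_formula a b c C B A.
Proof.
rewrite /phi_formula; congr (_ / (Num.sqrt _ * Num.sqrt _)); ring.
Qed.

Lemma phi_formula_swap34 (a b c B C A : R) : phi_formula a c b B C A = phi_formula a b c C B A.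
Proof.
rewrite /phi_formula [Num.sqrt _ * _]mulrC; congr (_ / (Num.sqrt _ * Num.sqrt _)); ring.
Qed.

Lemma enum_set2 (T : finType) (i j : T) : i != j ->
  enum [set i; j] = [:: i; j] \/ enum [set i; j] = [:: j; i].
Proof.
move=> ij.
have : perm_eq (enum [set i; j]) [:: i; j].
  apply: uniq_perm; rewrite ?enum_uniq //= ?inE ?ij // => z.
  by rewrite mem_enum !inE.
move=> p; have := perm_size p; have := p.
case: (enum _) => [|a [|b [|]]] //= {}p _.
have := perm_mem p a; rewrite !inE eqxx /= => /esym/orP[] /eqP ai.
  move: p; rewrite ai perm_cons => /perm_small_eq->; by [left |].
move: p; rewrite ai => p; right; congr [:: _; _].
have : perm_eq [:: j; b] [:: j; i] by apply: perm_trans p _; rewrite (perm_catC [:: i] [:: j]).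
by rewrite perm_cons => /perm_small_eq => /(_ isT)[].
Qed.

(** [phi] reads the vertices in the order of [enum]; the symmetries of the formula in i, j and in k,
    h make that order irrelevant. *)
Lemma phiE pr sg (l : @Edge n pr sg -> R) t (i j k h : 'I_4) : uniq [:: i; j; k; h] ->
  let X a b := cosh (lenOf l (t, [set a; b])) in
  phi l (t, [set i; j]) = phi_formula (X i j) (X i k) (X i h) (X j k) (X j h) (X k h).
Proof.
move=> u X.
have [ij kh] : i != j /\ k != h.
  by move: u; rewrite /= !inE !negb_or => /and4P[/and3P[-> _ _] _ -> _].
have cpl : ~: [set i; j] = [set k; h].
  apply/esym/eqP; rewrite eqEcard; apply/andP; split; last first.
    by rewrite cardsCs finset.setCK card_ord !cards2 ij kh.
  apply/fintype.subsetP => w; rewrite !inE; move: u; rewrite /= !inE !negb_or.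
  by move=> /and4P[/and3P[_ ik ih] /andP[jk jh] _ _] /orP[] /eqP->; rewrite eq_sym ?ik ?ih eq_sym ?jk ?jh.
have Xs a b : X a b = X b a by rewrite /X finset.setUC.
pose P a b c d := phi_formula (X a b) (X a c) (X a d) (X b c) (X b d) (X c d).
have P12 a b c d : P b a c d = P a b c d by rewrite /P (Xs b a) phi_formula_swap12.
have P34 a b c d : P a b d c = P a b c d by rewrite /P (Xs d c) phi_formula_swap34.
have -> : phi l (t, [set i; j]) = P (nth ord0 (enum [set i; j]) 0) (nth ord0 (enum [set i; j]) 1)
   (nth ord0 (enum [set k; h]) 0) (nth ord0 (enum [set k; h]) 1) by rewrite /phi /= cpl.
rewrite -/(P i j k h); clearbody P.
case: (enum_set2 ij) => ->; case: (enum_set2 kh) => -> /=.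
- by [].
- exact: P34.
- exact: P12.
- exact: etrans (P12 i j h k) (P34 i j k h).
Qed.

Lemma alpha_tet6 pr sg (l : @Edge n pr sg -> R) t (i j k h : 'I_4) : uniq [:: i; j; k; h] ->
  alpha l (t, [set i; j]) = ang12 (coshs (tet6 (lenOf l) t i j k h)).
Proof. by move=> u; rewrite /alpha (phiE _ _ u). Qed.

Lemma uniq4 (T : eqType) (a b c d : T) :
  uniq [:: a; b; c; d] = [&& a != b, a != c, a != d, b != c, b != d & c != d].
Proof. by rewrite /= !inE !negb_or andbT -!andbA. Qed.

Lemma uniq4_swap12 (T : eqType) (a b c d : T) : uniq [:: a; b; c; d] -> uniq [:: b; a; c; d].
Proof. by rewrite !uniq4 (eq_sym b a) => /and5P[-> -> -> -> /andP[-> ->]]. Qed.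
Lemma uniq4_swap23 (T : eqType) (a b c d : T) : uniq [:: a; b; c; d] -> uniq [:: a; c; b; d].
Proof. by rewrite !uniq4 (eq_sym c b) => /and5P[-> -> -> -> /andP[-> ->]]. Qed.
Lemma uniq4_swap34 (T : eqType) (a b c d : T) : uniq [:: a; b; c; d] -> uniq [:: a; b; d; c].
Proof. by rewrite !uniq4 (eq_sym d c) => /and5P[-> -> -> -> /andP[-> ->]]. Qed.

Lemma angs_tet6 pr sg (l : @Edge n pr sg -> R) t (i j k h : 'I_4) : uniq [:: i; j; k; h] ->
  angs (coshs (tet6 (lenOf l) t i j k h)) = tet6 (alpha l) t i j k h.
Proof.
move=> u; pose g (a b : 'I_4) := cosh (lenOf l (t, [set a; b])).
have gs a b : g a b = g b a by rewrite /g finset.setUC.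
pose A (a b c d : 'I_4) := Six (g a b) (g c d) (g a c) (g b d) (g a d) (g b c).
have E (a b c d : 'I_4) x : uniq [:: a; b; c; d] -> x = A a b c d ->
    ang12 x = alpha l (t, [set a; b]).
  by move=> e ->; rewrite (alpha_tet6 _ _ e).
have -> : coshs (tet6 (lenOf l) t i j k h) = A i j k h by [].
clearbody g.
have u13 := uniq4_swap23 u; have u31 := uniq4_swap12 u13.
have u14 := uniq4_swap23 (uniq4_swap34 u).
have u23 := uniq4_swap23 (uniq4_swap12 u).
have u24 := uniq4_swap23 (uniq4_swap34 (uniq4_swap12 u)).
have u34 := uniq4_swap23 (uniq4_swap34 (uniq4_swap12 (uniq4_swap23 u))).
congr Six.
- exact: E u _.
- by apply: E u34 _; rewrite /A /swap12 /swap23 /swap34 /=; congr Six.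
- by apply: E u13 _; rewrite /A /swap23 /=; congr Six.
- by apply: E u24 _; rewrite /A /swap12 /swap23 /swap34 /=; congr Six.
- by apply: E u14 _; rewrite /A /swap23 /swap34 /=; congr Six.
- by apply: E u23 _; rewrite /A /swap23 /swap12 /=; congr Six.
Qed.

Definition o0 : 'I_4 := @Ordinal 4 0 isT.
Definition o1 : 'I_4 := @Ordinal 4 1 isT.
Definition o2 : 'I_4 := @Ordinal 4 2 isT.
Definition o3 : 'I_4 := @Ordinal 4 3 isT.

Lemma ord4 (P : 'I_4 -> Prop) : P o0 -> P o1 -> P o2 -> P o3 -> forall i, P i.
Proof.
move=> p0 p1 p2 p3 [[|[|[|[|m]]]] hm] //.
- by rewrite (_ : Ordinal hm = o0) //; apply: val_inj.
- by rewrite (_ : Ordinal hm = o1) //; apply: val_inj.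
- by rewrite (_ : Ordinal hm = o2) //; apply: val_inj.
- by rewrite (_ : Ordinal hm = o3) //; apply: val_inj.
Qed.

Definition pairs4 : seq {set 'I_4} := [:: [set o0; o1]; [set o2; o3]; [set o0; o2];
  [set o1; o3]; [set o0; o3]; [set o1; o2]].

Lemma mem_pairs4 (s : {set 'I_4}) : (s \in pairs4) = (#|s| == 2%N).
Proof.
apply/idP/idP => [|/cards2P[a [b [ab ->]]]].
  by rewrite !inE => /or4P[|||/or3P[]] /eqP->; rewrite cards2.
rewrite !inE; move: ab; elim/ord4: a; elim/ord4: b; rewrite ?eqxx ?orbT //= => _;
  by rewrite finset.setUC ?eqxx ?orbT.
Qed.

Lemma uniq_pairs4 : uniq pairs4.
Proof.
apply: (@leq_size_uniq _ (enum [set s : {set 'I_4} | #|s| == 2%N])); first exact: enum_uniq.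
  by move=> s; rewrite mem_enum inE mem_pairs4.
by rewrite -cardE card_draws card_ord.
Qed.

Lemma sum_hatE (F : hatEdge n -> R) : \sum_(x in hatE n) F x =
  \sum_(t : 'I_n) (let f := tet6 F t o0 o1 o2 o3 in e12 f + e34 f + e13 f + e24 f + e14 f + e23 f).
Proof.
rewrite (eq_bigl (fun x : hatEdge n => xpredT x.1 && (#|x.2| == 2%N))); last first.
  by move=> x; rewrite mem_hatE.
rewrite (eq_bigr (fun x => F (x.1, x.2))); last by case.
rewrite -(pair_big_dep xpredT (fun (_ : 'I_n) (s : {set 'I_4}) => #|s| == 2%N) (fun t s => F (t, s))) /=.
apply: eq_bigr => t _.
rewrite (eq_bigl (mem pairs4)); last by move=> s; rewrite -mem_pairs4.
by rewrite -big_uniq ?uniq_pairs4 //= !big_cons big_nil addr0 !addrA.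
Qed.

Lemma hatE_tet (x : hatEdge n) : x \in hatE n -> exists i j k h : 'I_4,
  uniq [:: i; j; k; h] /\ x.2 = [set i; j].
Proof.
rewrite mem_hatE => x2; have /cards2P[i [j [ij e]]] := x2.
have : #|~: x.2| == 2%N by rewrite cardsCs finset.setCK card_ord (eqP x2).
move=> /cards2P[k [h [kh e']]]; exists i, j, k, h; split=> //.
have d a b : a \in [set i; j] -> b \in [set k; h] -> a != b.
  by rewrite -e -e' inE => ax bx; apply: contraNneq bx => <-.
by rewrite uniq4 ij kh !d // !inE eqxx ?orbT.
Qed.

Lemma compl_tet (v i j k h : 'I_4) : uniq [:: i; j; k; h] -> v \notin [set i; j] -> v = k \/ v = h.
Proof.
move=> u vij; have : v \in [:: i; j; k; h].
  have [||_ ->] := uniq_min_size (s2 := enum 'I_4) u; rewrite ?mem_enum //.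
    by move=> z; rewrite mem_enum.
  by rewrite -cardE card_ord.
by move: vij; rewrite !inE negb_or => /andP[/negbTE-> /negbTE->] /= /orP[] /eqP; [left | right].
Qed.

End Tetrahedra.

(** * The sign of the curvature on the faces of the box *)

Section Curvature.
Local Close Scope classical_set_scope.
Variables (R : realType) (n : nat) (pr : face n -> face n) (sg : face n -> {perm 'I_4}).
Hypothesis glu : is_gluing pr sg.
Implicit Types l W : Edge pr sg -> R.

Lemma allsix_tet6 (P : R -> Prop) l t (i j k h : 'I_4) : uniq [:: i; j; k; h] ->
  (forall e, P (l e)) -> allsix P (tet6 (lenOf l) t i j k h).
Proof.
rewrite uniq4 => /and5P[ij ik ih jk /andP[jh kh]] Pl.
have h1 a b : a != b -> P (lenOf l (t, [set a; b])).
  move=> ab; have xE : (t, [set a; b]) \in hatE n by rewrite mem_hatE cards2 ab.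
  by have [e xe] := edge_of pr sg xE; rewrite (lenOf_preE _ xe).
by do 2?split; apply: h1.
Qed.

(** Double counting: [lenOf W] is constant on each class, so a sum over edges becomes a sum over
    corners and thus over tetrahedra. Pairings with the curvature reduce to single tetrahedra in
    this way. *)
Lemma pairing_tet (F : hatEdge n -> R) W :
  \sum_(e : {X | X \in edgeSet pr sg}) W e * \sum_(x in preE (e : Edge pr sg)) F x
  = \sum_(t : 'I_n) dot (tet6 (lenOf W) t o0 o1 o2 o3) (tet6 F t o0 o1 o2 o3).
Proof.
transitivity (\sum_(x in hatE n) lenOf W x * F x).
  rewrite -(sum_edges pr sg); apply: eq_bigr => e _; rewrite mulr_sumr.
  by apply: eq_bigr => x xe; rewrite (lenOf_preE _ xe).
by rewrite sum_hatE.
Qed.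

Definition pairing W l : R := \sum_(e : {X | X \in edgeSet pr sg}) W e * curv l e.

Lemma pairingE W l : pairing W l = 2 * pi * (\sum_(e : {X | X \in edgeSet pr sg}) W e)
  - \sum_(t : 'I_n) dot (tet6 (lenOf W) t o0 o1 o2 o3) (angs (coshs (tet6 (lenOf l) t o0 o1 o2 o3))).
Proof.
rewrite /pairing; under eq_bigr do rewrite /curv mulrBr.
rewrite sumrB mulr_sumr; congr (_ - _); first by apply: eq_bigr => e _; rewrite mulrC.
by rewrite pairing_tet; apply: eq_bigr => t _; rewrite angs_tet6.
Qed.

Definition inbox12 l := forall e, 0 < l e /\ cosh (l e) <= 2.

Lemma box12_tet6 l t (i j k h : 'I_4) : inbox12 l -> uniq [:: i; j; k; h] ->
  gt1 (coshs (tet6 (lenOf l) t i j k h)) /\ box12 (coshs (tet6 (lenOf l) t i j k h)).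
Proof.
move=> lb u; split.
  by apply: positive_gt1; apply: allsix_tet6 => // e; have [] := lb e.
have : allsix (fun s => 1 <= cosh s <= 2) (tet6 (lenOf l) t i j k h).
  by apply: allsix_tet6 => // e; have [l0 ->] := lb e; rewrite andbT ltW // cosh_gt1.
by [].
Qed.

Lemma alpha_bounds l (e : Edge pr sg) x : inbox12 l -> x \in preE e ->
  cacos ((9 - cosh (l e)) / (7 + cosh (l e))) <= alpha l x
  <= cacos (2 * (2 - cosh (l e)) / (1 + cosh (l e))).
Proof.
move=> lb xe; have xE : x \in hatE n by move: xe; rewrite inE => /andP[].
have [i [j [k [h [u e2]]]]] := hatE_tet xE.
have [_ bx] := box12_tet6 x.1 lb u.
have xeq : x = (x.1, [set i; j]) by rewrite -e2 -surjective_pairing.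
have -> : alpha l x = cacos (phi12 (coshs (tet6 (lenOf l) x.1 i j k h))).
  by rewrite -ang12E -(alpha_tet6 l x.1 u) -xeq.
have -> : cosh (l e) = e12 (coshs (tet6 (lenOf l) x.1 i j k h)).
  by rewrite /= -xeq (lenOf_preE _ xe).
by rewrite !cacos_le ?phi12_upper ?phi12_lower.
Qed.

Lemma curv_ge0 l e : inbox12 l -> (9 <= valence e)%N -> cosh (l e) <= 1 + mu R (valence e) ->
  0 <= curv l e.
Proof.
move=> lb v9 lm; have /andP[m0 m1] := mu_itv R v9; have /andP[y0 y1] := ycos_ge R v9.
have [l0 _] := lb e; have c1 := cosh_gt1 l0.
have p2 : 0 < 2 + ycos R (valence e) by lra.
have N0 : 0 < (valence e)%:R :> R by rewrite ltr0n; apply: leq_trans v9.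
have hy : ycos R (valence e) <= 2 * (2 - cosh (l e)) / (1 + cosh (l e)).
  rewrite ler_pdivlMr; last by lra.
  move: m1; rewrite ler_pdivlMr // => m1.
  have : ycos R (valence e) * cosh (l e) <= ycos R (valence e) * (1 + mu R (valence e)).
    by rewrite ler_pM2l //; lra.
  lra.
have hc : cacos (ycos R (valence e)) = 2 * pi / (valence e)%:R.
  have /andP[a0 a1] := pi_frac R (leq_trans (isT : 2 < 9)%N v9).
  rewrite /cacos clamp1_id; last by apply/andP; split; lra.
  by rewrite cosK // in_itv /= (ltW a0) (ltW a1).
rewrite /curv subr_ge0.
have -> : 2 * pi = \sum_(x in preE e) 2 * pi / (valence e)%:R :> R.
  by rewrite sumr_const -[#|_|]/(valence e) -[RHS]mulr_natr divfK ?gt_eqF.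
apply: ler_sum => x xe; have /andP[_ h] := alpha_bounds lb xe.
by apply: le_trans h _; rewrite -hc cacos_le.
Qed.

Lemma curv_le0 l e : inbox12 l -> (9 < valence e)%N -> cosh (l e) = bconst R (valence e) ->
  curv l e <= 0.
Proof.
move=> lb v9 lm; have v9' := ltnW v9; have /andP[y0 y1] := ycos_ge R v9'.
have N0 : 0 < (valence e)%:R :> R by rewrite ltr0n; apply: leq_trans v9.
have hc : cacos (ycos R (valence e)) = 2 * pi / (valence e)%:R.
  have /andP[a0 a1] := pi_frac R (leq_trans (isT : 2 < 9)%N v9').
  rewrite /cacos clamp1_id; last by apply/andP; split; lra.
  by rewrite cosK // in_itv /= (ltW a0) (ltW a1).
rewrite /curv subr_le0.
have -> : 2 * pi = \sum_(x in preE e) 2 * pi / (valence e)%:R :> R.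
  by rewrite sumr_const -[#|_|]/(valence e) -[RHS]mulr_natr divfK ?gt_eqF.
apply: ler_sum => x xe; have /andP[h _] := alpha_bounds lb xe.
by rewrite -hc -bconst_ratio // -lm.
Qed.

Hypothesis v9 : forall e : Edge pr sg, (9 <= valence e)%N.

Lemma le_of_sum_lt (a b c q : R) : c <= a -> c <= b -> a + b < 2 * q -> c <= q.
Proof. lra. Qed.

Lemma shared_edge_arith (p S N c a a' x x' f g : R) : (a - c) + (a' - c) <= S ->
  9 * c <= N -> x + x' < 2 * (2 * p / 9) -> 15 * (2 * p / 9) < 7 * c + 2 * g + 6 * f ->
  g + 3 * f <= a + 3 * x -> g + 3 * f <= a' + 3 * x' -> 2 * p - (N + S) < 0.
Proof. lra. Qed.

(* Two tetrahedra sharing the face ijk have small total angle at ij, an edge with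
   [cosh = 2].  Then the longer edge [b = ik] of the face has [cosh >= 9 / 5], and
   the two angles at [b] exceed 2 pi / 9 by more than the at least seven other
   angles around [b] can fall short of it. *)
Lemma shared_edge_contra l (x : hatEdge n) v (i j k : 'I_4) (b : Edge pr sg) : inbox12 l ->
  x = (x.1, [set i; j]) -> uniq [:: i; j; k; v] ->
  cosh (lenOf l x) = 2 -> (x.1, [set i; k]) \in preE b ->
  cosh (lenOf l (x.1, [set j; k])) <= cosh (l b) ->
  alpha l x + alpha l (nb pr sg x v) < 2 * (2 * pi / 9) -> curv l b < 0.
Proof.
move=> lb xeq u x2 yb jb small.
set t := x.1 in xeq yb jb; set s := sg (t, v); set t' := (pr (t, v)).1.
have nbE (a c : 'I_4) : nb pr sg (t, [set a; c]) v = (t', [set s a; s c]).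
  by rewrite /nb /= finset.imsetU !imset_set1.
have lenN (a c : 'I_4) : a != v -> c != v -> a != c ->
    lenOf l (t', [set s a; s c]) = lenOf l (t, [set a; c]).
  move=> av cv ac; have yE : (t, [set a; c]) \in hatE n by rewrite mem_hatE cards2 ac.
  have [e ye] := edge_of pr sg yE; rewrite (lenOf_preE _ ye) -nbE; apply: lenOf_preE.
  by rewrite nb_preE // !inE negb_or !(eq_sym v) av cv.
have u' : uniq [:: s i; s j; s k; s v].
  by rewrite -(map_inj_uniq (@perm_inj _ s)) in u.
have := u; rewrite uniq4 => /and5P[ij ik iv jk /andP[jv kv]].
have c12 : lenOf l (t, [set i; j]) = lenOf l x by rewrite -xeq.
have c13 : lenOf l (t, [set i; k]) = l b by rewrite (lenOf_preE _ yb).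
have [g1 b1] := box12_tet6 t lb u; have [g2 b2] := box12_tet6 t' lb u'.
set X := coshs _ in g1 b1; set X' := coshs _ in g2 b2.
have E12 : e12 X = 2 by rewrite /= c12.
have E12' : e12 X' = 2 by rewrite /= lenN // c12.
have E13 : e13 X = cosh (l b) by rewrite /= c13.
have E13' : e13 X' = cosh (l b) by rewrite /= lenN // c13.
have E23 : e23 X <= e13 X by rewrite E13.
have E23' : e23 X' <= e13 X' by rewrite E13' /= lenN.
have bb : 1 <= cosh (l b) <= 2 by have [l0 ->] := lb b; rewrite andbT ltW // cosh_gt1.
have ax : alpha l x = ang12 X by rewrite -(alpha_tet6 l t u) -xeq.
have ax' : alpha l (nb pr sg x v) = ang12 X' by rewrite -(alpha_tet6 l t' u') -nbE -xeq.
have h1 := ang12_extremal_le b1 E12 E23 ltac:(by rewrite E13).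
have h1' := ang12_extremal_le b2 E12' E23' ltac:(by rewrite E13').
rewrite E13 in h1; rewrite E13' in h1'.
rewrite ax ax' in small.
have [b95 key] := extremal_sum_gt bb (le_of_sum_lt h1 h1' small).
have h2 := ang_extremal g1 b1 E12 ltac:(by rewrite E13) E23.
have h2' := ang_extremal g2 b2 E12' ltac:(by rewrite E13') E23'.
rewrite E13 in h2; rewrite E13' in h2'.
have ab : ang12 (swap23 X) = alpha l (t, [set i; k]).
  by have := congr1 (@e13 R) (angs_tet6 l t u).
have ab' : ang12 (swap23 X') = alpha l (t', [set s i; s k]).
  by have := congr1 (@e13 R) (angs_tet6 l t' u').
rewrite ab in h2; rewrite ab' in h2'.
set y := (t, [set i; k]) in yb ab h2; set y' := (t', _) in ab' h2'.
have vy : v \notin y.2 by rewrite !inE negb_or !(eq_sym v) iv kv.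
have y'E : y' = nb pr sg y v by rewrite nbE.
have y'b : y' \in preE b by rewrite y'E nb_preE.
have yy' : y' != y by rewrite y'E; apply: (nb_neq glu (leq_trans _ (v9 b)) yb vy).
set c := cacos ((9 - cosh (l b)) / (7 + cosh (l b))) in key.
have ac z : z \in preE b -> 0 <= alpha l z - c.
  by move=> zb; have /andP[] := alpha_bounds lb zb; rewrite subr_ge0.
have c0 : 0 <= c by apply: cacos_ge0.
clearbody c; clearbody X X' y y'.
have S : \sum_(z in preE b) alpha l z = (valence b)%:R * c + \sum_(z in preE b) (alpha l z - c).
  by rewrite sumrB sumr_const -[c *+ _]mulr_natl addrC subrK.
have S2 : (alpha l y - c) + (alpha l y' - c) <= \sum_(z in preE b) (alpha l z - c).
  rewrite (bigD1 y) //= (bigD1 y') ?y'b //= addrA lerDl.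
  by apply: sumr_ge0 => z /andP[/andP[/ac]].
have N9 : 9 * c <= (valence b)%:R * c.
  by rewrite (ler_wpM2r c0) // ler_nat.
rewrite /curv S; exact: (shared_edge_arith S2 N9 small key h2 h2').
Qed.

(* Averaging over the 18 pairs (corner at the edge, face through it): if the
   curvature is positive, two adjacent corners have total angle below 4 pi / 9. *)
Lemma curv_le0_valence9 l (e : Edge pr sg) : inbox12 l -> (forall e, 0 <= curv l e) ->
  valence e = 9%N -> cosh (l e) = 2 -> curv l e <= 0.
Proof.
move=> lb K0 e9 l2; rewrite leNgt; apply/negP => Ke.
pose P (p : hatEdge n * 'I_4) := (p.1 \in preE e) && (p.2 \notin p.1.2).
have [[x v] /andP[/= xe vx] small] : exists2 p, P p &
    alpha l p.1 + alpha l (nb pr sg p.1 p.2) < 2 * (2 * pi / 9).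
  apply: contrapT => no.
  have : \sum_(p | P p) 2 * (2 * pi / 9) <= \sum_(p | P p) (alpha l p.1 + alpha l (nb pr sg p.1 p.2)).
    apply: ler_sum => p Pp; rewrite leNgt; apply/negP => h; by apply: no; exists p.
  rewrite (sum_cross glu) sumr_const (card_cross e) e9 -[leLHS]mulr_natl.
  by move: Ke; rewrite /curv subr_gt0; lra.
have xE : x \in hatE n by move: xe; rewrite inE => /andP[].
have [i [j [k0 [h0 [u0 x2]]]]] := hatE_tet xE.
have [k u] : exists k, uniq [:: i; j; k; v].
  have := vx; rewrite x2 => /(compl_tet u0)[] ->; last by exists k0.
  by exists h0; apply: uniq4_swap34.
have xeq : x = (x.1, [set i; j]) by rewrite -x2 -surjective_pairing.
have lx2 : cosh (lenOf l x) = 2 by rewrite (lenOf_preE _ xe).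
have := u; rewrite uniq4 => /and5P[_ ik _ jk _].
have ikE : (x.1, [set i; k]) \in hatE n by rewrite mem_hatE cards2 ik.
have jkE : (x.1, [set j; k]) \in hatE n by rewrite mem_hatE cards2 jk.
have [b yb] := edge_of pr sg ikE; have [b' yb'] := edge_of pr sg jkE.
have [h|/ltW h] := leP (cosh (lenOf l (x.1, [set j; k]))) (cosh (lenOf l (x.1, [set i; k]))).
  rewrite (lenOf_preE _ yb) in h.
  by have := shared_edge_contra lb xeq u lx2 yb h small; rewrite ltNge K0.
(* When jk is the longer edge, i and j exchange roles. *)
rewrite (lenOf_preE _ yb') in h; rewrite finset.setUC in xeq.
by have := shared_edge_contra lb xeq (uniq4_swap12 u) lx2 yb' h small; rewrite ltNge K0.
Qed.

End Curvature.

(** * The contraction principle on a finite-dimensional box *)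

Lemma cvg_sum_seq (R : realType) (I T : Type) (F : set_system T) {FF : Filter F} (r : seq I)
  (f : I -> T -> R) (l : I -> R) :
  (forall i, f i @ F --> l i) -> (fun k => \sum_(i <- r) f i k) @ F --> \sum_(i <- r) l i.
Proof.
move=> h; elim: r => [|i r IH].
  have -> : (fun k => \sum_(i <- [::]) f i k) = (fun=> 0) by apply/funext => k; rewrite big_nil.
  by rewrite big_nil; exact: cvg_cst.
have -> : (fun k => \sum_(j <- i :: r) f j k) = (fun k => f i k + \sum_(j <- r) f j k).
  by apply/funext => k; rewrite big_cons.
by rewrite big_cons; apply: cvgD.
Qed.

Section Contraction.
Variables (R : realType) (E : finType) (lo hi : E -> R) (T : (E -> R) -> E -> R) (q : R).
Implicit Types l : E -> R.

Let box l := forall e, lo e <= l e <= hi e.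
Let dist2 l l' := \sum_(e : E) (l' e - l e) ^+ 2.

Lemma dist2_ge0 l l' : 0 <= dist2 l l'.
Proof. by apply: sumr_ge0 => e _; exact: sqr_ge0. Qed.

Lemma dist2_coord l l' e : (l' e - l e) ^+ 2 <= dist2 l l'.
Proof. by rewrite /dist2 (bigD1 e) //= lerDl; apply: sumr_ge0 => *; exact: sqr_ge0. Qed.

Hypothesis lohi : forall e, lo e <= hi e.
Hypothesis Tbox : forall l, box (T l).
Hypothesis q01 : 0 <= q < 1.
Hypothesis contr : forall l l', box l -> box l' -> dist2 (T l) (T l') <= q * dist2 l l'.

Let u k := iter k T lo.

Lemma iter_box k : box (u k).
Proof. by case: k => [|k] e; [rewrite /= lexx lohi | exact: Tbox]. Qed.

Lemma iter_dist2 k : dist2 (u k) (u k.+1) <= q ^+ k * dist2 (u 0) (u 1).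
Proof.
elim: k => [|k IH]; first by rewrite expr0 mul1r.
apply: le_trans (contr (iter_box k) (iter_box k.+1)) _.
by rewrite exprS -mulrA ler_wpM2l //; case/andP: q01.
Qed.

Lemma iter_cvg e : cvgn (fun k => u k e).
Proof.
have /andP[q0 q1] := q01.
pose s k := u k.+1 e - u k e.
have sE : (fun k => u k e) = (fun k => series s k + u 0 e).
  apply/funext => k; rewrite /series /= /s telescope_sumr //.
  by rewrite subrK.
rewrite sE; apply: is_cvgD; last exact: is_cvg_cst.
apply: normed_cvg; apply: (@series_le_cvg _ _ (geometric (Num.sqrt (dist2 (u 0) (u 1))) (Num.sqrt q))).
- by move=> k; exact: normr_ge0.
- by move=> k; rewrite /= mulr_ge0 ?exprn_ge0 ?sqrtr_ge0.
- move=> k; rewrite /= -(@ler_pXn2r _ 2) ?nnegrE ?mulr_ge0 ?exprn_ge0 ?sqrtr_ge0 //.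
  rewrite exprMn (sqr_sqrtr (dist2_ge0 _ _)) -exprM mulnC exprM (sqr_sqrtr q0).
  rewrite real_normK ?num_real // mulrC.
  exact: le_trans (dist2_coord (u k) (u k.+1) e) (iter_dist2 k).
apply: is_cvg_geometric_series; rewrite ger0_norm ?sqrtr_ge0 //.
by rewrite -[ltRHS]sqrtr1 ltr_sqrt.
Qed.

(** Iteration from the lower corner. The estimate is for squared Euclidean distances, so each
    coordinate is compared with a geometric series of ratio sqrt q. *)
Lemma finite_contraction : exists l, box l /\ forall e, T l e = l e.
Proof.
have /andP[q0 q1] := q01.
pose L e := limn (fun k => u k e).
have Lcvg e : (fun k => u k e) @ \oo --> L e by exact: iter_cvg.
have Lbox : box L.
  move=> e; apply/andP; split.
    by apply: limr_ge; [exact: iter_cvg | near=> k; have /andP[] := iter_box k e].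
  by apply: limr_le; [exact: iter_cvg | near=> k; have /andP[] := iter_box k e].
exists L; split=> // e.
have d0 : (fun k => dist2 L (u k)) @ \oo --> (0 : R).
  have -> : (0 : R) = \sum_(e : E) 0 by rewrite big1.
  apply: cvg_sum_seq => e'.
  have h : (fun k => u k e' - L e') @ \oo --> (0 : R).
    by rewrite -(subrr (L e')); apply: cvgB => //; exact: cvg_cst.
  by have h2 := cvgM h h; rewrite mulr0 in h2; exact: h2.
(* The contraction estimate also serves as continuity of T at the limit. *)
have d1 : (fun k => (u k.+1 e - T L e) ^+ 2) @ \oo --> (0 : R).
  apply: (@squeeze_cvgr _ _ _ _ (fun=> 0) (fun k => q * dist2 L (u k))).
  - near=> k; rewrite sqr_ge0 /=.
    exact: le_trans (dist2_coord (T L) (u k.+1) e) (contr Lbox (iter_box k)).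
  - exact: cvg_cst.
  - by rewrite -(mulr0 q); apply: cvgM d0; exact: cvg_cst.
have d2 : (fun k => (u k.+1 e - T L e) ^+ 2) @ \oo --> (L e - T L e) ^+ 2.
  have h : (fun k => u k.+1 e - T L e) @ \oo --> L e - T L e.
    by apply: cvgB; [have := Lcvg e; rewrite -cvg_shiftS; apply | exact: cvg_cst].
  exact: (cvgM h h).
have : (L e - T L e) ^+ 2 = 0 by apply: cvg_unique d2 d1.
by move/eqP; rewrite sqrf_eq0 subr_eq0 => /eqP.
Unshelve. all: by end_near. Qed.

End Contraction.

Lemma finite_lower_bound (R : realType) (E : finType) (f : E -> R) : (forall e, 0 < f e) ->
  exists2 m, 0 < m <= 1 & forall e, m <= f e.
Proof.
move=> f0; have S0 : 0 <= \sum_e (f e)^-1 by apply: sumr_ge0 => e _; rewrite invr_ge0 ltW.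
(* This is at most 1 and below every value, and it remains meaningful for empty E. *)
exists (1 + \sum_e (f e)^-1)^-1.
  by rewrite invr_gt0 ltr_wpDr //= invf_le1 ?lerDl // ltr_wpDr.
move=> e; rewrite -[leRHS]invrK lef_pV2 ?posrE ?invr_gt0 // ?ltr_wpDr //.
rewrite (bigD1 e) //= addrCA lerDl addr_ge0 // sumr_ge0 // => i _.
by rewrite invr_ge0 ltW.
Qed.

(** * Coercivity and Lipschitz bounds for the curvature *)

Section Existence.
Local Close Scope classical_set_scope.
Variables (R : realType) (n : nat) (pr : face n -> face n) (sg : face n -> {perm 'I_4}).
Implicit Types l W : Edge pr sg -> R.

Let S W := \sum_(e : {X | X \in edgeSet pr sg}) W e ^+ 2.

Definition inboxE (m : R) l := forall e, 0 < l e /\ 1 + m <= cosh (l e) <= 2 + m.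

Lemma tet6_seg l W s t (i j k h : 'I_4) : tet6 (lenOf (fun e => l e + s * W e)) t i j k h =
  seg (tet6 (lenOf l) t i j k h) (tet6 (lenOf W) t i j k h) s.
Proof.
have h1 x : lenOf (fun e => l e + s * W e) x = lenOf l x + s * lenOf W x.
  by rewrite /lenOf; case: insub => // ; rewrite mulr0 addr0.
by rewrite /tet6 /seg /= !h1.
Qed.

Lemma inboxE_tet6 m l t (i j k h : 'I_4) : inboxE m l -> uniq [:: i; j; k; h] ->
  positive (tet6 (lenOf l) t i j k h) /\ inbox (1 + m) (2 + m) (coshs (tet6 (lenOf l) t i j k h)).
Proof.
move=> lb u; split; first by apply: allsix_tet6 => // e; have [] := lb e.
have : allsix (fun s => 1 + m <= cosh s <= 2 + m) (tet6 (lenOf l) t i j k h).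
  by apply: allsix_tet6 => // e; have [] := lb e.
by [].
Qed.

Lemma sum_dot_ge W : S W <=
  \sum_(t : 'I_n) dot (tet6 (lenOf W) t o0 o1 o2 o3) (tet6 (lenOf W) t o0 o1 o2 o3).
Proof.
rewrite -pairing_tet; apply: ler_sum => e _.
rewrite (eq_bigr (fun=> W e)); last by move=> x xe; rewrite (lenOf_preE _ xe).
rewrite sumr_const -[#|_|]/(valence e) expr2.
have [x xe] := preE_inh e; have v1 : (0 < valence e)%N by apply/card_gt0P; exists x.
by rewrite -[W e *+ _]mulr_natl mulrCA ler_peMl ?ler1n // -expr2 sqr_ge0.
Qed.

(** The curvature is 2 pi minus a sum of angles, so the constants cancel and the pairing decreases
    where that of the angles grows. Only the fraction s of the segment has to lie in the box. *)
Lemma pairing_coercive m : 0 < m <= 1 -> exists2 c, 0 < c & forall l W s, 0 < s <= 1 ->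
  inboxE m l -> (forall e, 0 < l e + W e) -> inboxE m (fun e => l e + s * W e) ->
  c * s * S W <= pairing W l - pairing W (fun e => l e + W e).
Proof.
move=> m01; have [c c0 far] := @coercive_far R m m01; exists c => // l W s s01 lb lW lsW.
have s0 : 0 < s by case/andP: s01.
rewrite !pairingE opprD addrACA subrr add0r opprK addrC -sumrB.
have h := sum_dot_ge W; rewrite -(ler_pM2l (mulr_gt0 c0 s0)) in h; apply: le_trans h _.
rewrite mulr_sumr; apply: ler_sum => t _.
have u : uniq [:: o0; o1; o2; o3] by [].
have E1 : (fun e => l e + W e) = (fun e => l e + 1 * W e) by apply/funext => e; rewrite mul1r.
have [p1 b1] := inboxE_tet6 t lb u; have [_ b2] := inboxE_tet6 t lsW u.
rewrite tet6_seg in b2.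
rewrite E1 tet6_seg; apply: far => //.
by rewrite -tet6_seg -E1; apply: allsix_tet6.
Qed.

Lemma lenOf_sqr_le W x : x \in hatE n -> `|lenOf W x| <= Num.sqrt (S W).
Proof.
move=> xE; have [e xe] := edge_of pr sg xE; rewrite (lenOf_preE _ xe) -sqrtr_sqr ler_wsqrtr //.
rewrite /S (bigD1 (e : {X | X \in edgeSet pr sg})) //= lerDl.
by apply: sumr_ge0 => *; exact: sqr_ge0.
Qed.

Lemma curv_lipschitz m : 0 < m <= 1 -> exists2 B, 0 <= B & forall l W e,
  inboxE m l -> inboxE m (fun e => l e + W e) ->
  (curv (fun e => l e + W e) e - curv l e) ^+ 2 <= B * S W.
Proof.
move=> m01; have [K K0 lip] := @lipschitz_box R m m01.
pose N : R := #|{: hatEdge n}|%:R.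
have S0 W : 0 <= S W by apply: sumr_ge0 => *; exact: sqr_ge0.
exists ((N * (K * 6)) ^+ 2); first exact: sqr_ge0.
move=> l W e lb lWb.
have E1 : (fun e => l e + W e) = (fun e => l e + 1 * W e) by apply/funext => f; rewrite mul1r.
have da x : x \in hatE n -> `|alpha (fun e => l e + W e) x - alpha l x| <= K * 6 * Num.sqrt (S W).
  move=> xE; have [i [j [k [h [u x2]]]]] := hatE_tet xE.
  have xeq : x = (x.1, [set i; j]) by rewrite -x2 -surjective_pairing.
  have [p1 b1] := inboxE_tet6 x.1 lb u; have [p2 b2] := inboxE_tet6 x.1 lWb u.
  rewrite E1 tet6_seg in p2 b2.
  have [[+ _ _] _ _ _] := lip _ _ p1 p2 b1 b2.
  rewrite /= -tet6_seg -E1 -!(alpha_tet6 _ _ u) -xeq => h1; apply: le_trans h1 _.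
  rewrite -mulrA ler_pM2l //.
  have [[n1 n2 n3] n4 n5 n6] : allsix (fun r => `|r| <= Num.sqrt (S W)) (tet6 (lenOf W) x.1 i j k h).
    move: (u); rewrite uniq4 => /and5P[ij ik ih jk /andP[jh kh]].
    by do 2?split; apply: lenOf_sqr_le; rewrite mem_hatE cards2 ?ij ?ik ?ih ?jk ?jh ?kh.
  by rewrite /norm1; lra.
have dk : `|curv (fun e => l e + W e) e - curv l e| <= N * (K * 6) * Num.sqrt (S W).
  rewrite /curv opprD addrACA subrr add0r opprK addrC -sumrB.
  apply: le_trans (ler_norm_sum _ _ _) _.
  apply: le_trans (_ : \sum_(x in preE e) K * 6 * Num.sqrt (S W) <= _).
    by apply: ler_sum => x xe; rewrite distrC; apply: da; move: xe; rewrite inE => /andP[].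
  rewrite sumr_const -[_ *+ #|_|]mulr_natl -[leRHS]mulrA ler_wpM2r ?mulr_ge0 ?sqrtr_ge0 ?(ltW K0) //.
  by rewrite ler_nat max_card.
rewrite -[_ ^+ 2]real_normK ?num_real // -[S W in leRHS]sqr_sqrtr // -exprMn.
by rewrite lerXn2r ?nnegrE ?mulr_ge0 ?sqrtr_ge0 ?ler0n ?(ltW K0).
Qed.

End Existence.

Lemma clamp_diff (R : realType) (a b p q : R) : a <= b -> p <= q ->
  0 <= Num.max a (Num.min b q) - Num.max a (Num.min b p) <= q - p.
Proof.
move=> ab pq; rewrite !maxEle !minEle; apply/andP.
by case: (leP b q); case: (leP b p); case: (leP a b); case: (leP a p); case: (leP a q) => *; split; lra.
Qed.

(** * Existence of a zero-curvature metric in the box *)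

Section ZeroCurvature.
Local Close Scope classical_set_scope.
Variables (R : realType) (n : nat) (pr : face n -> face n) (sg : face n -> {perm 'I_4}).
Hypothesis glu : is_gluing pr sg.
Hypothesis v9 : forall e : Edge pr sg, (9 <= valence e)%N.
Implicit Types l W : Edge pr sg -> R.

Definition lower (e : Edge pr sg) : R := arccosh (1 + mu R (valence e)).
Definition upper (e : Edge pr sg) : R := arccosh (bconst R (valence e)).

Lemma lower_gt0 e : 0 < lower e.
Proof. by apply: arccosh_gt0; rewrite ltrDl; have /andP[] := mu_itv R (v9 e). Qed.

Lemma lower_le_upper e : lower e <= upper e.
Proof.
have /andP[m0 _] := mu_itv R (v9 e); have /andP[b1 _] := bconst_itv R (v9 e).
by apply: arccosh_le => //; rewrite lerDl ltW.
Qed.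

Lemma cosh_lower e : cosh (lower e) = 1 + mu R (valence e).
Proof. by apply: arccoshK; rewrite lerDl ltW //; have /andP[] := mu_itv R (v9 e). Qed.

Lemma cosh_upper e : cosh (upper e) = bconst R (valence e).
Proof.
apply: arccoshK; have /andP[m0 _] := mu_itv R (v9 e); have /andP[b1 _] := bconst_itv R (v9 e).
by apply: le_trans b1; rewrite lerDl ltW.
Qed.

Lemma upper_le e : upper e <= arccosh 2.
Proof.
have /andP[m0 _] := mu_itv R (v9 e); have /andP[b1 b2] := bconst_itv R (v9 e).
by apply: arccosh_le => //; apply: le_trans b1; rewrite lerDl ltW.
Qed.

Definition edgebox l := forall e, lower e <= l e <= upper e.

Lemma edgebox_cosh l : edgebox l ->
  forall e, 0 < l e /\ 1 + mu R (valence e) <= cosh (l e) <= bconst R (valence e).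
Proof.
move=> lb e; have /andP[h1 h2] := lb e; have l0 := lt_le_trans (lower_gt0 e) h1.
split=> //; rewrite -cosh_lower -cosh_upper.
by rewrite (cosh_le (ltW (lower_gt0 e)) h1) (cosh_le (ltW l0) h2).
Qed.

Lemma edgebox_inbox12 l : edgebox l -> inbox12 l.
Proof.
move=> lb e; have [l0 /andP[_ h]] := edgebox_cosh lb e; split=> //.
by apply: le_trans h _; have /andP[] := bconst_itv R (v9 e).
Qed.

Lemma edgebox_hyperideal l : edgebox l -> hyperideal l.
Proof.
move=> lb; split=> [e|x xE]; first by have [] := edgebox_cosh lb e.
have [i [j [k [h [u x2]]]]] := hatE_tet xE.
have -> : x = (x.1, [set i; j]) by rewrite -x2 -surjective_pairing.
have [g1 b1] := box12_tet6 x.1 (edgebox_inbox12 lb) u.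
by rewrite (phiE _ _ u); exact: phi_itv g1 (box12_ngram b1).
Qed.

Lemma mu_lower_bound : exists2 m : R, 0 < m <= 1 & forall l, edgebox l -> inboxE m l.
Proof.
have [m m01 hm] := @finite_lower_bound R {X | X \in edgeSet pr sg}
  (fun e => mu R (valence (e : Edge pr sg))) (fun e => proj1 (andP (mu_itv R (v9 e)))).
exists m => // l lb e; have [l0 /andP[h1 h2]] := edgebox_cosh lb e; split=> //.
apply/andP; split; first by apply: le_trans h1; rewrite lerD2l; exact: hm.
apply: le_trans h2 _; have /andP[_ h] := bconst_itv R (v9 e).
by apply: le_trans h _; rewrite lerDl; case/andP: m01 => /ltW.
Qed.

Definition clampE (e : Edge pr sg) (t : R) := Num.max (lower e) (Num.min (upper e) t).

Lemma clampE_itv e t : lower e <= clampE e t <= upper e.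
Proof. by rewrite /clampE le_max lexx ge_max lower_le_upper ge_min lexx. Qed.

Lemma clampE_lipschitz e s t : (clampE e s - clampE e t) ^+ 2 <= (s - t) ^+ 2.
Proof.
have [st|/ltW ts] := leP t s.
  have /andP[h1 h2] := clamp_diff (lower_le_upper e) st.
  by rewrite lerXn2r ?nnegrE // subr_ge0.
have /andP[h1 h2] := clamp_diff (lower_le_upper e) ts.
by rewrite -sqrrN opprB -[leRHS]sqrrN opprB lerXn2r ?nnegrE // subr_ge0.
Qed.

Lemma zero_curvature_of_fixpoint l (tau : R) : 0 < tau -> edgebox l ->
  (forall e, clampE e (l e + tau * curv l e) = l e) -> forall e, curv l e = 0.
Proof.
move=> tau0 lb fx; have lb12 := edgebox_inbox12 lb.
have K0 e : 0 <= curv l e.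
  rewrite leNgt; apply/negP => K.
  have : cosh (l e) <= 1 + mu R (valence e).
    rewrite -cosh_lower cosh_le //; first by apply: ltW; have [] := edgebox_cosh lb e.
    have t0 : tau * curv l e < 0 by rewrite pmulr_rlt0.
    have /andP[l1 l2] := lb e.
    move: (fx e) l1 l2 t0; rewrite /clampE maxEle minEle; move: (tau * curv l e) (lower_le_upper e) => q lu.
    by case: (leP (upper e) (l e + q)); [rewrite lu|case: (leP (lower e) (l e + q))] => *; lra.
  by move=> /(curv_ge0 lb12 (v9 e)); rewrite leNgt K.
move=> e; apply/eqP; rewrite eq_le K0 andbT leNgt; apply/negP => K.
have lu : cosh (l e) = bconst R (valence e).
  rewrite -cosh_upper; congr cosh.
  have t0 : 0 < tau * curv l e by rewrite pmulr_rgt0.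
  have /andP[l1 l2] := lb e.
  move: (fx e) l1 l2 t0; rewrite /clampE maxEle minEle; move: (tau * curv l e) (lower_le_upper e) => q lu.
  by case: (leP (upper e) (l e + q)); [rewrite lu|case: (leP (lower e) (l e + q))] => *; lra.
suff : curv l e <= 0 by rewrite leNgt K.
have := v9 e; rewrite leq_eqVlt => /orP[/eqP e9|e9]; last exact: curv_le0.
by apply: curv_le0_valence9 => //; rewrite lu /bconst -e9 eqxx.
Qed.

Lemma zero_curvature_exists : exists2 l, edgebox l & forall e, curv l e = 0.
Proof.
have [m m01 mb] := mu_lower_bound.
have [c c0 coer] := @pairing_coercive R n pr sg m m01.
have [B B0 lip] := @curv_lipschitz R n pr sg m m01.
pose N : R := #|{: {X | X \in edgeSet pr sg}}|%:R.
have N0 : 0 <= N by rewrite ler0n.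
have NB : 0 <= N * B by exact: mulr_ge0.
(* Expanding the square, one step multiplies squared distances by at most 1 - 2 tau c + tau^2 N B.
   With M in place of N B the minimum is at tau = c / M, where q = 1 - c^2 / M; the summand c^2
   keeps q nonnegative and the 1 keeps M positive. *)
pose M := N * B + c ^+ 2 + 1.
have M0 : 0 < M by rewrite /M; have := sqr_ge0 c; lra.
pose tau := c / M; have tau0 : 0 < tau by exact: divr_gt0.
pose q := 1 - 2 * tau * c + tau ^+ 2 * M.
have qE : q = 1 - c ^+ 2 / M by rewrite /q /tau; field; rewrite lt0r_neq0.
have q01 : 0 <= q < 1.
  rewrite qE; apply/andP; split; last by rewrite ltrBlDr ltrDl divr_gt0 ?exprn_gt0.
  by rewrite subr_ge0 ler_pdivrMr // mul1r /M; lra.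
pose T l e := clampE e (l e + tau * curv l e).
have contr l l' : edgebox l -> edgebox l' ->
    \sum_(e : {X | X \in edgeSet pr sg}) (T l' e - T l e) ^+ 2
    <= q * \sum_(e : {X | X \in edgeSet pr sg}) (l' e - l e) ^+ 2.
  move=> lb lb'; pose W e := l' e - l e.
  have l'E : l' = (fun e => l e + W e) by apply/funext => e; rewrite /W addrC subrK.
  have l'E1 : l' = (fun e => l e + 1 * W e) by rewrite l'E; apply/funext => e; rewrite mul1r.
  set S := \sum_e (l' e - l e) ^+ 2.
  have h1 : c * S <= pairing W l - pairing W l'.
    have : c * 1 * S <= pairing W l - pairing W (fun e => l e + W e).
      apply: coer; rewrite ?ltr01 ?lexx //; first exact: mb.
        by move=> e; rewrite -[_ + _]/((fun e => l e + W e) e) -l'E; have [] := edgebox_cosh lb' e.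
      by rewrite -l'E1; exact: mb.
    by rewrite mulr1 -l'E.
  have h2 e : (curv l' e - curv l e) ^+ 2 <= B * S.
    by rewrite l'E; apply: lip; [exact: mb | rewrite -l'E; exact: mb].
  apply: le_trans (_ : \sum_(e : {X | X \in edgeSet pr sg})
      ((l' e - l e) + tau * (curv l' e - curv l e)) ^+ 2 <= _).
    apply: ler_sum => e _; apply: le_trans (clampE_lipschitz _ _ _) _.
    by rewrite le_eqVlt; apply/orP; left; apply/eqP; ring.
  have -> : \sum_(e : {X | X \in edgeSet pr sg}) ((l' e - l e) + tau * (curv l' e - curv l e)) ^+ 2
    = S - 2 * tau * (pairing W l - pairing W l')
      + tau ^+ 2 * \sum_(e : {X | X \in edgeSet pr sg}) (curv l' e - curv l e) ^+ 2.
    rewrite /pairing -sumrB !mulr_sumr -sumrB -big_split /=.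
    by apply: eq_bigr => e _; rewrite /W; ring.
  have h3 : \sum_(e : {X | X \in edgeSet pr sg}) (curv l' e - curv l e) ^+ 2 <= N * B * S.
    apply: le_trans (_ : \sum_(e : {X | X \in edgeSet pr sg}) B * S <= _); first by apply: ler_sum.
    by rewrite sumr_const -[_ *+ #|_|]mulr_natl mulrA lexx.
  have S0 : 0 <= S by apply: sumr_ge0 => *; exact: sqr_ge0.
  have h4 : tau ^+ 2 * \sum_(e : {X | X \in edgeSet pr sg}) (curv l' e - curv l e) ^+ 2
      <= tau ^+ 2 * (M * S).
    rewrite ler_pM2l ?exprn_gt0 //; apply: le_trans h3 _; rewrite ler_wpM2r // /M.
    by rewrite -addrA lerDl addr_ge0 // sqr_ge0.
  have h5 : 2 * tau * (c * S) <= 2 * tau * (pairing W l - pairing W l').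
    by rewrite ler_pM2l // mulr_gt0.
  rewrite [leRHS](_ : _ = S - 2 * tau * (c * S) + tau ^+ 2 * (M * S)); last by rewrite /q; ring.
  by apply: lerD h4; rewrite lerD2l lerN2.
have [l [lb fx]] := finite_contraction lower_le_upper
  (fun l e => clampE_itv e (l e + tau * curv l e)) q01 contr.
by exists l => //; exact: zero_curvature_of_fixpoint tau0 lb fx.
Qed.

End ZeroCurvature.

(** * Differential inequalities and the entropy *)

Section Comparison.
Variable R : realType.
Implicit Types f df : R -> R.

Lemma continuous_of_deriv_right f df (b : R) : 0 < b -> (forall t : R, 0 < t -> is_derive t 1 f (df t)) ->
  f @ 0^'+ --> f 0 -> {within `[0, b], continuous f}.
Proof.
move=> b0 fd f0; apply/(continuous_within_itvP _ b0); split=> //.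
  by move=> t; rewrite in_itv /= => /andP[t0 _]; exact: is_derive_continuous (fd _ t0).
by apply: cvg_at_left_filter; exact: is_derive_continuous (fd _ b0).
Qed.

(** Derivatives for t > 0 and right continuity at 0 are what a solution of the flow provides. *)
Lemma le_of_deriv_le0 f df : (forall t : R, 0 < t -> is_derive t 1 f (df t)) ->
  f @ 0^'+ --> f 0 -> (forall t : R, 0 < t -> df t <= 0) -> forall t : R, 0 <= t -> f t <= f 0.
Proof.
move=> fd f0 d0 t; rewrite le_eqVlt => /orP[/eqP<-//|t0].
have fd' s : s \in `]0, t[%R -> is_derive s 1 f (df s) by rewrite in_itv /= => /andP[/fd].
have [c] := MVT t0 fd' (continuous_of_deriv_right t0 fd f0).
rewrite in_itv /= subr0 => /andP[c0 _] E.
by rewrite -subr_le0 E mulr_le0_ge0 ?d0 // ltW.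
Qed.

Lemma is_derive_sum_seq (I : Type) (s : seq I) (g : I -> R -> R) (dg : I -> R) (t : R) :
  (forall i, is_derive t 1 (g i) (dg i)) ->
  is_derive t 1 (fun u => \sum_(i <- s) g i u) (\sum_(i <- s) dg i).
Proof.
move=> h; elim: s => [|i s IH].
  have -> : (fun u => \sum_(i <- [::]) g i u) = (fun=> 0) by apply/funext => u; rewrite big_nil.
  by rewrite big_nil; exact: derC.
have -> : (fun u => \sum_(j <- i :: s) g j u) = (fun u => g i u + \sum_(j <- s) g j u).
  by apply/funext => u; rewrite big_cons.
by rewrite big_cons; exact: derD.
Qed.

(* The square of a solution of f' = K f times exp(2 M t) is nondecreasing, so f
   never vanishes. *)
Lemma linear_ode_pos f (K : R -> R) (M : R) : 0 < f 0 ->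
  (forall t : R, 0 < t -> is_derive t 1 f (K t * f t)) -> f @ 0^'+ --> f 0 ->
  (forall t : R, `|K t| <= M) -> forall t : R, 0 <= t -> 0 < f t.
Proof.
move=> f0 fd fc KM.
pose g t := - (f t ^+ 2 * expR (2 * M * t)).
have e2 (t : R) : is_derive t 1 (fun t => expR (2 * M * t)) (expR (2 * M * t) * (2 * M)).
  apply: der_comp (is_derive_expR _) _.
  by apply: is_derive_eq (derM (derC (2 * M) t) (is_derive_id t 1)) _; ring.
have gd (t : R) : 0 < t -> is_derive t 1 g (- (2 * (f t ^+ 2 * expR (2 * M * t)) * (K t + M))).
  by move=> t0; apply: is_derive_eq (derN (derM (derX2 (fd t t0)) (e2 t))) _; ring.
have gc : g @ 0^'+ --> g 0.
  apply: cvgN; apply: cvgM; first by rewrite expr2; exact: (cvgM fc fc).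
  by apply: cvg_at_right_filter; exact: is_derive_continuous (e2 0).
have g0 (t : R) : 0 <= t -> g t <= g 0.
  apply: le_of_deriv_le0 gd gc _ t => t t0; rewrite oppr_le0 mulr_ge0 //.
    by rewrite mulr_ge0 // mulr_ge0 ?sqr_ge0 ?expR_ge0.
  by have := KM t; rewrite ler_norml; lra.
have fn (t : R) : 0 <= t -> f t != 0.
  move=> t0; apply/eqP => ft; have := g0 t t0.
  rewrite /g ft expr0n /= mul0r oppr0 leNgt oppr_lt0 mulr0 expR0 mulr1.
  by rewrite exprn_gt0.
move=> t t0; rewrite ltNge; apply/negP => ft.
have tp : 0 < t by rewrite lt_neqAle t0 andbT; apply/eqP => E; move: ft; rewrite -E leNgt f0.
have zI : Num.min (f 0) (f t) <= 0 <= Num.max (f 0) (f t).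
  by rewrite ge_min ft orbT le_max (ltW f0).
have [c] := IVT t0 (continuous_of_deriv_right tp fd fc) zI.
by rewrite in_itv /= => /andP[/fn/eqP cn _].
Qed.

(* Along [x' = K x] the entropy has derivative [(x - z) K]. *)
Definition entropy (z x : R) := x - z - z * (ln x - ln z).

(** From ln q <= q - 1 with q = sqrt (x / z). The companion upper bound uses q = z / x. *)
Lemma entropy_ge (z x : R) : 0 < z -> 0 < x -> (Num.sqrt x - Num.sqrt z) ^+ 2 <= entropy z x.
Proof.
move=> z0 x0; have sz : 0 < Num.sqrt z by rewrite sqrtr_gt0.
have sx : 0 < Num.sqrt x by rewrite sqrtr_gt0.
have h : ln (Num.sqrt x) - ln (Num.sqrt z) <= Num.sqrt x / Num.sqrt z - 1.
  rewrite -ln_div ?posrE //; set q := _ / _; have q0 : 0 < q by exact: divr_gt0.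
  by rewrite -{1}(subrK 1 q) addrC; apply: le_ln1Dx; lra.
have lx : ln x = 2 * ln (Num.sqrt x) by rewrite -{1}(sqr_sqrtr (ltW x0)) lnXn // mulr_natl.
have lz : ln z = 2 * ln (Num.sqrt z) by rewrite -{1}(sqr_sqrtr (ltW z0)) lnXn // mulr_natl.
rewrite /entropy lx lz -mulrBr; rewrite -(ler_pM2l z0) in h.
have zz : z * (Num.sqrt x / Num.sqrt z - 1) = Num.sqrt z * Num.sqrt x - z.
  by rewrite -{1 4}(sqr_sqrtr (ltW z0)); field; exact: lt0r_neq0.
rewrite zz in h; rewrite sqrrB (sqr_sqrtr (ltW x0)) (sqr_sqrtr (ltW z0)); clear - h; lra.
Qed.

Lemma entropy_le (z x : R) : 0 < z -> 0 < x -> x * entropy z x <= (x - z) ^+ 2.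
Proof.
move=> z0 x0; have h : ln z - ln x <= z / x - 1.
  rewrite -ln_div ?posrE //; set q := _ / _; have q0 : 0 < q by exact: divr_gt0.
  by rewrite -{1}(subrK 1 q) addrC; apply: le_ln1Dx; lra.
have e : x * (z / x - 1) = z - x by field; exact: lt0r_neq0.
rewrite -(ler_pM2l x0) e in h.
by rewrite -(ler_pM2l z0) in h; rewrite /entropy; clear - h; lra.
Qed.

Lemma entropy_ge0 (z x : R) : 0 < z -> 0 < x -> 0 <= entropy z x.
Proof. by move=> z0 x0; apply: le_trans (entropy_ge z0 x0); exact: sqr_ge0. Qed.

(** Ends of a sublevel set of the entropy: the lower one drops the term x from the inequality, the
    upper one comes from [entropy_ge]. They keep the flow away from 0 and infinity. *)
Definition entropy_lo (P z : R) := expR (ln z - (P + z) / z).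
Definition entropy_hi (P z : R) := (Num.sqrt z + Num.sqrt P) ^+ 2.

Lemma entropy_bounds (P z x : R) : 0 < z -> 0 < x -> entropy z x <= P ->
  entropy_lo P z <= x <= entropy_hi P z.
Proof.
move=> z0 x0 xP; apply/andP; split.
  rewrite -[leRHS]lnK ?posrE // ler_expR lerBlDr -lerBlDl ler_pdivlMr //.
  by move: xP; rewrite /entropy; clear - x0; lra.
have P0 : 0 <= P by apply: le_trans xP; exact: entropy_ge0.
rewrite -{1}(sqr_sqrtr (ltW x0)) lerXn2r ?nnegrE ?addr_ge0 ?sqrtr_ge0 //.
rewrite -lerBlDl; apply: le_trans (ler_norm _) _; rewrite -sqrtr_sqr ler_wsqrtr //.
exact: le_trans (entropy_ge z0 x0) xP.
Qed.

Lemma is_derive_entropy (z t d : R) f : 0 < f t -> is_derive t 1 f d ->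
  is_derive t 1 (fun s => entropy z (f s)) ((1 - z / f t) * d).
Proof.
move=> ft fd.
have h := derD (derD fd (derC (- z) t)) (derN (derM (derC z t) (derD (der_comp (is_derive1_ln ft) fd) (derC (- ln z) t)))).
by apply: is_derive_eq h _; ring.
Qed.

End Comparison.

(** * Exponential convergence of the flow *)

Section EntropyFlow.
Variables (R : realType) (E : finType) (z : E -> R) (K : (E -> R) -> E -> R) (M c r : R).
Hypothesis z0 : forall e, 0 < z e.
Hypothesis KM : forall l e, `|K l e| <= M.
Hypotheses (c0 : 0 < c) (r0 : 0 < r).
Let S (l : E -> R) := \sum_e (l e - z e) ^+ 2.
Hypothesis coercive : forall l, (forall e, 0 < l e) ->
  \sum_e (l e - z e) * K l e <= - (c * (r / (r + Num.sqrt (S l))) * S l).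
Variable lt : R -> E -> R.
Hypothesis lt0 : forall e, 0 < lt 0 e.
Hypothesis ltc : forall e, (fun s => lt s e) @ 0^'+ --> lt 0 e.
Hypothesis ltd : forall t : R, 0 < t -> forall e, is_derive t 1 (fun s => lt s e) (K (lt t) e * lt t e).

Lemma flow_pos (t : R) e : 0 <= t -> 0 < lt t e.
Proof.
exact: (@linear_ode_pos _ (fun s => lt s e) (fun s => K (lt s) e) M (lt0 e)
  (fun s s0 => ltd s0 e) (@ltc e) (fun s => KM (lt s) e)).
Qed.

Let Psi (t : R) := \sum_e entropy (z e) (lt t e).
Let D (t : R) := \sum_e (lt t e - z e) * K (lt t) e.

Lemma is_derive_Psi (t : R) : 0 < t -> is_derive t 1 Psi (D t).
Proof.
move=> t0; have tp e := flow_pos e (ltW t0).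
have h := is_derive_sum_seq (index_enum E) (fun e => is_derive_entropy (z e) (tp e) (ltd t0 e)).
apply: is_derive_eq h _; apply: eq_bigr => e _.
by field; exact: lt0r_neq0.
Qed.

Lemma Psi_right : Psi @ 0^'+ --> Psi 0.
Proof.
apply: cvg_sum_seq => e.
have h : {for lt 0 e, continuous (entropy (z e))}.
  exact: is_derive_continuous (is_derive_entropy (z e) (lt0 e) (is_derive_id (lt 0 e) 1)).
exact: (continuous_cvg _ h (@ltc e)).
Qed.

Lemma S_ge0 l : 0 <= S l. Proof. by apply: sumr_ge0 => *; exact: sqr_ge0. Qed.

Lemma rate_gt0 (s : R) : 0 < c * (r / (r + Num.sqrt s)).
Proof. by rewrite mulr_gt0 ?divr_gt0 // ltr_wpDr ?sqrtr_ge0. Qed.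

Lemma Psi_le0 (t : R) : 0 <= t -> Psi t <= Psi 0.
Proof.
apply: le_of_deriv_le0 is_derive_Psi Psi_right _ t => t t0.
apply: le_trans (coercive (fun e => flow_pos e (ltW t0))) _.
by rewrite oppr_le0 mulr_ge0 ?S_ge0 // ltW ?rate_gt0.
Qed.

Let P := Psi 0.
Let lo e := entropy_lo P (z e).
Let hi e := entropy_hi P (z e).

Lemma entropy_le_Psi (t : R) e : 0 <= t -> entropy (z e) (lt t e) <= Psi t.
Proof.
move=> t0; rewrite /Psi (bigD1 e) //= lerDl; apply: sumr_ge0 => i _.
by apply: entropy_ge0 => //; exact: flow_pos.
Qed.

Lemma flow_bounds (t : R) e : 0 <= t -> lo e <= lt t e <= hi e.
Proof.
move=> t0; apply: entropy_bounds => //; first exact: flow_pos.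
exact: le_trans (entropy_le_Psi e t0) (Psi_le0 t0).
Qed.

Let S0 := \sum_e (hi e + z e) ^+ 2.

Lemma flow_S_le (t : R) : 0 <= t -> S (lt t) <= S0.
Proof.
move=> t0; apply: ler_sum => e _; have /andP[_ h] := flow_bounds e t0.
have x0 := flow_pos e t0; have y0 := z0 e.
have h1 : `|lt t e - z e| <= hi e + z e by rewrite ler_norml; apply/andP; split; lra.
by rewrite -[leLHS]real_normK ?num_real // lerXn2r ?nnegrE // (le_trans _ h1).
Qed.

(** S is bounded along the orbit, which bounds the coercivity rate below, and x >= p makes (x - z)^2
    dominate p times the entropy, so Psi' <= - k2 Psi. As Psi controls squares, distances decay at
    half that rate. *)
Lemma entropy_flow_cvg : exists C k : R, 0 < k /\ forall t : R, 0 <= t -> forall e,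
  `|lt t e - z e| <= C * expR (- (k * t)).
Proof.
have [p /andP[p0 _] plo] := finite_lower_bound (fun e => expR_gt0 _ : 0 < lo e).
pose k2 := c * (r / (r + Num.sqrt S0)) * p.
have k20 : 0 < k2 by rewrite mulr_gt0 ?rate_gt0.
have SPsi (t : R) : 0 <= t -> p * Psi t <= S (lt t).
  move=> t0; rewrite mulr_sumr; apply: ler_sum => e _.
  have x0 := flow_pos e t0; apply: le_trans (entropy_le (z0 e) x0).
  apply: ler_wpM2r; first exact: entropy_ge0.
  by apply: le_trans (plo e) _; have /andP[] := flow_bounds e t0.
have Dle (t : R) : 0 < t -> D t + k2 * Psi t <= 0.
  move=> t0; have t0' := ltW t0; rewrite -lerBrDr sub0r.
  apply: le_trans (coercive (fun e => flow_pos e t0')) _; rewrite lerN2 /k2 -mulrA.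
  apply: ler_pM; [exact/ltW/rate_gt0 | | | exact: SPsi].
    by rewrite mulr_ge0 ?(ltW p0) // sumr_ge0 // => e _; rewrite entropy_ge0 // flow_pos.
  rewrite ler_pM2l // ler_pM2l // lef_pV2 ?posrE ?ltr_wpDr ?sqrtr_ge0 //.
  by rewrite lerD2l ler_wsqrtr // flow_S_le.
have de (t : R) : is_derive t 1 (fun t => expR (k2 * t)) (expR (k2 * t) * k2).
  apply: der_comp (is_derive_expR _) _.
  by apply: is_derive_eq (derM (derC k2 t) (is_derive_id t 1)) _; ring.
have decay (t : R) : 0 <= t -> Psi t * expR (k2 * t) <= P.
  move=> t0; pose f t := Psi t * expR (k2 * t).
  have fd (s : R) : 0 < s -> is_derive s 1 f ((D s + k2 * Psi s) * expR (k2 * s)).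
    by move=> s0; apply: is_derive_eq (derM (is_derive_Psi s0) (de s)) _; ring.
  have fr : f @ 0^'+ --> f 0.
    apply: cvgM Psi_right _.
    by apply: cvg_at_right_filter; exact: is_derive_continuous (de 0).
  have := le_of_deriv_le0 fd fr _ t0; rewrite /f mulr0 expR0 mulr1; apply.
  by move=> s s0; rewrite mulr_le0_ge0 ?expR_ge0 // Dle.
(* Bounds the factor (sqrt x + sqrt z)^2 between (sqrt x - sqrt z)^2 and (x - z)^2. *)
pose G := \sum_e (Num.sqrt (hi e) + Num.sqrt (z e)) ^+ 2.
have G0 : 0 <= G by apply: sumr_ge0 => *; exact: sqr_ge0.
have P0 : 0 <= P by apply: sumr_ge0 => e _; rewrite entropy_ge0.
exists (Num.sqrt (P * G)), (k2 / 2); split=> [|t t0 e]; first by rewrite divr_gt0.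
have x0 := flow_pos e t0; have /andP[_ xh] := flow_bounds e t0.
rewrite -(@ler_pXn2r _ 2) ?nnegrE ?mulr_ge0 ?sqrtr_ge0 ?expR_ge0 //.
rewrite exprMn (sqr_sqrtr (mulr_ge0 P0 G0)) real_normK ?num_real //.
have -> : expR (- (k2 / 2 * t)) ^+ 2 = (expR (k2 * t))^-1.
  by rewrite -expRM_natl -expRN; congr expR; field.
have -> : (lt t e - z e) ^+ 2 = (Num.sqrt (lt t e) - Num.sqrt (z e)) ^+ 2
    * (Num.sqrt (lt t e) + Num.sqrt (z e)) ^+ 2.
  by rewrite -exprMn -subr_sqr (sqr_sqrtr (ltW x0)) (sqr_sqrtr (ltW (z0 e))).
rewrite [leRHS]mulrAC.
apply: ler_pM; rewrite ?sqr_ge0 //.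
  apply: le_trans (entropy_ge (z0 e) x0) (le_trans (entropy_le_Psi e t0) _).
  by rewrite ler_pdivlMr ?expR_gt0 // decay.
rewrite /G (bigD1 e) //= -[leLHS]addr0; apply: lerD; last by apply: sumr_ge0 => *; exact: sqr_ge0.
by rewrite lerXn2r ?nnegrE ?addr_ge0 ?sqrtr_ge0 // lerD2r ler_wsqrtr.
Qed.

End EntropyFlow.

(** * Coercivity around the solution and uniqueness *)

Section CurvatureCoercive.
Local Close Scope classical_set_scope.
Variables (R : realType) (n : nat) (pr : face n -> face n) (sg : face n -> {perm 'I_4}).
Hypothesis v9 : forall e : Edge pr sg, (9 <= valence e)%N.
Implicit Types l z : Edge pr sg -> R.

Lemma arccosh_lt (s t : R) : 1 <= s -> s < t -> arccosh s < arccosh t.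
Proof.
move=> s1 st; have t1 : 1 <= t by apply: le_trans s1 (ltW st).
by rewrite ltNge -cosh_le_mono ?arccosh_ge0 // !arccoshK // -ltNge.
Qed.

(** The segment from z to l may leave the box, but its initial fraction s = r / (r + sqrt S) changes
    each length by at most r. The rate c s is then uniform as long as S is bounded. *)
Lemma curv_coercive z : edgebox z -> (forall e, curv z e = 0) ->
  exists c r : R, [/\ 0 < c, 0 < r & forall l, (forall e, 0 < l e) ->
    let S := \sum_(e : {X | X \in edgeSet pr sg}) (l e - z e) ^+ 2 in
    \sum_(e : {X | X \in edgeSet pr sg}) (l e - z e) * curv l e
      <= - (c * (r / (r + Num.sqrt S)) * S)].
Proof.
move=> zb z0; have [m /andP[m0 m1] mb] := @mu_lower_bound R n pr sg v9.
(* Passing to m / 2 leaves room on both sides of z, whose cosh lies in [1 + m, 2]; r below measures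
   that room in lengths. *)
have h2 : 0 < m / 2 <= 1 by apply/andP; split; lra.
have [c c0 coer] := @pairing_coercive R n pr sg (m / 2) h2.
pose r := Num.min (arccosh (1 + m) - arccosh (1 + m / 2)) (arccosh (2 + m / 2) - arccosh (2 : R)).
have r0 : 0 < r.
  by rewrite lt_min !subr_gt0 !arccosh_lt //; lra.
exists c, r; split=> // l l0; cbv zeta; set S := \sum_e (l e - z e) ^+ 2.
pose W e := l e - z e.
have lE : l = (fun e => z e + W e) by apply/funext => e; rewrite /W addrC subrK.
have q0 : 0 < r + Num.sqrt S by rewrite ltr_wpDr ?sqrtr_ge0.
pose s := r / (r + Num.sqrt S).
have s0 : 0 < s by exact: divr_gt0.
have s1 : s <= 1 by rewrite ler_pdivrMr // mul1r lerDl sqrtr_ge0.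
have sW e : `|s * W e| <= r.
  rewrite normrM (gtr0_norm s0) /s mulrAC ler_pdivrMr // ler_pM2l //.
  apply: le_trans (_ : Num.sqrt S <= _); last by rewrite lerDr ltW.
  rewrite -sqrtr_sqr ler_wsqrtr // /S /W (bigD1 (e : {X | X \in edgeSet pr sg})) //= lerDl.
  by apply: sumr_ge0 => *; exact: sqr_ge0.
have zin : inboxE (m / 2) z.
  move=> e; have [ze /andP[h _]] := mb z zb e; have [_ h'] := edgebox_inbox12 v9 zb e.
  by split=> //; apply/andP; split; lra.
have zsin : inboxE (m / 2) (fun e => z e + s * W e).
  move=> e; have [ze /andP[h _]] := mb z zb e; have [_ h'] := edgebox_inbox12 v9 zb e.
  have p1 : 1 <= 1 + m / 2 by lra.
  have p2 : 1 <= 2 + m / 2 by lra.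
  have p3 : 1 <= 1 + m by lra.
  have p4 : 1 <= (2 : R) by lra.
  have z1 : arccosh (1 + m) <= z e by rewrite -cosh_le_mono ?arccosh_ge0 ?(ltW ze) // arccoshK.
  have z2 : z e <= arccosh 2 by rewrite -cosh_le_mono ?arccosh_ge0 ?(ltW ze) // arccoshK.
  have r1 : r <= arccosh (1 + m) - arccosh (1 + m / 2) by rewrite /r ge_min lexx.
  have r2 : r <= arccosh (2 + m / 2) - arccosh 2 by rewrite /r ge_min lexx orbT.
  have := sW e; rewrite ler_norml => /andP[w1 w2].
  have t1 : arccosh (1 + m / 2) <= z e + s * W e by clear - z1 r1 w1; lra.
  have t2 : z e + s * W e <= arccosh (2 + m / 2) by clear - z2 r2 w2; lra.
  have a0 : 0 < arccosh (1 + m / 2) by apply: arccosh_gt0; lra.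
  have t0 := lt_le_trans a0 t1; split=> //.
  have := cosh_le (ltW a0) t1; have := cosh_le (ltW t0) t2.
  by rewrite (arccoshK p1) (arccoshK p2) => -> ->.
have s01 : 0 < s <= 1 by rewrite s0.
have zW e : 0 < z e + W e by rewrite /W addrC subrK.
have := coer z W s s01 zin zW zsin; rewrite -lE.
have -> : pairing W z = 0 by rewrite /pairing big1 // => e _; rewrite z0 mulr0.
by rewrite sub0r lerNr.
Qed.

Lemma zero_curvature_unique z l : edgebox z -> (forall e, curv z e = 0) ->
  (forall e, 0 < l e) -> (forall e, curv l e = 0) -> l = z.
Proof.
move=> zb z0 lp l0; have [c [r [c0 r0 coer]]] := curv_coercive zb z0.
have := coer l lp; cbv zeta; set S := \sum_e (l e - z e) ^+ 2.
rewrite big1; last by move=> e _; rewrite l0 mulr0.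
have k0 : 0 < c * (r / (r + Num.sqrt S)).
  by rewrite mulr_gt0 ?divr_gt0 // ltr_wpDr ?sqrtr_ge0.
rewrite oppr_ge0 pmulr_rle0 // => S0; apply/funext => e.
have h : (l e - z e) ^+ 2 <= S.
  rewrite /S (bigD1 (e : {X | X \in edgeSet pr sg})) //= lerDl.
  by apply: sumr_ge0 => *; exact: sqr_ge0.
apply/eqP; rewrite -subr_eq0 -sqrf_eq0 eq_le sqr_ge0 andbT.
exact: le_trans h S0.
Qed.

(** Provides the constant with which [linear_ode_pos] keeps the lengths positive along the flow. *)
Lemma curv_bounded l (e : Edge pr sg) : `|curv l e| <= 2 * pi + #|{: hatEdge n}|%:R * pi :> R.
Proof.
have p0 := pi_ge0 R.
apply: le_trans (ler_normB _ _) _; rewrite ger0_norm ?mulr_ge0 // lerD2l.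
apply: le_trans (ler_norm_sum _ _ _) _.
apply: le_trans (_ : \sum_(x in preE e) pi <= _).
  by apply: ler_sum => x _; rewrite ger0_norm; [exact: cacos_lepi | exact: cacos_ge0].
by rewrite sumr_const -[_ *+ #|_|]mulr_natl ler_wpM2r // ler_nat max_card.
Qed.

End CurvatureCoercive.

Unset Implicit Arguments.

Theorem theorem1p5 (R : realType) (n : nat)
  (pr : face n -> face n) (sg : face n -> {perm 'I_4}) :
  (0 < n)%N -> is_gluing pr sg ->
  (forall e : Edge pr sg, (9 <= valence e)%N) ->
  exists l : Edge pr sg -> R,
    [/\ hyperideal l /\ (forall e : Edge pr sg, curv l e = 0),
        (forall l' : Edge pr sg -> R, (forall e : Edge pr sg, 0 < l' e) ->
            (forall e : Edge pr sg, curv l' e = 0) -> l' = l),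
        (forall e : Edge pr sg, arccosh (1 + mu R (valence e)) <= l e
                   <= arccosh (bconst R (valence e))),
        (forall e : Edge pr sg, 0 < arccosh (1 + mu R (valence e)) /\
                   arccosh (bconst R (valence e)) <= arccosh 2) &
        (forall l0 : Edge pr sg -> R, (forall e : Edge pr sg, 0 < l0 e) ->
         forall lt : R -> Edge pr sg -> R,
           (forall e : Edge pr sg, lt 0 e = l0 e) ->
           (forall e : Edge pr sg, (fun s => lt s e) @ 0^'+ --> l0 e) ->
           (forall t : R, 0 < t -> forall e : Edge pr sg,
               is_derive t 1 (fun s => lt s e) (curv (lt t) e * lt t e)) ->
           exists C c : R, 0 < c /\
             forall t : R, 0 <= t -> forall e : Edge pr sg,
               `|lt t e - l e| <= C * expR (- (c * t)))].
Proof.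
move=> n0 glu v9; have [z zb z0] := zero_curvature_exists R glu v9.
have zp e : 0 < z e by have [] := edgebox_cosh v9 zb e.
exists z; split.
- by split=> //; exact: edgebox_hyperideal.
- by move=> l lp l0; exact: (zero_curvature_unique v9 zb z0 lp l0).
- exact: zb.
- by move=> e; split; [exact: lower_gt0 | exact: upper_le].
move=> l0 l0p lt lt0 ltc ltd.
have [c [r [c0 r0 coer]]] := curv_coercive v9 zb z0.
have p0 e : 0 < lt 0 e by rewrite lt0.
have c0' e : (fun s => lt s e) @ 0^'+ --> lt 0 e by rewrite lt0; exact: ltc.
have [C [k [k0 h]]] := @entropy_flow_cvg R {X | X \in edgeSet pr sg} z (@curv R n pr sg) _ c r zp
  (fun l e => curv_bounded l e) c0 r0 coer lt p0 c0' ltd.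
by exists C, k.
Qed.
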